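(* (i) For $0<\Delta\le 1$ and $w,z\in\mathbb{C}$, \[ K_{\mathrm{SO(odd)},\pi\Delta}(w,z) = \frac{\sin\pi\Delta(z-\overline{w})}{\pi(z-\overline{w})} - \frac{1}{2 + \Delta} \left(\frac{\sin\pi\Delta z}{\pi z}\right) \left( \frac{\sin\pi\Delta \overline{w} }{\pi \overline{w}}\right). \] (ii) For any $\Delta>0$ and $w,z\in\mathbb{C}$, \[ K_{\mathrm{SO(odd)},\pi\Delta}(w,z) = K_{\mathrm{Sp},\pi\Delta}(w,z) - \frac{K_{\mathrm{Sp},\pi\Delta}(w,0)}{1 + K_{\mathrm{Sp},\pi\Delta}(0,0)}K_{\mathrm{Sp},\pi\Delta}(0,z). \]
   Context: $W_{\mathrm{Sp}}(x)=1-\frac{\sin 2\pi x}{2\pi x}$ and $W_{\mathrm{SO(odd)}}(x)=1-\frac{\sin 2\pi x}{2\pi x}+\boldsymbol{\delta}_0(x)$, with $\boldsymbol{\delta}_0$ the Dirac delta at $0$. For $G\in\{\mathrm{Sp},\mathrm{SO(odd)}\}$ and $\Delta>0$, $\mathcal{H}_{G,\pi\Delta}$ is the Hilbert space of entire functions $F$ of exponential type at most $\pi\Delta$ with $\int_{\mathbb{R}}|F|^2W_G<\infty$ and inner product $\langle F,H\rangle=\int F\overline{H}W_G$ (for $\mathrm{SO(odd)}$ this equals $\int F\overline{H}(1-\frac{\sin2\pi x}{2\pi x})dx+F(0)\overline{H(0)}$). Its reproducing kernel $K_{G,\pi\Delta}$ is the unique function on $\mathbb{C}\times\mathbb{C}$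 with $K_{G,\pi\Delta}(w,\cdot)$ in the space and $F(w)=\langle F,K_{G,\pi\Delta}(w,\cdot)\rangle$ for all $F$ and $w$. Removable singularities are interpreted by continuity. *)

(* Defs.v *)
From Stdlib Require Import Reals.
From Coquelicot Require Export Coquelicot.
Open Scope R_scope.

Definition Cexp (z : C) : C :=
  (exp (Re z) * cos (Im z), exp (Re z) * sin (Im z)).
Definition Csin (z : C) : C :=
  (Cminus (Cexp (Cmult Ci z)) (Cexp (Copp (Cmult Ci z))) / (2 * Ci))%C.

Definition C_is_zero (u : C) : bool :=
  if Req_EM_T (Re u) 0 then (if Req_EM_T (Im u) 0 then true else false) else false.

(* sincD D u = sin(pi D u) / (pi u), extended by continuity (value D) at u = 0. *)
Definition sincD (D : R) (u : C) : C :=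
  if C_is_zero u then RtoC D
  else (Csin (RtoC (PI * D) * u) / (RtoC PI * u))%C.

(* W_Sp(x) = 1 - sin(2 pi x)/(2 pi x), extended by continuity (value 0) at 0. *)
Definition W_Sp (x : R) : R :=
  if Req_EM_T x 0 then 0 else 1 - sin (2 * PI * x) / (2 * PI * x).

Definition entire (F : C -> C) : Prop := forall z : C, ex_derive F z.

Definition exp_type_le (tau : R) (F : C -> C) : Prop :=
  forall eps : R, 0 < eps ->
    exists M : R, forall z : C, Cmod (F z) <= M * exp ((tau + eps) * Cmod z).

Inductive group := Sp | SOodd.

(* Membership in H_{G, pi D}.  Since W_SOodd = W_Sp + delta_0, the
   condition int |F|^2 W_G < oo is the same for both G. *)
Definition in_space (G : group) (D : R) (F : C -> C) : Prop :=
  entire F /\ exp_type_le (PI * D) F /\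
  ex_RInt_gen (fun x : R => (Cmod (F (RtoC x)))^2 * W_Sp x)
              (Rbar_locally m_infty) (Rbar_locally p_infty).

(* Contribution of the Dirac mass at 0 to the inner product. *)
Definition atom (G : group) (F H : C -> C) : C :=
  match G with
  | Sp => RtoC 0
  | SOodd => (F (RtoC 0) * Cconj (H (RtoC 0)))%C
  end.

Definition inner_is (G : group) (F H : C -> C) (v : C) : Prop :=
  @is_RInt_gen C_R_NormedModule
    (fun x : R => (F (RtoC x) * Cconj (H (RtoC x)) * RtoC (W_Sp x))%C)
    (Rbar_locally m_infty) (Rbar_locally p_infty)
    (v - atom G F H)%C.

Definition is_repr_kernel (G : group) (D : R) (K : C -> C -> C) : Prop :=
  forall w : C, in_space G D (K w) /\
    forall F : C -> C, in_space G D F -> inner_is G F (K w) (F w).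

(* Main.v *)
Require Import Defs.
From Stdlib Require Import Reals Lra Psatz FunctionalExtensionality.
From Coquelicot Require Import Coquelicot.
Open Scope R_scope.
Open Scope C_scope.

(** Write [k_w = sincD D (. - w)].  The weight satisfies [W_Sp = 1 - sincD 2 / 2], so everything
    reduces to one reproducing identity: if [F] is entire, of exponential type at most [pi T] and
    square integrable on the real line, then [F w] is the integral of [F x sincD T (x - w)].
    Applied to [F] with [T = D] and to [F k_w], of type [2 pi D <= 2 pi], with [T = 2], it gives
    [<F, k_w>_SOodd = F w + F 0 k_w(0) / 2], and (i) is the resulting rank-one correction.

    For the identity, assume first that the type is smaller than [pi T].  The segment [[-A, A]] is
    moved to the lower half of the circle [|z| = A] and [sin] is split into exponentials; Cauchy's
    formula on the circle produces [F w], and it remains to see that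
    [F z exp (+- i pi T (z - w)) / (z - w)] has vanishing integrals over the half circles on which
    the exponential decays.  On rays away from the real axis this function decays exponentially,
    on the real axis it is integrable, and sectors of opening less than [pi / 2] between such rays
    are swept after multiplication by [exp (- e c z^2)], [e -> 0]; no Phragmen-Lindelof bound is
    needed.  The borderline type is reached by letting the band decrease to [T].

    Part (ii) and uniqueness are formal consequences of Hermitian symmetry. *)

(** * Curves in the complex plane *)

Local Notation ex_CInt := (@ex_RInt C_R_NormedModule).
Local Notation is_CInt := (@is_RInt C_R_NormedModule).
Local Notation CInt := (@RInt C_R_CompleteNormedModule).
Local Notation is_curve_derive := (@is_derive R_AbsRing C_R_NormedModule).
Local Notation Ccontinuous := (@continuous R_UniformSpace C_UniformSpace).

(** The obstacle is that growth and decay are only known in different regions. At type exactly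
    [PI * T] the decay of [exp (+- i PI T z)] never outweighs the bound on [F], in any direction;
    this is why a smaller type [k] comes before the limit in the band. With type [k] there is decay
    on the rays where [PI * T * |sin phi| > k], while close to the real axis no pointwise bound is
    at hand, only square integrability on the axis itself. A sector spanned by the axis and one
    decaying ray bridges this gap from information on its two sides alone. On the lower half circle
    only one of the two exponentials decays. The other is transferred to the upper half circle,
    where it decays in turn, and the pole at [w] met in this transfer is the source of [F w]. *)

Lemma Cmod_minus_sym (x y : C) : Cmod (x - y) = Cmod (y - x).
Proof. rewrite <- Cmod_opp. f_equal. ring. Qed.

Lemma Cmod_triangle_minus (x y : C) : (Cmod (x - y) <= Cmod x + Cmod y)%R.
Proof.
  unfold Cminus. eapply Rle_trans; [apply Cmod_triangle|].
  rewrite Cmod_opp. lra.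
Qed.

Lemma Cmod_triangle_inv (x y : C) : (Cmod x - Cmod y <= Cmod (x - y))%R.
Proof.
  pose proof (Cmod_triangle (x - y) y) as H.
  replace (x - y + y) with x in H by ring. lra.
Qed.

Lemma Rabs_Im_le_Cmod (z : C) : (Rabs (Im z) <= Cmod z)%R.
Proof. eapply Rle_trans; [apply Rmax_r | apply Rmax_Cmod]. Qed.

(** Balls of [C_UniformSpace] are coordinatewise, whereas all estimates use [Cmod]; halving the
    radius passes from the former to the latter. *)
Lemma Cmod_lt_sum (z : C) (e : R) :
  (Rabs (Re z) < e / 2 -> Rabs (Im z) < e / 2 -> Cmod z < e)%R.
Proof.
  intros H1 H2.
  replace z with (RtoC (Re z) + Ci * RtoC (Im z)).
  - eapply Rle_lt_trans; [apply Cmod_triangle|].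
    rewrite Cmod_mult, Cmod_Ci, !Cmod_R. lra.
  - destruct z; unfold RtoC, Ci, Cplus, Cmult; simpl; f_equal; ring.
Qed.

Lemma continuous_C_epsilon (f : R -> C) (x : R) :
  Ccontinuous f x <->
  (forall e : R, 0 < e -> exists d : R, 0 < d /\
     forall y : R, Rabs (y - x) < d -> Cmod (f y - f x) < e)%R.
Proof.
  split.
  - intros H e He.
    assert (He2 : (0 < e / 2)%R) by lra.
    destruct (proj1 (filterlim_locally _ _) H (mkposreal _ He2)) as [d Hd].
    exists d; split; [apply cond_pos|]. intros y Hy.
    destruct (Hd y) as [H1 H2]; [exact Hy|].
    apply Cmod_lt_sum; assumption.
  - intros H. apply filterlim_locally. intros e.
    destruct (H e (cond_pos e)) as [d [Hd Hy]].
    exists (mkposreal d Hd). intros y By.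
    apply C_NormedModule_mixin_compat1. exact (Hy y By).
Qed.

Lemma continuous_Re_Im (f : R -> C) (x : R) :
  continuous (fun t => Re (f t)) x -> continuous (fun t => Im (f t)) x ->
  Ccontinuous f x.
Proof.
  intros H1 H2. apply filterlim_locally. intros e.
  generalize (filter_and _ _ (proj1 (filterlim_locally _ _) H1 e)
                (proj1 (filterlim_locally _ _) H2 e)).
  apply filter_imp. intros y [B1 B2]. split; assumption.
Qed.

Lemma continuous_Re (f : R -> C) (x : R) :
  Ccontinuous f x -> continuous (fun t => Re (f t)) x.
Proof.
  intros H. apply filterlim_locally. intros e.
  generalize (proj1 (filterlim_locally _ _) H e).
  apply filter_imp. intros y B. apply B.
Qed.

Lemma continuous_Im (f : R -> C) (x : R) :
  Ccontinuous f x -> continuous (fun t => Im (f t)) x.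
Proof.
  intros H. apply filterlim_locally. intros e.
  generalize (proj1 (filterlim_locally _ _) H e).
  apply filter_imp. intros y B. apply B.
Qed.

Lemma continuous_Cplus (f g : R -> C) (x : R) :
  Ccontinuous f x -> Ccontinuous g x -> Ccontinuous (fun t => f t + g t) x.
Proof.
  intros Hf Hg; apply continuous_Re_Im; simpl.
  - exact (continuous_plus _ _ x (continuous_Re f x Hf) (continuous_Re g x Hg)).
  - exact (continuous_plus _ _ x (continuous_Im f x Hf) (continuous_Im g x Hg)).
Qed.

Lemma continuous_Copp (f : R -> C) (x : R) :
  Ccontinuous f x -> Ccontinuous (fun t => - f t) x.
Proof.
  intros Hf; apply continuous_Re_Im; simpl.
  - exact (continuous_opp _ x (continuous_Re f x Hf)).
  - exact (continuous_opp _ x (continuous_Im f x Hf)).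
Qed.

Lemma continuous_Cminus (f g : R -> C) (x : R) :
  Ccontinuous f x -> Ccontinuous g x -> Ccontinuous (fun t => f t - g t) x.
Proof.
  intros Hf Hg. apply continuous_Cplus; [|apply continuous_Copp]; assumption.
Qed.

Lemma continuous_Cmult (f g : R -> C) (x : R) :
  Ccontinuous f x -> Ccontinuous g x -> Ccontinuous (fun t => f t * g t) x.
Proof.
  intros Hf Hg.
  pose proof (continuous_Re f x Hf) as A. pose proof (continuous_Im f x Hf) as B.
  pose proof (continuous_Re g x Hg) as A'. pose proof (continuous_Im g x Hg) as B'.
  apply continuous_Re_Im; simpl.
  - exact (continuous_minus _ _ x (continuous_mult (K := R_AbsRing) _ _ x A A')
             (continuous_mult (K := R_AbsRing) _ _ x B B')).
  - exact (continuous_plus _ _ x (continuous_mult (K := R_AbsRing) _ _ x A B')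
             (continuous_mult (K := R_AbsRing) _ _ x B A')).
Qed.

Lemma continuous_RtoC (f : R -> R) (x : R) :
  continuous f x -> Ccontinuous (fun t => RtoC (f t)) x.
Proof.
  intros Hf; apply continuous_Re_Im; simpl; [exact Hf|apply continuous_const].
Qed.

Lemma continuous_Cmod (f : R -> C) (x : R) :
  Ccontinuous f x -> continuous (fun t => Cmod (f t)) x.
Proof.
  intros Hf.
  apply (continuous_ext (fun t => sqrt (Re (f t) ^ 2 + Im (f t) ^ 2)%R)); [reflexivity|].
  apply continuous_comp with (g := sqrt).
  - apply (continuous_plus (fun t => Re (f t) ^ 2)%R (fun t => Im (f t) ^ 2)%R).
    + apply (continuous_ext (fun t => Re (f t) * Re (f t))%R);
        [intro; simpl; ring|].
      apply (continuous_mult (K := R_AbsRing)); apply continuous_Re; exact Hf.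
    + apply (continuous_ext (fun t => Im (f t) * Im (f t))%R);
        [intro; simpl; ring|].
      apply (continuous_mult (K := R_AbsRing)); apply continuous_Im; exact Hf.
  - apply continuous_sqrt.
Qed.

Lemma is_curve_derive_pair (f : R -> C) (x : R) (l : C) :
  is_derive (fun t => Re (f t)) x (Re l) -> is_derive (fun t => Im (f t)) x (Im l) ->
  is_curve_derive f x l.
Proof.
  intros H1 H2.
  pose proof (is_derive_scal_l (V := C_R_NormedModule) _ _ _ (RtoC 1) H1) as K1.
  pose proof (is_derive_scal_l (V := C_R_NormedModule) _ _ _ Ci H2) as K2.
  pose proof (is_derive_plus _ _ _ _ _ K1 K2) as K3.
  destruct l as [a b].
  replace (a, b) with (plus (scal (Re (a, b)) (RtoC 1)) (scal (Im (a, b)) Ci)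
                       : C_R_NormedModule).
  - refine (is_derive_ext _ _ _ _ _ K3). intro t. destruct (f t) as [u v].
    unfold plus, scal, RtoC, Ci; simpl; unfold prod_plus, prod_scal; simpl;
    unfold plus, scal; simpl; unfold mult; simpl; f_equal; ring.
  - unfold plus, scal, RtoC, Ci; simpl; unfold prod_plus, prod_scal; simpl;
    unfold plus, scal; simpl; unfold mult; simpl; f_equal; ring.
Qed.

Lemma is_curve_derive_Re (f : R -> C) (x : R) (l : C) :
  is_curve_derive f x l -> is_derive (fun t => Re (f t)) x (Re l).
Proof.
  intros H.
  refine (filterdiff_comp' (U := AbsRing_NormedModule R_AbsRing) (V := C_R_NormedModule)
            (W := R_NormedModule) f (fun z : C => Re z) x _ (fun z : C => Re z) H _).
  apply (filterdiff_linear (U := C_R_NormedModule) (V := R_NormedModule)).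
  apply (is_linear_fst (U := R_NormedModule) (V := R_NormedModule)).
Qed.

Lemma is_curve_derive_Im (f : R -> C) (x : R) (l : C) :
  is_curve_derive f x l -> is_derive (fun t => Im (f t)) x (Im l).
Proof.
  intros H.
  refine (filterdiff_comp' (U := AbsRing_NormedModule R_AbsRing) (V := C_R_NormedModule)
            (W := R_NormedModule) f (fun z : C => Im z) x _ (fun z : C => Im z) H _).
  apply (filterdiff_linear (U := C_R_NormedModule) (V := R_NormedModule)).
  apply (is_linear_snd (U := R_NormedModule) (V := R_NormedModule)).
Qed.

Lemma is_curve_derive_continuous (f : R -> C) (x : R) (l : C) :
  is_curve_derive f x l -> Ccontinuous f x.
Proof.
  intros H. apply continuous_Re_Im.
  - apply (ex_derive_continuous (V := R_NormedModule)). exists (Re l).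
    apply is_curve_derive_Re; exact H.
  - apply (ex_derive_continuous (V := R_NormedModule)). exists (Im l).
    apply is_curve_derive_Im; exact H.
Qed.

Lemma is_curve_derive_mult (f g : R -> C) (x : R) (l m : C) :
  is_curve_derive f x l -> is_curve_derive g x m ->
  is_curve_derive (fun t => f t * g t) x (l * g x + f x * m).
Proof.
  intros Hf Hg.
  pose proof (is_curve_derive_Re _ _ _ Hf) as A. pose proof (is_curve_derive_Im _ _ _ Hf) as B.
  pose proof (is_curve_derive_Re _ _ _ Hg) as A'. pose proof (is_curve_derive_Im _ _ _ Hg) as B'.
  apply is_curve_derive_pair.
  - pose proof (is_derive_minus _ _ _ _ _ (Derive.is_derive_mult _ _ _ _ _ A A')
                  (Derive.is_derive_mult _ _ _ _ _ B B')) as K.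
    match type of K with is_derive _ _ ?v => replace (Re _) with v end; [exact K|].
    destruct (f x), (g x), l, m; unfold minus, plus, opp; simpl; ring.
  - pose proof (is_derive_plus _ _ _ _ _ (Derive.is_derive_mult _ _ _ _ _ A B')
                  (Derive.is_derive_mult _ _ _ _ _ B A')) as K.
    match type of K with is_derive _ _ ?v => replace (Im _) with v end; [exact K|].
    destruct (f x), (g x), l, m; unfold minus, plus, opp; simpl; ring.
Qed.

Lemma is_curve_derive_plus (f g : R -> C) (x : R) (l m : C) :
  is_curve_derive f x l -> is_curve_derive g x m ->
  is_curve_derive (fun t => f t + g t) x (l + m).
Proof. intros Hf Hg. exact (is_derive_plus _ _ _ _ _ Hf Hg). Qed.

Lemma is_curve_derive_const (c : C) (x : R) :
  is_curve_derive (fun _ => c) x (RtoC 0).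
Proof. exact (is_derive_const (V := C_R_NormedModule) c x). Qed.

Lemma is_curve_derive_cmult (c : C) (f : R -> C) (x : R) (l : C) :
  is_curve_derive f x l -> is_curve_derive (fun t => c * f t) x (c * l).
Proof.
  intros H.
  pose proof (is_curve_derive_mult _ _ _ _ _ (is_curve_derive_const c x) H) as K.
  replace (c * l) with (0 * f x + c * l) by ring. exact K.
Qed.

(** The integral lives in a real normed module, whose linearity only covers real scalars; complex
    constants are treated through the two coordinates. *)
Lemma is_CInt_Cmult (c : C) (f : R -> C) (a b : R) (l : C) :
  is_CInt f a b l -> is_CInt (fun t => c * f t) a b (c * l).
Proof.
  intros H.
  pose proof (is_RInt_fct_extend_fst (U := R_NormedModule) (V := R_NormedModule) f a b l H) as H1.
  pose proof (is_RInt_fct_extend_snd (U := R_NormedModule) (V := R_NormedModule) f a b l H) as H2.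
  apply (is_RInt_fct_extend_pair (U := R_NormedModule) (V := R_NormedModule) (fun t => c * f t)).
  - exact (is_RInt_minus _ _ _ _ _ _ (is_RInt_scal _ _ _ (Re c) _ H1)
             (is_RInt_scal _ _ _ (Im c) _ H2)).
  - exact (is_RInt_plus _ _ _ _ _ _ (is_RInt_scal _ _ _ (Re c) _ H2)
             (is_RInt_scal _ _ _ (Im c) _ H1)).
Qed.

Lemma CInt_Cmult (c : C) (f : R -> C) (a b : R) :
  ex_CInt f a b -> CInt (fun t => c * f t) a b = c * CInt f a b.
Proof.
  intros H. apply (is_RInt_unique (V := C_R_CompleteNormedModule)).
  apply is_CInt_Cmult. exact (RInt_correct (V := C_R_CompleteNormedModule) _ _ _ H).
Qed.

Lemma CInt_minus (f g : R -> C) (a b : R) :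
  ex_CInt f a b -> ex_CInt g a b ->
  CInt (fun t => f t - g t) a b = CInt f a b - CInt g a b.
Proof. intros Hf Hg. exact (RInt_minus (V := C_R_CompleteNormedModule) f g a b Hf Hg). Qed.

Lemma CInt_Chasles (f : R -> C) (a b c : R) :
  ex_CInt f a b -> ex_CInt f b c -> CInt f a b + CInt f b c = CInt f a c.
Proof. intros Hf Hg. exact (RInt_Chasles (V := C_R_CompleteNormedModule) f a b c Hf Hg). Qed.

Lemma CInt_ext (f g : R -> C) (a b : R) :
  (a <= b)%R -> (forall t, (a <= t <= b)%R -> f t = g t) -> CInt f a b = CInt g a b.
Proof.
  intros Hab H. apply (RInt_ext (V := C_R_CompleteNormedModule)).
  rewrite Rmin_left, Rmax_right by exact Hab. intros; apply H; lra.
Qed.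

Lemma ex_CInt_continuous (f : R -> C) (a b : R) :
  (a <= b)%R -> (forall t, (a <= t <= b)%R -> Ccontinuous f t) -> ex_CInt f a b.
Proof.
  intros Hab H. apply (ex_RInt_continuous (V := C_R_CompleteNormedModule)).
  rewrite Rmin_left, Rmax_right by exact Hab. exact H.
Qed.

Lemma ex_RInt_continuous_on (f : R -> R) (a b : R) :
  (a <= b)%R -> (forall t, (a <= t <= b)%R -> continuous f t) -> ex_RInt f a b.
Proof.
  intros Hab H. apply (ex_RInt_continuous (V := R_CompleteNormedModule)).
  rewrite Rmin_left, Rmax_right by exact Hab. exact H.
Qed.

Lemma Cmod_CInt_le_RInt (f : R -> C) (g : R -> R) (a b : R) :
  (a <= b)%R -> ex_CInt f a b -> ex_RInt g a b ->
  (forall t, (a <= t <= b)%R -> (Cmod (f t) <= g t)%R) ->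
  (Cmod (CInt f a b) <= RInt g a b)%R.
Proof.
  intros Hab Hf Hg H. rewrite Cmod_norm.
  apply (norm_RInt_le (V := C_R_NormedModule) f g a b); [exact Hab| | |].
  - intros x Hx. rewrite <- Cmod_norm. apply H; exact Hx.
  - exact (RInt_correct (V := C_R_CompleteNormedModule) _ _ _ Hf).
  - exact (RInt_correct (V := R_CompleteNormedModule) _ _ _ Hg).
Qed.

Lemma Cmod_CInt_le (f : R -> C) (M a b : R) :
  (a <= b)%R -> ex_CInt f a b ->
  (forall t, (a <= t <= b)%R -> (Cmod (f t) <= M)%R) ->
  (Cmod (CInt f a b) <= (b - a) * M)%R.
Proof.
  intros Hab Hf H.
  eapply Rle_trans; [apply (Cmod_CInt_le_RInt f (fun _ => M)); try assumption; apply ex_RInt_const|].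
  rewrite RInt_const. apply Rle_refl.
Qed.

Lemma CInt_derive (f df : R -> C) (a b : R) :
  (a <= b)%R ->
  (forall t, (a <= t <= b)%R -> is_curve_derive f t (df t)) ->
  (forall t, (a <= t <= b)%R -> Ccontinuous df t) ->
  CInt df a b = f b - f a.
Proof.
  intros Hab H1 H2. apply (is_RInt_unique (V := C_R_CompleteNormedModule)).
  apply (is_RInt_derive (V := C_R_CompleteNormedModule) f df);
    rewrite Rmin_left, Rmax_right by exact Hab; assumption.
Qed.

(** There is no mean value point for a complex-valued function, so the mean value inequality is
    obtained by integrating the derivative. *)
Lemma curve_increment_le (f df : R -> C) (M a b : R) :
  (a <= b)%R ->
  (forall t, (a <= t <= b)%R -> is_curve_derive f t (df t)) ->
  (forall t, (a <= t <= b)%R -> Ccontinuous df t) ->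
  (forall t, (a <= t <= b)%R -> (Cmod (df t) <= M)%R) ->
  (Cmod (f b - f a) <= (b - a) * M)%R.
Proof.
  intros Hab H1 H2 H3. rewrite <- (CInt_derive f df a b Hab H1 H2).
  apply Cmod_CInt_le; try assumption. apply ex_CInt_continuous; assumption.
Qed.

(** * Complex differentiability and the exponential *)

Local Notation holo := (@ex_derive C_AbsRing C_NormedModule).

Lemma is_C_derive_epsilon (F : C -> C) (z l : C) :
  @is_derive C_AbsRing C_NormedModule F z l <->
  (forall e : R, (0 < e)%R -> exists d : R, (0 < d)%R /\
     forall y : C, (Cmod (y - z) < d)%R ->
       (Cmod (F y - F z - l * (y - z)) <= e * Cmod (y - z))%R).
Proof.
  split.
  - intros [_ H] e He.
    destruct (H z (fun P HP => HP) (mkposreal e He)) as [d Hd].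
    exists d; split; [apply cond_pos|]. intros y Hy.
    pose proof (Hd y Hy) as K.
    replace (l * (y - z)) with ((y - z) * l) by ring. exact K.
  - intros H. split.
    + apply (is_linear_scal_l (K := C_AbsRing) (V := C_NormedModule)).
    + intros x Hx.
      apply (is_filter_lim_locally_unique
               (V := AbsRing_NormedModule C_AbsRing) z x) in Hx.
      subst x. intros e.
      destruct (H e (cond_pos e)) as [d [Hd HH]].
      exists (mkposreal d Hd). intros y Hy.
      pose proof (HH y Hy) as K.
      replace (l * (y - z)) with ((y - z) * l) in K by ring. exact K.
Qed.

Lemma holo_const (c z : C) : holo (fun _ => c) z.
Proof. exists zero. apply (is_derive_const (V := C_NormedModule)). Qed.

Lemma holo_id (z : C) : holo (fun u => u) z.
Proof.
  exists (RtoC 1). apply is_C_derive_epsilon. intros e He. exists 1%R; split; [lra|].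
  intros y _. replace (y - z - 1 * (y - z)) with (RtoC 0) by ring.
  rewrite Cmod_0. apply Rmult_le_pos; [lra|apply Cmod_ge_0].
Qed.

Lemma holo_opp (f : C -> C) (z : C) : holo f z -> holo (fun u => - f u) z.
Proof. apply (ex_derive_opp (V := C_NormedModule)). Qed.

Lemma holo_minus (f g : C -> C) (z : C) :
  holo f z -> holo g z -> holo (fun u => f u - g u) z.
Proof. apply (ex_derive_minus (V := C_NormedModule)). Qed.

(* Coquelicot's product and chain rules are stated for the other normed-module structure on [C],
   which has the same norm but different balls. *)
Lemma is_derive_C_AbsRing (f : C -> C) (z l : C) :
  @is_derive C_AbsRing C_NormedModule f z l <->
  @is_derive C_AbsRing (AbsRing_NormedModule C_AbsRing) f z l.
Proof. split; intros [_ H]; split; [apply is_linear_scal_l|exact H| apply is_linear_scal_l|exact H]. Qed.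

Lemma holo_mult (f g : C -> C) (z : C) :
  holo f z -> holo g z -> holo (fun u => f u * g u) z.
Proof.
  intros [l Hl] [m Hm]. eexists. apply is_derive_C_AbsRing.
  apply is_derive_C_AbsRing in Hl, Hm.
  exact (is_derive_mult (K := C_AbsRing) f g z l m Hl Hm Cmult_comm).
Qed.

Lemma holo_comp (f g : C -> C) (z : C) :
  holo f (g z) -> holo g z -> holo (fun u => f (g u)) z.
Proof.
  intros [l Hl] [m Hm]. eexists. apply is_derive_C_AbsRing in Hm.
  exact (is_derive_comp (K := C_AbsRing) (V := C_NormedModule) f g z l m Hl Hm).
Qed.

Lemma holo_local (F : C -> C) (z : C) :
  holo F z -> forall e : R, (0 < e)%R -> exists d : R, (0 < d)%R /\
    forall y : C, (Cmod (y - z) < d)%R -> (Cmod (F y - F z) < e)%R.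
Proof.
  intros [l Hl] e He.
  destruct (proj1 (is_C_derive_epsilon F z l) Hl 1%R Rlt_0_1) as [d [Hd H]].
  pose proof (Cmod_ge_0 l) as Hl0.
  set (d' := Rmin d (e / (Cmod l + 1))%R).
  assert (0 < e / (Cmod l + 1))%R by (apply Rdiv_lt_0_compat; lra).
  exists d'; split; [apply Rmin_pos; lra|]. intros y Hy.
  assert (Cmod (y - z) < d)%R by (eapply Rlt_le_trans; [exact Hy|apply Rmin_l]).
  assert (K : (Cmod (y - z) < e / (Cmod l + 1))%R)
    by (eapply Rlt_le_trans; [exact Hy|apply Rmin_r]).
  replace (F y - F z) with ((F y - F z - l * (y - z)) + l * (y - z)) by ring.
  eapply Rle_lt_trans; [apply Cmod_triangle|]. rewrite Cmod_mult.
  pose proof (H y ltac:(assumption)) as Hy1.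
  apply (Rmult_lt_compat_r (Cmod l + 1)) in K; [|lra].
  unfold Rdiv in K. rewrite Rmult_assoc, Rinv_l in K by lra. lra.
Qed.

Lemma continuous_holo_comp (F : C -> C) (g : R -> C) (t : R) :
  holo F (g t) -> Ccontinuous g t -> Ccontinuous (fun s => F (g s)) t.
Proof.
  intros HF Hg. apply continuous_C_epsilon. intros e He.
  destruct (holo_local F (g t) HF e He) as [d [Hd H]].
  destruct (proj1 (continuous_C_epsilon g t) Hg d Hd) as [d' [Hd' H']].
  exists d'; split; [exact Hd'|]. intros y Hy. apply H, H', Hy.
Qed.

Lemma holo_inv_id (z : C) : z <> 0 -> holo Cinv z.
Proof.
  intros Hz. exists (- / (z * z)). apply is_C_derive_epsilon. intros e He.
  pose proof (proj1 (Cmod_gt_0 z) Hz) as Hm.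
  set (m := Cmod z) in *.
  (* The remainder is exactly [(y - z)^2 / (y z^2)]. The first bound keeps [Cmod y] above [m / 2];
     the second then makes the remaining quotient at most [e]. *)
  set (d := Rmin (m / 2) (e * m ^ 3 / 2)).
  assert (0 < m ^ 3)%R by (apply pow_lt; exact Hm).
  exists d; split; [apply Rmin_pos; [lra|]; nra|]. intros y Hy.
  assert (Hy1 : (Cmod (y - z) < m / 2)%R) by (eapply Rlt_le_trans; [exact Hy|apply Rmin_l]).
  assert (Hy2 : (Cmod (y - z) < e * m ^ 3 / 2)%R)
    by (eapply Rlt_le_trans; [exact Hy|apply Rmin_r]).
  assert (Hym : (m / 2 < Cmod y)%R).
  { pose proof (Cmod_triangle_inv z y) as K. rewrite Cmod_minus_sym in K. fold m in K. lra. }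
  assert (Hy0 : y <> 0) by (apply Cmod_gt_0; lra).
  replace (/ y - / z - - / (z * z) * (y - z)) with ((y - z) * (y - z) / (y * (z * z)))
    by (field; split; assumption).
  rewrite Cmod_div, !Cmod_mult by (repeat apply Cmult_neq_0; assumption). fold m.
  unfold Rdiv. rewrite Rmult_assoc, (Rmult_comm (Cmod (y - z))).
  apply Rmult_le_compat_r; [apply Cmod_ge_0|].
  assert (0 < Cmod y * (m * m))%R by nra.
  apply Rmult_le_reg_r with (Cmod y * (m * m))%R; [assumption|].
  rewrite Rmult_assoc, Rinv_l by lra. rewrite Rmult_1_r.
  apply Rle_trans with (e * m ^ 3 / 2)%R; [lra|].
  replace (e * m ^ 3 / 2)%R with (e * (m / 2 * (m * m)))%R by field.
  apply Rmult_le_compat_l; [lra|]. apply Rmult_le_compat_r; nra.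
Qed.

Lemma holo_inv (f : C -> C) (z : C) :
  holo f z -> f z <> 0 -> holo (fun u => / f u) z.
Proof.
  intros Hf Hz. apply (holo_comp Cinv f); [apply holo_inv_id; exact Hz|exact Hf].
Qed.

Lemma holo_div (f g : C -> C) (z : C) :
  holo f z -> holo g z -> g z <> 0 -> holo (fun u => f u / g u) z.
Proof. intros Hf Hg Hz. apply holo_mult; [exact Hf|apply holo_inv; assumption]. Qed.

Lemma holo_ext_loc (f g : C -> C) (z : C) (r : R) :
  (0 < r)%R -> (forall u, (Cmod (u - z) < r)%R -> f u = g u) -> holo f z -> holo g z.
Proof.
  intros Hr H [l Hl]. exists l.
  apply (is_derive_ext_loc (V := C_NormedModule) f g z l); [|exact Hl].
  exists (mkposreal r Hr). exact H.
Qed.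

(** * The complex exponential and its Taylor remainders *)

Lemma Cexp_plus (u v : C) : Cexp (u + v) = Cexp u * Cexp v.
Proof.
  destruct u as [a b], v as [c d]. unfold Cexp, Cmult, Cplus; simpl.
  rewrite exp_plus, cos_plus, sin_plus. f_equal; ring.
Qed.

Lemma Cexp_0 : Cexp 0 = 1.
Proof. unfold Cexp; simpl. rewrite exp_0, cos_0, sin_0. unfold RtoC. f_equal; ring. Qed.

Lemma Cmod_Cexp (z : C) : Cmod (Cexp z) = exp (Re z).
Proof.
  unfold Cmod, Cexp; simpl.
  replace (exp (Re z) * cos (Im z) * (exp (Re z) * cos (Im z) * 1) +
           exp (Re z) * sin (Im z) * (exp (Re z) * sin (Im z) * 1))%R
    with (exp (Re z) * exp (Re z) * ((sin (Im z))² + (cos (Im z))²))%R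
    by (unfold Rsqr; ring).
  rewrite sin2_cos2, Rmult_1_r. apply sqrt_square. left; apply exp_pos.
Qed.

Lemma Cexp_conj (z : C) : Cexp (Cconj z) = Cconj (Cexp z).
Proof.
  destruct z as [a b]. unfold Cexp, Cconj; simpl. rewrite cos_neg, sin_neg. f_equal; ring.
Qed.

Lemma exp_Re_le (z : C) : (exp (Re z) <= exp (Cmod z))%R.
Proof.
  assert (Re z <= Cmod z)%R as [H|H].
  - eapply Rle_trans; [apply Rle_abs|apply re_le_Cmod].
  - left; apply exp_increasing; exact H.
  - rewrite H; apply Rle_refl.
Qed.

Lemma exp_le (x y : R) : (x <= y -> exp x <= exp y)%R.
Proof. intros [H|H]; [left; apply exp_increasing, H|rewrite H; apply Rle_refl]. Qed.

Lemma is_curve_derive_Cexp (v : C) (t : R) :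
  is_curve_derive (fun s => Cexp (RtoC s * v)) t (v * Cexp (RtoC t * v)).
Proof.
  destruct v as [a b].
  apply is_curve_derive_pair; simpl; auto_derive; trivial; unfold Rminus; ring.
Qed.

Lemma continuous_Cexp_line (v : C) (t : R) : Ccontinuous (fun s => Cexp (RtoC s * v)) t.
Proof. eapply is_curve_derive_continuous, is_curve_derive_Cexp. Qed.

Lemma Cmod_RtoC_mult_le (t : R) (v : C) : (0 <= t <= 1)%R -> (Cmod (RtoC t * v) <= Cmod v)%R.
Proof.
  intros Ht. rewrite Cmod_mult, Cmod_R, Rabs_pos_eq by lra.
  pose proof (Cmod_ge_0 v). nra.
Qed.

Lemma continuous_RtoC_id (t : R) : Ccontinuous (fun s => RtoC s) t.
Proof. apply continuous_RtoC. apply continuous_id. Qed.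

Lemma continuous_Cconst (c : C) (t : R) : Ccontinuous (fun _ => c) t.
Proof. apply continuous_const. Qed.

Lemma is_curve_derive_line (v : C) (t : R) : is_curve_derive (fun s => RtoC s * v) t v.
Proof.
  destruct v as [a b]. apply is_curve_derive_pair; simpl; auto_derive; trivial; ring.
Qed.

(** This remainder and the next two come from integrating along the segment from [0] to [v], where
    the derivative is [v] times the previous remainder at [t v]. The crude constants, without
    factorials, suffice. *)
Lemma Cexp_remainder_1 (v : C) : (Cmod (Cexp v - 1) <= Cmod v * exp (Cmod v))%R.
Proof.
  pose proof (curve_increment_le (fun s => Cexp (RtoC s * v)) (fun s => v * Cexp (RtoC s * v))
    (Cmod v * exp (Cmod v))%R 0 1) as K. cbv beta in K.
  rewrite !Cmult_0_l, Cmult_1_l, Cexp_0 in K.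
  eapply Rle_trans; [apply K; try lra|lra].
  - intros t _. apply is_curve_derive_Cexp.
  - intros t _. apply continuous_Cmult; [apply continuous_Cconst|apply continuous_Cexp_line].
  - intros t Ht. rewrite Cmod_mult, Cmod_Cexp.
    apply Rmult_le_compat_l; [apply Cmod_ge_0|].
    eapply Rle_trans; [apply exp_Re_le|]. apply exp_le, Cmod_RtoC_mult_le, Ht.
Qed.

Lemma Cexp_remainder_2 (v : C) : (Cmod (Cexp v - 1 - v) <= Cmod v ^ 2 * exp (Cmod v))%R.
Proof.
  pose proof (curve_increment_le (fun s => Cexp (RtoC s * v) + (-(1)) * (RtoC s * v))
    (fun s => v * Cexp (RtoC s * v) + (-(1)) * v)
    (Cmod v ^ 2 * exp (Cmod v))%R 0 1) as K. cbv beta in K.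
  rewrite !Cmult_0_l, Cmult_1_l, Cexp_0 in K.
  replace (Cexp v - 1 - v) with (Cexp v + - (1) * v - (1 + - (1) * 0)) by ring.
  eapply Rle_trans; [apply K; try lra|lra].
  - intros t _. apply is_curve_derive_plus; [apply is_curve_derive_Cexp|].
    apply is_curve_derive_cmult, is_curve_derive_line.
  - intros t _. apply continuous_Cplus; [|apply continuous_Cconst].
    apply continuous_Cmult; [apply continuous_Cconst|apply continuous_Cexp_line].
  - intros t Ht. replace (v * Cexp (t * v) + - (1) * v) with (v * (Cexp (t * v) - 1)) by ring.
    rewrite Cmod_mult. simpl. rewrite Rmult_1_r, Rmult_assoc.
    apply Rmult_le_compat_l; [apply Cmod_ge_0|].
    eapply Rle_trans; [apply Cexp_remainder_1|].
    apply Rmult_le_compat; try apply Cmod_ge_0; [left; apply exp_pos| |].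
    + apply Cmod_RtoC_mult_le, Ht.
    + apply exp_le, Cmod_RtoC_mult_le, Ht.
Qed.

(** The third order is needed for the sine: in the difference of the two exponentials the quadratic
    terms cancel, leaving a cubic error, which makes [sincD] differentiable at [0]. *)
Lemma Cexp_remainder_3 (v : C) :
  (Cmod (Cexp v - 1 - v - v * v / 2) <= Cmod v ^ 3 * exp (Cmod v))%R.
Proof.
  pose proof (curve_increment_le
    (fun s => Cexp (RtoC s * v) + (-(1)) * (RtoC s * v) + (-(1) / 2) * ((RtoC s * v) * (RtoC s * v)))
    (fun s => v * Cexp (RtoC s * v) + (-(1)) * v + (-(1) / 2) * (v * (RtoC s * v) + RtoC s * v * v))
    (Cmod v ^ 3 * exp (Cmod v))%R 0 1) as K. cbv beta in K.
  rewrite !Cmult_0_l, !Cmult_1_l, Cexp_0 in K.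
  replace (Cexp v - 1 - v - v * v / 2)
    with (Cexp v + - (1) * v + - (1) / 2 * (v * v) - (1 + - (1) * 0 + - (1) / 2 * 0))
    by (field; intro H; injection H; lra).
  eapply Rle_trans; [apply K; try lra|lra].
  - intros t _. apply is_curve_derive_plus; [apply is_curve_derive_plus; [apply is_curve_derive_Cexp|]|].
    + apply is_curve_derive_cmult, is_curve_derive_line.
    + apply is_curve_derive_cmult, (is_curve_derive_mult (fun s => RtoC s * v) (fun s => RtoC s * v));
        apply is_curve_derive_line.
  - intros t _.
    assert (Ccontinuous (fun s => RtoC s * v) t)
      by (eapply is_curve_derive_continuous, is_curve_derive_line).
    apply continuous_Cplus; [apply continuous_Cplus; [|apply continuous_Cconst]|].
    + apply continuous_Cmult; [apply continuous_Cconst|apply continuous_Cexp_line].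
    + apply continuous_Cmult; [apply continuous_Cconst|].
      apply (continuous_Cplus (fun s => v * (RtoC s * v)) (fun s => RtoC s * v * v));
        apply continuous_Cmult; first [assumption | apply continuous_Cconst].
  - intros t Ht.
    replace (v * Cexp (t * v) + - (1) * v + - (1) / 2 * (v * (t * v) + t * v * v))
      with (v * (Cexp (t * v) - 1 - t * v)) by (field; intro H; injection H; lra).
    rewrite Cmod_mult. replace (Cmod v ^ 3)%R with (Cmod v * Cmod v ^ 2)%R by ring.
    rewrite Rmult_assoc.
    apply Rmult_le_compat_l; [apply Cmod_ge_0|].
    eapply Rle_trans; [apply Cexp_remainder_2|].
    apply Rmult_le_compat; [apply pow2_ge_0|left; apply exp_pos| |].
    + apply pow_incr. split; [apply Cmod_ge_0|apply Cmod_RtoC_mult_le, Ht].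
    + apply exp_le, Cmod_RtoC_mult_le, Ht.
Qed.

Lemma holo_Cexp (z : C) : holo Cexp z.
Proof.
  exists (Cexp z). apply is_C_derive_epsilon. intros e He.
  set (m := exp (Re z)). assert (Hm : (0 < m)%R) by apply exp_pos.
  set (d := Rmin 1 (e / (m * 3))).
  assert (0 < e / (m * 3))%R by (apply Rdiv_lt_0_compat; lra).
  exists d; split; [apply Rmin_pos; lra|]. intros y Hy.
  assert (Hy1 : (Cmod (y - z) < 1)%R) by (eapply Rlt_le_trans; [exact Hy|apply Rmin_l]).
  assert (Hy2 : (Cmod (y - z) < e / (m * 3))%R) by (eapply Rlt_le_trans; [exact Hy|apply Rmin_r]).
  replace (Cexp y) with (Cexp z * Cexp (y - z)) by (rewrite <- Cexp_plus; f_equal; ring).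
  replace (Cexp z * Cexp (y - z) - Cexp z - Cexp z * (y - z))
    with (Cexp z * (Cexp (y - z) - 1 - (y - z))) by ring.
  rewrite Cmod_mult, Cmod_Cexp. fold m.
  pose proof (Cexp_remainder_2 (y - z)) as K.
  set (h := Cmod (y - z)) in *. pose proof (Cmod_ge_0 (y - z)) as Hh. fold h in Hh.
  assert (exp h <= 3)%R.
  { eapply Rle_trans; [apply exp_le; left; exact Hy1|apply exp_le_3]. }
  apply Rle_trans with (m * (h ^ 2 * 3))%R.
  - apply Rmult_le_compat_l; [lra|]. eapply Rle_trans; [exact K|].
    apply Rmult_le_compat_l; [apply pow2_ge_0|assumption].
  - replace (m * (h ^ 2 * 3))%R with ((h * (m * 3)) * h)%R by ring.
    apply Rmult_le_compat_r; [exact Hh|].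
    apply (Rmult_lt_compat_r (m * 3)) in Hy2; [|lra].
    unfold Rdiv in Hy2. rewrite Rmult_assoc, Rinv_l in Hy2 by lra. lra.
Qed.

(** * Cauchy's theorem for homotopies *)

Lemma nested_intervals (a b : nat -> R) :
  (forall n, a n <= a (S n))%R -> (forall n, b (S n) <= b n)%R -> (forall n, a n <= b n)%R ->
  exists x : R, forall n, (a n <= x <= b n)%R.
Proof.
  intros Ha Hb Hab.
  assert (Ha' : forall n k, (a n <= a (n + k)%nat)%R).
  { intros n k. induction k; [rewrite Nat.add_0_r; lra|].
    rewrite Nat.add_succ_r. eapply Rle_trans; [exact IHk|apply Ha]. }
  assert (Hb' : forall n k, (b (n + k)%nat <= b n)%R).
  { intros n k. induction k; [rewrite Nat.add_0_r; lra|].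
    rewrite Nat.add_succ_r. eapply Rle_trans; [apply Hb|exact IHk]. }
  assert (Hmn : forall m n, (a m <= b n)%R).
  { intros m n. eapply Rle_trans; [apply (Ha' m n)|].
    eapply Rle_trans; [apply Hab|]. rewrite Nat.add_comm. apply Hb'. }
  destruct (completeness (fun y => exists n, y = a n)) as [x [Hx1 Hx2]].
  - exists (b 0%nat). intros y [n ->]. apply Hmn.
  - exists (a 0%nat), 0%nat. reflexivity.
  - exists x. intros n. split.
    + apply Hx1. exists n; reflexivity.
    + apply Hx2. intros y [m ->]. apply Hmn.
Qed.

Lemma exists_half_pow_lt (x d : R) : (0 < d)%R -> exists n : nat, (x * (/ 2) ^ n < d)%R.
Proof.
  intros Hd.
  destruct (pow_lt_1_zero (/ 2)%R) with (y := (d / (Rabs x + 1))%R) as [N HN].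
  - rewrite Rabs_pos_eq; lra.
  - apply Rdiv_lt_0_compat; [lra|]. pose proof (Rabs_pos x); lra.
  - exists N. specialize (HN N (le_n _)).
    pose proof (Rabs_pos x) as Hx.
    assert (Hp : (0 < (/ 2) ^ N)%R) by (apply pow_lt; lra).
    rewrite Rabs_pos_eq in HN by lra.
    apply (Rmult_lt_compat_l (Rabs x + 1)) in HN; [|lra].
    replace ((Rabs x + 1) * (d / (Rabs x + 1)))%R with d in HN by (field; lra).
    pose proof (Rle_abs x). nra.
Qed.

Section Bisection.

Context (B : R -> R -> R -> R -> C) (a0 b0 c0 d0 : R).

(** [((a, b), (c, d))] encodes the rectangle [[a, b] x [c, d]]. The half that is kept carries at
    least half of the modulus of [B], and a halving in each variable makes one of Goursat's
    quarterings. *)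
Definition half_s (r : (R * R) * (R * R)) : (R * R) * (R * R) :=
  let '((a, b), (c, d)) := r in
  let m := ((a + b) / 2)%R in
  if Rle_dec (Cmod (B a b c d) / 2) (Cmod (B a m c d)) then ((a, m), (c, d))
  else ((m, b), (c, d)).

Definition half_t (r : (R * R) * (R * R)) : (R * R) * (R * R) :=
  let '((a, b), (c, d)) := r in
  let m := ((c + d) / 2)%R in
  if Rle_dec (Cmod (B a b c d) / 2) (Cmod (B a b c m)) then ((a, b), (c, m))
  else ((a, b), (m, d)).

Definition quarter (n : nat) : (R * R) * (R * R) :=
  Nat.iter n (fun r => half_t (half_s r)) ((a0, b0), (c0, d0)).

Hypothesis split_s : forall a m b c d,
  (a0 <= a <= m)%R -> (m <= b <= b0)%R -> (c0 <= c <= d)%R -> (d <= d0)%R ->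
  B a b c d = B a m c d + B m b c d.
Hypothesis split_t : forall a b c m d,
  (a0 <= a <= b)%R -> (b <= b0)%R -> (c0 <= c <= m)%R -> (m <= d <= d0)%R ->
  B a b c d = B a b c m + B a b m d.

Definition box_ok (r : (R * R) * (R * R)) : Prop :=
  let '((a, b), (c, d)) := r in
  (a0 <= a <= b)%R /\ (b <= b0)%R /\ (c0 <= c <= d)%R /\ (d <= d0)%R.

Definition box_norm (r : (R * R) * (R * R)) : R :=
  let '((a, b), (c, d)) := r in Cmod (B a b c d).

Definition box_sub (r r' : (R * R) * (R * R)) : Prop :=
  let '((a, b), (c, d)) := r in
  let '((a', b'), (c', d')) := r' in
  (a' <= a)%R /\ (b <= b')%R /\ (c' <= c)%R /\ (d <= d')%R.

Lemma half_s_spec (r : (R * R) * (R * R)) : box_ok r ->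
  box_ok (half_s r) /\ box_sub (half_s r) r /\ (box_norm r / 2 <= box_norm (half_s r))%R /\
  (snd (fst (half_s r)) - fst (fst (half_s r)) = (snd (fst r) - fst (fst r)) / 2)%R /\
  (snd (snd (half_s r)) - fst (snd (half_s r)) = snd (snd r) - fst (snd r))%R.
Proof.
  destruct r as [[a b] [c d]]. intros (H1 & H2 & H3 & H4). unfold half_s, box_norm, box_sub, box_ok.
  set (m := ((a + b) / 2)%R).
  assert (Hm : (a <= m <= b)%R) by (unfold m; lra).
  destruct (Rle_dec _ _) as [K|K]; simpl; repeat split; try lra; try (unfold m; lra).
  rewrite (split_s a m b c d) in * by lra.
  pose proof (Cmod_triangle (B a m c d) (B m b c d)). lra.
Qed.

Lemma half_t_spec (r : (R * R) * (R * R)) : box_ok r ->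
  box_ok (half_t r) /\ box_sub (half_t r) r /\ (box_norm r / 2 <= box_norm (half_t r))%R /\
  (snd (fst (half_t r)) - fst (fst (half_t r)) = snd (fst r) - fst (fst r))%R /\
  (snd (snd (half_t r)) - fst (snd (half_t r)) = (snd (snd r) - fst (snd r)) / 2)%R.
Proof.
  destruct r as [[a b] [c d]]. intros (H1 & H2 & H3 & H4). unfold half_t, box_norm, box_sub, box_ok.
  set (m := ((c + d) / 2)%R).
  assert (Hm : (c <= m <= d)%R) by (unfold m; lra).
  destruct (Rle_dec _ _) as [K|K]; simpl; repeat split; try lra; try (unfold m; lra).
  rewrite (split_t a b c m d) in * by lra.
  pose proof (Cmod_triangle (B a b c m) (B a b m d)). lra.
Qed.

Hypothesis start_ok : (a0 <= b0)%R /\ (c0 <= d0)%R.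

Lemma quarter_spec (n : nat) :
  box_ok (quarter n) /\ box_sub (quarter (S n)) (quarter n) /\
  (Cmod (B a0 b0 c0 d0) * (/ 2) ^ n * (/ 2) ^ n <= box_norm (quarter n))%R /\
  (snd (fst (quarter n)) - fst (fst (quarter n)) = (b0 - a0) * (/ 2) ^ n)%R /\
  (snd (snd (quarter n)) - fst (snd (quarter n)) = (d0 - c0) * (/ 2) ^ n)%R.
Proof.
  assert (Step : forall r, box_ok r -> box_ok (half_t (half_s r)) /\
    box_sub (half_t (half_s r)) r /\
    (box_norm r / 4 <= box_norm (half_t (half_s r)))%R /\
    (snd (fst (half_t (half_s r))) - fst (fst (half_t (half_s r)))
       = (snd (fst r) - fst (fst r)) / 2)%R /\
    (snd (snd (half_t (half_s r))) - fst (snd (half_t (half_s r)))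
       = (snd (snd r) - fst (snd r)) / 2)%R).
  { intros r Hr. destruct (half_s_spec r Hr) as (A1 & A2 & A3 & A4 & A5).
    destruct (half_t_spec _ A1) as (B1 & B2 & B3 & B4 & B5).
    repeat split; try assumption; try lra.
    destruct (half_t (half_s r)) as [[? ?] [? ?]], (half_s r) as [[? ?] [? ?]], r as [[? ?] [? ?]].
    unfold box_sub in *. lra. }
  assert (H : box_ok (quarter n) /\
    (Cmod (B a0 b0 c0 d0) * (/ 2) ^ n * (/ 2) ^ n <= box_norm (quarter n))%R /\
    (snd (fst (quarter n)) - fst (fst (quarter n)) = (b0 - a0) * (/ 2) ^ n)%R /\
    (snd (snd (quarter n)) - fst (snd (quarter n)) = (d0 - c0) * (/ 2) ^ n)%R).
  { induction n as [|n IH].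
    - simpl. repeat split; lra.
    - destruct IH as (I1 & I2 & I3 & I4). destruct (Step _ I1) as (A1 & A2 & A3 & A4 & A5).
      change (quarter (S n)) with (half_t (half_s (quarter n))).
      repeat split; [exact A1| | |]; simpl pow; lra. }
  destruct H as (H1 & H2 & H3 & H4). destruct (Step _ H1) as (A1 & A2 & A3 & A4 & A5).
  repeat split; assumption.
Qed.

(** After [n] quarterings the modulus is at least [N / 4^n], with [N] its value on the whole box,
    while the sum of the sides is [l / 2^n]. A bound that is locally [e] times the square of this
    sum therefore forces [N <= e l^2] at the common point of the boxes. *)
Lemma additive_box_function_eq_0 :
  (forall s t, (a0 <= s <= b0)%R -> (c0 <= t <= d0)%R -> forall e, (0 < e)%R ->
     exists del, (0 < del)%R /\ forall a b c d,
       (a0 <= a <= s)%R -> (s <= b <= b0)%R -> (c0 <= c <= t)%R -> (t <= d <= d0)%R ->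
       ((b - a) + (d - c) < del)%R ->
       (Cmod (B a b c d) <= e * ((b - a) + (d - c)) ^ 2)%R) ->
  B a0 b0 c0 d0 = 0.
Proof.
  intros Hloc.
  destruct (nested_intervals (fun n => fst (fst (quarter n))) (fun n => snd (fst (quarter n))))
    as [s Hs].
  1-3: intros n; destruct (quarter_spec n) as (A1 & A2 & _);
       destruct (quarter (S n)) as [[? ?] [? ?]], (quarter n) as [[? ?] [? ?]];
       unfold box_ok, box_sub in *; simpl; lra.
  destruct (nested_intervals (fun n => fst (snd (quarter n))) (fun n => snd (snd (quarter n))))
    as [t Ht].
  1-3: intros n; destruct (quarter_spec n) as (A1 & A2 & _);
       destruct (quarter (S n)) as [[? ?] [? ?]], (quarter n) as [[? ?] [? ?]];
       unfold box_ok, box_sub in *; simpl; lra.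
  apply Cmod_eq_0. apply Rle_antisym; [|apply Cmod_ge_0].
  apply Rnot_lt_le. intros HN. set (N := Cmod (B a0 b0 c0 d0)) in *.
  set (l := ((b0 - a0) + (d0 - c0))%R).
  assert (Hl : (0 < 2 * (l ^ 2 + 1))%R) by (pose proof (pow2_ge_0 l); lra).
  (* With this [e] the inequality [N <= e l^2] becomes absurd for positive [N]; the [+ 1] covers a
     degenerate box with [l = 0]. *)
  assert (He : (0 < N / (2 * (l ^ 2 + 1)))%R) by (apply Rdiv_lt_0_compat; lra).
  destruct (Hloc s t (Hs 0%nat) (Ht 0%nat) _ He) as (del & Hdel & K).
  destruct (exists_half_pow_lt l del Hdel) as [n Hn].
  destruct (quarter_spec n) as (A1 & _ & A2 & A3 & A4). specialize (Hs n). specialize (Ht n).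
  destruct (quarter n) as [[a b] [c d]]. unfold box_ok, box_norm in *; simpl in *.
  set (p := ((/ 2) ^ n)%R) in *. assert (Hp : (0 < p)%R) by (apply pow_lt; lra).
  assert (Hsum : ((b - a) + (d - c) = l * p)%R) by (unfold l; lra).
  specialize (K a b c d). rewrite Hsum in K.
  assert (K' : (Cmod (B a b c d) <= N / (2 * (l ^ 2 + 1)) * (l * p) ^ 2)%R) by (apply K; lra).
  assert (K2 : (N * (p * p) <= N / (2 * (l ^ 2 + 1)) * l ^ 2 * (p * p))%R).
  { fold N in A2. replace (N * (p * p))%R with (N * p * p)%R by ring.
    eapply Rle_trans; [exact A2|]. eapply Rle_trans; [exact K'|]. right; ring. }
  apply Rmult_le_reg_r in K2; [|nra].
  assert (K3 : (N / (2 * (l ^ 2 + 1)) * (2 * (l ^ 2 + 1)) = N)%R) by (field; lra).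
  nra.
Qed.

End Bisection.

(** The counterclockwise integral of the form [p ds + q dt] around the rectangle. *)
Definition box_boundary (p q : R -> R -> C) (a b c d : R) : C :=
  CInt (fun s => p s c) a b + CInt (fun t => q b t) c d
  - CInt (fun s => p s d) a b - CInt (fun t => q a t) c d.

(** The affine function [al + be z] has the primitive [al z + be z^2 / 2], so its integral depends
    on the endpoints only; what remains is the approximation error [k] times the bound [L] on the
    speed. *)
Lemma curve_integral_affine_approx (f : C -> C) (g dg : R -> C) (al be : C) (k L a b : R) :
  (a <= b)%R ->
  (forall t, (a <= t <= b)%R -> is_curve_derive g t (dg t)) ->
  (forall t, (a <= t <= b)%R -> Ccontinuous dg t) ->
  (forall t, (a <= t <= b)%R -> Ccontinuous (fun u => f (g u)) t) ->
  (forall t, (a <= t <= b)%R -> (Cmod (f (g t) - (al + be * g t)) <= k)%R) ->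
  (forall t, (a <= t <= b)%R -> (Cmod (dg t) <= L)%R) ->
  (Cmod (CInt (fun t => f (g t) * dg t)%C a b
         - ((al * g b + be / 2 * (g b * g b)) - (al * g a + be / 2 * (g a * g a))))
   <= (b - a) * (k * L))%R.
Proof.
  intros Hab Hg Hdg Hf Hk HL.
  assert (Hgc : forall t, (a <= t <= b)%R -> Ccontinuous g t)
    by (intros t Ht; eapply is_curve_derive_continuous, Hg, Ht).
  assert (Hh : forall t, (a <= t <= b)%R -> Ccontinuous (fun u => (al + be * g u) * dg u) t).
  { intros t Ht. apply continuous_Cmult; [|apply Hdg, Ht].
    apply continuous_Cplus; [apply continuous_Cconst|].
    apply continuous_Cmult; [apply continuous_Cconst|apply Hgc, Ht]. }
  rewrite <- (CInt_derive (fun t => al * g t + be / 2 * (g t * g t))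
                (fun t => (al + be * g t) * dg t) a b Hab); [| |exact Hh].
  - rewrite <- CInt_minus.
    + apply Cmod_CInt_le; [exact Hab| |].
      * apply ex_CInt_continuous; [exact Hab|]. intros t Ht.
        apply continuous_Cminus; [|apply Hh, Ht].
        apply continuous_Cmult; [apply Hf, Ht|apply Hdg, Ht].
      * intros t Ht.
        replace (f (g t) * dg t - (al + be * g t) * dg t)
          with ((f (g t) - (al + be * g t)) * dg t) by ring.
        rewrite Cmod_mult. apply Rmult_le_compat; try apply Cmod_ge_0; [apply Hk|apply HL]; exact Ht.
    + apply ex_CInt_continuous; [exact Hab|]. intros t Ht.
      apply continuous_Cmult; [apply Hf, Ht|apply Hdg, Ht].
    + apply ex_CInt_continuous; [exact Hab|exact Hh].
  - intros t Ht. specialize (Hg t Ht).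
    replace ((al + be * g t) * dg t)
      with (al * dg t + be / 2 * (dg t * g t + g t * dg t))
      by (field; intro H; injection H; lra).
    apply is_curve_derive_plus; apply is_curve_derive_cmult; [exact Hg|].
    apply is_curve_derive_mult; exact Hg.
Qed.

(* Goursat's bisection, carried out in the parameter domain of a C^1 homotopy [g]. *)
Theorem homotopy_Cauchy (f : C -> C) (g gs gt : R -> R -> C) (a0 b0 c0 d0 L : R) :
  (a0 <= b0)%R -> (c0 <= d0)%R ->
  (forall s t, (a0 <= s <= b0)%R -> (c0 <= t <= d0)%R ->
     is_curve_derive (fun u => g u t) s (gs s t) /\ is_curve_derive (fun u => g s u) t (gt s t) /\
     Ccontinuous (fun u => gs u t) s /\ Ccontinuous (fun u => gt s u) t /\
     (Cmod (gs s t) <= L)%R /\ (Cmod (gt s t) <= L)%R /\ holo f (g s t)) ->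
  box_boundary (fun s t => f (g s t) * gs s t) (fun s t => f (g s t) * gt s t) a0 b0 c0 d0 = 0.
Proof.
  intros Hab Hcd H.
  assert (Ds : forall s t, (a0 <= s <= b0)%R -> (c0 <= t <= d0)%R ->
            is_curve_derive (fun u => g u t) s (gs s t)) by (intros; apply H; assumption).
  assert (Dt : forall s t, (a0 <= s <= b0)%R -> (c0 <= t <= d0)%R ->
            is_curve_derive (fun u => g s u) t (gt s t)) by (intros; apply H; assumption).
  assert (Cgs : forall s t, (a0 <= s <= b0)%R -> (c0 <= t <= d0)%R ->
            Ccontinuous (fun u => gs u t) s)
    by (intros s t Hs Ht; exact (proj1 (proj2 (proj2 (H s t Hs Ht))))).
  assert (Cgt : forall s t, (a0 <= s <= b0)%R -> (c0 <= t <= d0)%R ->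
            Ccontinuous (fun u => gt s u) t)
    by (intros s t Hs Ht; exact (proj1 (proj2 (proj2 (proj2 (H s t Hs Ht)))))).
  assert (Bs : forall s t, (a0 <= s <= b0)%R -> (c0 <= t <= d0)%R -> (Cmod (gs s t) <= L)%R)
    by (intros s t Hs Ht; exact (proj1 (proj2 (proj2 (proj2 (proj2 (H s t Hs Ht))))))).
  assert (Bt : forall s t, (a0 <= s <= b0)%R -> (c0 <= t <= d0)%R -> (Cmod (gt s t) <= L)%R)
    by (intros s t Hs Ht; exact (proj1 (proj2 (proj2 (proj2 (proj2 (proj2 (H s t Hs Ht)))))))).
  assert (Cs : forall s t, (a0 <= s <= b0)%R -> (c0 <= t <= d0)%R ->
            Ccontinuous (fun u => f (g u t)) s).
  { intros s t Hs Ht. destruct (H s t Hs Ht) as (A1 & A2 & A3 & A4 & A5 & A6 & A7).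
    apply continuous_holo_comp; [exact A7|eapply is_curve_derive_continuous, A1]. }
  assert (Ct : forall s t, (a0 <= s <= b0)%R -> (c0 <= t <= d0)%R ->
            Ccontinuous (fun u => f (g s u)) t).
  { intros s t Hs Ht. destruct (H s t Hs Ht) as (A1 & A2 & A3 & A4 & A5 & A6 & A7).
    apply continuous_holo_comp; [exact A7|eapply is_curve_derive_continuous, A2]. }
  assert (Is : forall t a b, (c0 <= t <= d0)%R -> (a0 <= a <= b)%R -> (b <= b0)%R ->
            ex_CInt (fun s => f (g s t) * gs s t) a b).
  { intros t a b Ht Ha Hb. apply ex_CInt_continuous; [lra|]. intros s Hs.
    apply continuous_Cmult; [apply Cs; lra|apply Cgs; lra]. }
  assert (It : forall s a b, (a0 <= s <= b0)%R -> (c0 <= a <= b)%R -> (b <= d0)%R ->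
            ex_CInt (fun t => f (g s t) * gt s t) a b).
  { intros s a b Hs Ha Hb. apply ex_CInt_continuous; [lra|]. intros t Ht.
    apply continuous_Cmult; [apply Ct; lra|apply Cgt; lra]. }
  apply additive_box_function_eq_0; unfold box_boundary.
  - intros a m b c d A1 A2 A3 A4.
    rewrite <- (CInt_Chasles (fun s => f (g s c) * gs s c) a m b) by (apply Is; lra).
    rewrite <- (CInt_Chasles (fun s => f (g s d) * gs s d) a m b) by (apply Is; lra).
    ring.
  - intros a b c m d A1 A2 A3 A4.
    rewrite <- (CInt_Chasles (fun t => f (g a t) * gt a t) c m d) by (apply It; lra).
    rewrite <- (CInt_Chasles (fun t => f (g b t) * gt b t) c m d) by (apply It; lra).
    ring.
  - split; assumption.
  - intros s0 t0 Hs0 Ht0 e He.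
    destruct (H s0 t0 Hs0 Ht0) as (_ & _ & _ & _ & HL1 & _ & be & Hbe).
    assert (HL : (0 <= L)%R) by (eapply Rle_trans; [apply Cmod_ge_0|exact HL1]).
    assert (HLL : (0 < 2 * L * L + 1)%R) by nra.
    (* The affine error is [e' L l] on the whole small box, and the four sides have total parameter
       length [2 l], at speed at most [L]. The sum is [2 L^2 e' l^2], which this choice of [e']
       keeps below [e l^2]. *)
    assert (He' : (0 < e / (2 * L * L + 1))%R) by (apply Rdiv_lt_0_compat; lra).
    destruct (proj1 (is_C_derive_epsilon _ _ _) Hbe _ He') as (d1 & Hd1 & K).
    assert (Hd1' : (0 < d1 / (L + 1))%R) by (apply Rdiv_lt_0_compat; lra).
    exists (d1 / (L + 1))%R; split; [exact Hd1'|].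
    intros a b c d A1 A2 A3 A4 Hlen.
    set (l := ((b - a) + (d - c))%R) in *. assert (Hl : (0 <= l)%R) by (unfold l; lra).
    set (p0 := g s0 t0) in *. set (al := f p0 - be * p0). set (e' := (e / (2 * L * L + 1))%R) in *.
    assert (LipS : forall t x y, (c0 <= t <= d0)%R -> (a0 <= x <= y)%R -> (y <= b0)%R ->
              (Cmod (g y t - g x t) <= (y - x) * L)%R).
    { intros t x y Ht Hx Hy.
      apply (curve_increment_le (fun u => g u t) (fun u => gs u t)); [lra| | |]; intros u Hu;
        [apply Ds|apply Cgs|apply Bs]; lra. }
    assert (LipT : forall s x y, (a0 <= s <= b0)%R -> (c0 <= x <= y)%R -> (y <= d0)%R ->
              (Cmod (g s y - g s x) <= (y - x) * L)%R).
    { intros s x y Hs Hx Hy.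
      apply (curve_increment_le (fun u => g s u) (fun u => gt s u)); [lra| | |]; intros u Hu;
        [apply Dt|apply Cgt|apply Bt]; lra. }
    assert (Lip : forall s t, (a <= s <= b)%R -> (c <= t <= d)%R ->
              (Cmod (g s t - p0) <= L * l)%R).
    { intros s t Hs Ht. replace (g s t - p0) with ((g s t - g s0 t) + (g s0 t - p0)) by ring.
      eapply Rle_trans; [apply Cmod_triangle|].
      assert (Cmod (g s t - g s0 t) <= L * (b - a))%R.
      { destruct (Rle_dec s s0).
        - rewrite Cmod_minus_sym. eapply Rle_trans; [apply LipS; lra|]. nra.
        - eapply Rle_trans; [apply LipS; lra|]. nra. }
      assert (Cmod (g s0 t - p0) <= L * (d - c))%R.
      { unfold p0. destruct (Rle_dec t t0).
        - rewrite Cmod_minus_sym. eapply Rle_trans; [apply LipT; lra|]. nra.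
        - eapply Rle_trans; [apply LipT; lra|]. nra. }
      unfold l. lra. }
    assert (Hbound : forall s t, (a <= s <= b)%R -> (c <= t <= d)%R ->
              (Cmod (f (g s t) - (al + be * g s t)) <= e' * (L * l))%R).
    { intros s t Hs Ht. specialize (Lip s t Hs Ht).
      replace (f (g s t) - (al + be * g s t)) with (f (g s t) - f p0 - be * (g s t - p0))
        by (unfold al; ring).
      eapply Rle_trans; [apply K|].
      - eapply Rle_lt_trans; [exact Lip|].
        apply (Rmult_lt_compat_r (L + 1)) in Hlen; [|lra].
        unfold Rdiv in Hlen. rewrite Rmult_assoc, Rinv_l in Hlen by lra. nra.
      - apply Rmult_le_compat_l; [lra|exact Lip]. }
    (* The primitive of the affine approximation at [p0]. Its increments along the four sides
       cancel, so only the errors [u1] to [u4] survive. *)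
    set (Hf := fun z => al * z + be / 2 * (z * z)).
    assert (E1 : forall t, (c <= t <= d)%R ->
      (Cmod (CInt (fun s => f (g s t) * gs s t)%C a b - (Hf (g b t) - Hf (g a t)))
        <= (b - a) * (e' * (L * l) * L))%R).
    { intros t Ht. apply (curve_integral_affine_approx f (fun s => g s t) (fun s => gs s t));
        [lra| | | | |]; intros s Hs; [apply Ds|apply Cgs|apply Cs|apply Hbound|apply Bs]; lra. }
    assert (E2 : forall s, (a <= s <= b)%R ->
      (Cmod (CInt (fun t => f (g s t) * gt s t)%C c d - (Hf (g s d) - Hf (g s c)))
        <= (d - c) * (e' * (L * l) * L))%R).
    { intros s Hs. apply (curve_integral_affine_approx f (fun t => g s t) (fun t => gt s t));
        [lra| | | | |]; intros t Ht; [apply Dt|apply Cgt|apply Ct|apply Hbound|apply Bt]; lra. }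
    pose proof (E1 c ltac:(lra)) as X1. pose proof (E1 d ltac:(lra)) as X2.
    pose proof (E2 a ltac:(lra)) as X3. pose proof (E2 b ltac:(lra)) as X4.
    set (u1 := CInt (fun s => f (g s c) * gs s c) a b - (Hf (g b c) - Hf (g a c))) in *.
    set (u2 := CInt (fun s => f (g s d) * gs s d) a b - (Hf (g b d) - Hf (g a d))) in *.
    set (u3 := CInt (fun t => f (g a t) * gt a t) c d - (Hf (g a d) - Hf (g a c))) in *.
    set (u4 := CInt (fun t => f (g b t) * gt b t) c d - (Hf (g b d) - Hf (g b c))) in *.
    match goal with |- (Cmod ?z <= _)%R => replace z with ((u1 + u4) - (u2 + u3)) end.
    2: { unfold u1, u2, u3, u4. ring. }
    eapply Rle_trans; [apply Cmod_triangle_minus|].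
    pose proof (Cmod_triangle u1 u4). pose proof (Cmod_triangle u2 u3).
    assert (Hee : (e' * (2 * L * L + 1) = e)%R)
      by (unfold e', Rdiv; rewrite Rmult_assoc, Rinv_l by lra; ring).
    apply Rle_trans with (l * 2 * (e' * (L * l) * L))%R.
    { set (k := (e' * (L * l) * L)%R) in *. unfold l. lra. }
    replace (l * 2 * (e' * (L * l) * L))%R with (e' * (2 * L * L) * l ^ 2)%R by ring.
    apply Rmult_le_compat_r; [apply pow2_ge_0|]. unfold e' in *. lra.
Qed.

(** * Arcs at infinity in sectors *)

Definition cis (t : R) : C := (cos t, sin t).

Lemma Cmod_cis (t : R) : Cmod (cis t) = 1%R.
Proof.
  unfold Cmod, cis; simpl. pose proof (sin2_cos2 t) as H. unfold Rsqr in H.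
  match goal with |- sqrt ?x = _ => replace x with 1%R by lra end. apply sqrt_1.
Qed.

Lemma Cmod_polar (r t : R) : (0 <= r)%R -> Cmod (RtoC r * cis t) = r.
Proof. intros Hr. rewrite Cmod_mult, Cmod_cis, Cmod_R, Rabs_pos_eq by exact Hr. ring. Qed.

Lemma cis_plus (s t : R) : cis (s + t) = cis s * cis t.
Proof. unfold cis, Cmult; simpl. rewrite cos_plus, sin_plus. f_equal; ring. Qed.

Lemma is_curve_derive_cis (t : R) : is_curve_derive cis t (Ci * cis t).
Proof. apply is_curve_derive_pair; simpl; auto_derive; trivial; ring. Qed.

Lemma continuous_cis (t : R) : Ccontinuous cis t.
Proof. eapply is_curve_derive_continuous, is_curve_derive_cis. Qed.

Lemma continuous_arc_velocity (A t : R) : Ccontinuous (fun u => RtoC A * (Ci * cis u)) t.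
Proof.
  apply continuous_Cmult; [apply continuous_Cconst|].
  apply continuous_Cmult; [apply continuous_Cconst|apply continuous_cis].
Qed.

Lemma Cmod_arc_velocity (A t : R) : (0 <= A)%R -> Cmod (RtoC A * (Ci * cis t)) = A.
Proof. intros HA. rewrite !Cmod_mult, Cmod_Ci, Cmod_cis, Cmod_R, Rabs_pos_eq by exact HA. ring. Qed.

Definition arc_integral (f : C -> C) (A a b : R) : C :=
  CInt (fun t => f (RtoC A * cis t) * (RtoC A * (Ci * cis t))) a b.

Definition ray_integral (f : C -> C) (phi A B : R) : C :=
  CInt (fun r => f (RtoC r * cis phi) * cis phi) A B.

Lemma continuous_on_arc (f : C -> C) (A t : R) :
  holo f (RtoC A * cis t) -> Ccontinuous (fun u => f (RtoC A * cis u)) t.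
Proof.
  intros H. apply (continuous_holo_comp f (fun u => RtoC A * cis u)); [exact H|].
  apply continuous_Cmult; [apply continuous_Cconst|apply continuous_cis].
Qed.

Lemma continuous_on_ray (f : C -> C) (phi r : R) :
  holo f (RtoC r * cis phi) -> Ccontinuous (fun u => f (RtoC u * cis phi)) r.
Proof.
  intros H. apply (continuous_holo_comp f (fun u => RtoC u * cis phi)); [exact H|].
  apply continuous_Cmult; [apply continuous_RtoC_id|apply continuous_Cconst].
Qed.

Lemma ex_arc_integral (f : C -> C) (A a b : R) :
  (a <= b)%R -> (forall t, (a <= t <= b)%R -> holo f (RtoC A * cis t)) ->
  ex_CInt (fun t => f (RtoC A * cis t) * (RtoC A * (Ci * cis t))) a b.
Proof.
  intros Hab H. apply ex_CInt_continuous; [exact Hab|]. intros t Ht.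
  apply continuous_Cmult; [apply continuous_on_arc, H, Ht|apply continuous_arc_velocity].
Qed.

Lemma arc_integral_Chasles (f : C -> C) (A a b c : R) :
  (a <= b <= c)%R -> (forall t, (a <= t <= c)%R -> holo f (RtoC A * cis t)) ->
  arc_integral f A a b + arc_integral f A b c = arc_integral f A a c.
Proof.
  intros Hab H. apply CInt_Chasles; apply ex_arc_integral; try lra; intros; apply H; lra.
Qed.

Lemma Cmod_arc_integral_le (f : C -> C) (A a b M : R) :
  (a <= b)%R -> (0 <= A)%R -> (forall t, (a <= t <= b)%R -> holo f (RtoC A * cis t)) ->
  (forall t, (a <= t <= b)%R -> (Cmod (f (RtoC A * cis t)%C) <= M)%R) ->
  (Cmod (arc_integral f A a b) <= (b - a) * (M * A))%R.
Proof.
  intros Hab HA H HM. apply Cmod_CInt_le; [exact Hab|apply ex_arc_integral; assumption|].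
  intros t Ht. rewrite Cmod_mult, Cmod_arc_velocity by exact HA.
  apply Rmult_le_compat_r; [exact HA|apply HM, Ht].
Qed.

(** Polar coordinates serve as the homotopy. The inner arc is thus exchanged for an outer arc and
    two radial segments. *)
Lemma polar_Cauchy (f : C -> C) (A B a b : R) :
  (0 <= A <= B)%R -> (a <= b)%R ->
  (forall r t, (A <= r <= B)%R -> (a <= t <= b)%R -> holo f (RtoC r * cis t)) ->
  arc_integral f A a b = ray_integral f a A B + arc_integral f B a b - ray_integral f b A B.
Proof.
  intros HAB Hab H.
  pose proof (homotopy_Cauchy f (fun r t => RtoC r * cis t) (fun r t => cis t)
    (* [B + 1] bounds both speeds, [1] along the rays and [r <= B] along the arcs. *)
    (fun r t => RtoC r * (Ci * cis t)) A B a b (B + 1)) as K.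
  unfold box_boundary in K. unfold arc_integral, ray_integral.
  match type of K with _ -> _ -> _ -> ?e = _ => assert (K' : e = 0) end.
  - apply K; [lra|exact Hab|]. intros r t Hr Ht.
    refine (conj _ (conj _ (conj _ (conj _ (conj _ (conj _ _)))))).
    + apply is_curve_derive_line.
    + apply is_curve_derive_cmult, is_curve_derive_cis.
    + apply continuous_Cconst.
    + apply continuous_arc_velocity.
    + rewrite Cmod_cis. lra.
    + rewrite Cmod_arc_velocity; lra.
    + apply H; assumption.
  - assert (Halg : forall p q r s : C, p + q - r - s = 0 -> s = p + q - r).
    { intros p q r s E. replace s with (s + 0) by ring. rewrite <- E. ring. }
    apply Halg, K'.
Qed.

Lemma gaussian_beats_exponential (K k e theta : R) :
  (0 < e)%R -> (0 < theta)%R ->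
  exists B0, (0 <= B0)%R /\ forall B, (B0 <= B)%R -> (K * (exp (k * B) * exp (- (e * B ^ 2)) * B) <= theta)%R.
Proof.
  intros He Hth.
  (* Beyond [(k + 2) / e] the two exponentials together are at most [exp (- 2 B)]. One factor
     [exp (- B)] absorbs [B], the other absorbs [Rabs K <= theta * B]. *)
  set (B0 := Rmax 0 (Rmax ((k + 2) / e) (Rabs K / theta))).
  exists B0; split; [apply Rmax_l|]. intros B HB.
  assert (H0 : (0 <= B)%R) by (eapply Rle_trans; [apply Rmax_l|exact HB]).
  assert (H1 : ((k + 2) / e <= B)%R)
    by (eapply Rle_trans; [|exact HB]; eapply Rle_trans; [|apply Rmax_r]; apply Rmax_l).
  assert (H2 : (Rabs K / theta <= B)%R)
    by (eapply Rle_trans; [|exact HB]; eapply Rle_trans; [|apply Rmax_r]; apply Rmax_r).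
  assert (H1' : (k + 2 <= e * B)%R).
  { apply (Rmult_le_compat_l e) in H1; [|lra].
    replace (e * ((k + 2) / e))%R with (k + 2)%R in H1 by (field; lra). exact H1. }
  assert (H2' : (Rabs K <= theta * B)%R).
  { apply (Rmult_le_compat_l theta) in H2; [|lra].
    replace (theta * (Rabs K / theta))%R with (Rabs K) in H2 by (field; lra). exact H2. }
  assert (HX : (exp (k * B) * exp (- (e * B ^ 2)) * B <= exp (- B))%R).
  { apply Rle_trans with (exp (k * B) * exp (- (e * B ^ 2)) * exp B)%R.
    - apply Rmult_le_compat_l.
      + left; apply Rmult_lt_0_compat; apply exp_pos.
      + pose proof (exp_ineq1_le B). lra.
    - rewrite <- !exp_plus. apply exp_le. nra. }
  assert (HX0 : (0 <= exp (k * B) * exp (- (e * B ^ 2)) * B)%R).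
  { apply Rmult_le_pos; [left; apply Rmult_lt_0_compat; apply exp_pos|exact H0]. }
  assert (Hexp : (exp (- B) * exp B = 1)%R)
    by (rewrite <- exp_plus; replace (- B + B)%R with 0%R by ring; apply exp_0).
  pose proof (exp_ineq1_le B) as HB1. pose proof (exp_pos (- B)) as HB2.
  pose proof (Rle_abs K) as HK. pose proof (Rabs_pos K) as HK0.
  apply Rle_trans with (Rabs K * exp (- B))%R.
  - eapply Rle_trans; [apply Rmult_le_compat_r; [exact HX0|exact HK]|].
    apply Rmult_le_compat_l; assumption.
  - apply Rle_trans with (theta * exp B * exp (- B))%R; [|rewrite Rmult_assoc, (Rmult_comm (exp B)), Hexp; lra].
    apply Rmult_le_compat_r; [lra|]. nra.
Qed.

Lemma le_of_small_linear (x y Q : R) :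
  (forall e, (0 < e <= 1)%R -> (x <= y + e * Q)%R) -> (x <= y)%R.
Proof.
  intros H. apply Rnot_lt_le. intros Hlt.
  pose proof (Rabs_pos Q) as HQ. pose proof (Rle_abs Q) as HQ'.
  set (e := Rmin 1 ((x - y) / (2 * (Rabs Q + 1)))).
  assert (He1 : (0 < (x - y) / (2 * (Rabs Q + 1)))%R) by (apply Rdiv_lt_0_compat; lra).
  assert (He : (0 < e <= 1)%R) by (split; [apply Rmin_pos; lra|apply Rmin_l]).
  specialize (H e He).
  assert (He2 : (e * (2 * (Rabs Q + 1)) <= x - y)%R).
  { replace (x - y)%R with ((x - y) / (2 * (Rabs Q + 1)) * (2 * (Rabs Q + 1)))%R by (field; lra).
    apply Rmult_le_compat_r; [lra|apply Rmin_r]. }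
  nra.
Qed.

(** Absolute integrability along the ray in Cauchy form, uniform in the outer end [B], so that [B]
    can go to infinity while [A] stays fixed. *)
Definition ray_negligible (f : C -> C) (phi : R) : Prop :=
  forall eta, (0 < eta)%R -> exists A0, forall A B, (A0 <= A <= B)%R ->
    (RInt (fun r => Cmod (f (RtoC r * cis phi)%C)) A B <= eta)%R.

Definition arc_negligible (f : C -> C) (a b : R) : Prop :=
  forall eta, (0 < eta)%R -> exists A0, forall A, (A0 <= A)%R ->
    (Cmod (arc_integral f A a b) <= eta)%R.

Definition gauss (e : R) (c z : C) : C := Cexp (- (RtoC e * c * (z * z))).

Lemma holo_gauss (e : R) (c z : C) : holo (gauss e c) z.
Proof.
  apply (holo_comp Cexp (fun z => - (RtoC e * c * (z * z)))); [apply holo_Cexp|].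
  apply holo_opp, holo_mult; [apply holo_const|apply holo_mult; apply holo_id].
Qed.

(* [2 t - (a + b)] stays within [b - a < pi / 2] of [0] on the sector, so the quadratic
   exponential rotated to the bisector decays uniformly there. *)
Lemma Cmod_gauss_sector (a b r t e : R) :
  (b - a < PI / 2)%R -> (a <= t <= b)%R -> (0 <= e)%R ->
  (Cmod (gauss e (cis (- (a + b))) (RtoC r * cis t)) <= exp (- (e * cos (b - a) * r ^ 2)))%R.
Proof.
  intros Hba Ht He. unfold gauss. rewrite Cmod_Cexp. apply exp_le.
  replace (RtoC e * cis (- (a + b)) * (RtoC r * cis t * (RtoC r * cis t)))
    with (RtoC (e * r ^ 2) * (cis (- (a + b)) * (cis t * cis t))).
  2: { rewrite RtoC_mult, RtoC_pow. simpl. ring. }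
  rewrite <- !cis_plus.
  replace (Re (- (RtoC (e * r ^ 2) * cis (- (a + b) + (t + t)))))
    with (- ((e * r ^ 2) * cos (- (a + b) + (t + t))))%R by (simpl; ring).
  assert (H : (cos (b - a) <= cos (- (a + b) + (t + t)))%R).
  { destruct (Rle_dec 0 (- (a + b) + (t + t))).
    - apply cos_decr_1; lra.
    - rewrite <- (cos_neg (- (a + b) + (t + t))). apply cos_decr_1; lra. }
  assert (0 <= e * r ^ 2)%R by (apply Rmult_le_pos; [lra|apply pow2_ge_0]).
  nra.
Qed.

Lemma gauss_sub_1 (e r t : R) (c : C) : (0 <= r)%R -> (0 <= e <= 1)%R -> Cmod c = 1%R ->
  (Cmod (gauss e c (RtoC r * cis t) - 1) <= e * (r ^ 2 * exp (r ^ 2)))%R.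
Proof.
  intros Hr He Hc. unfold gauss. eapply Rle_trans; [apply Cexp_remainder_1|].
  rewrite Cmod_opp, !Cmod_mult, Hc, Cmod_cis, !Cmod_R, !Rabs_pos_eq by lra.
  replace (e * 1 * (r * 1 * (r * 1)))%R with (e * r ^ 2)%R by ring.
  pose proof (pow2_ge_0 r) as Hr2. rewrite Rmult_assoc.
  apply Rmult_le_compat_l; [lra|]. apply Rmult_le_compat_l; [exact Hr2|]. apply exp_le. nra.
Qed.

(** The Gaussian factor has modulus at most [1] on the sector, so the two radial integrals of the
    regularised function are bounded by those of [f], whatever [e]. It also makes the far arc
    vanish, since [f] has only exponential growth. The order of the limits matters: [B] to infinity
    for fixed [e], then [e] to [0] for fixed [A]. *)
Lemma sector_arc_negligible (f : C -> C) (A1 M k a b : R) :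
  (0 < A1)%R ->
  (forall z, (A1 <= Cmod z)%R -> holo f z) ->
  (forall z, (A1 <= Cmod z)%R -> (Cmod (f z) <= M * exp (k * Cmod z))%R) ->
  (a <= b)%R -> (b - a < PI / 2)%R ->
  ray_negligible f a -> ray_negligible f b -> arc_negligible f a b.
Proof.
  intros HA1 Hf HM Hab Hba Ra Rb eta Heta.
  assert (Heta2 : (0 < eta / 2)%R) by lra.
  destruct (Ra _ Heta2) as [A2 HA2]. destruct (Rb _ Heta2) as [A3 HA3].
  exists (Rmax A1 (Rmax A2 A3)). intros A HA.
  assert (HAA1 : (A1 <= A)%R) by (eapply Rle_trans; [apply Rmax_l|exact HA]).
  assert (HAA2 : (A2 <= A)%R)
    by (eapply Rle_trans; [|exact HA]; eapply Rle_trans; [|apply Rmax_r]; apply Rmax_l).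
  assert (HAA3 : (A3 <= A)%R)
    by (eapply Rle_trans; [|exact HA]; eapply Rle_trans; [|apply Rmax_r]; apply Rmax_r).
  clear HA Ra Rb.
  (* [kk] is the guaranteed rate of Gaussian decay on the sector; it is positive because the opening
     is less than [PI / 2]. *)
  set (c := cis (- (a + b))). set (kk := cos (b - a)).
  assert (Hkk : (0 < kk)%R) by (apply cos_gt_0; pose proof PI_RGT_0; lra).
  assert (Hpol : forall r t, (A <= r)%R -> (A1 <= Cmod (RtoC r * cis t))%R)
    by (intros; rewrite Cmod_polar; lra).
  assert (HfM : forall r t, (A <= r)%R -> (Cmod (f (RtoC r * cis t)%C) <= M * exp (k * r))%R).
  { intros r t Hr. pose proof (HM _ (Hpol r t Hr)) as X. rewrite Cmod_polar in X by lra. exact X. }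
  assert (HM0 : (0 <= M)%R).
  { pose proof (HfM A 0%R (Rle_refl _)) as X. pose proof (Cmod_ge_0 (f (RtoC A * cis 0))).
    pose proof (exp_pos (k * A)). nra. }
  set (fe := fun e z => f z * gauss e c z).
  assert (Hfe : forall e z, (A1 <= Cmod z)%R -> holo (fe e) z).
  { intros e z Hz. apply holo_mult; [apply Hf, Hz|apply holo_gauss]. }
  assert (Hg1 : forall e r t, (0 <= e)%R -> (a <= t <= b)%R ->
            (Cmod (gauss e c (RtoC r * cis t)) <= 1)%R).
  { intros e r t He Ht. eapply Rle_trans; [apply Cmod_gauss_sector; assumption|].
    rewrite <- exp_0. apply exp_le. fold kk. pose proof (pow2_ge_0 r).
    assert (0 <= e * kk * r ^ 2)%R by (apply Rmult_le_pos; [nra|assumption]). lra. }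
  assert (Hray : forall e phi B, (0 <= e)%R -> (phi = a \/ phi = b) -> (A <= B)%R ->
            (Cmod (ray_integral (fe e) phi A B) <= eta / 2)%R).
  { intros e phi B He Hphi HB.
    apply Rle_trans with (RInt (fun r => Cmod (f (RtoC r * cis phi)%C)) A B).
    - apply Cmod_CInt_le_RInt; [exact HB| | |].
      + apply ex_CInt_continuous; [exact HB|]. intros r Hr.
        apply continuous_Cmult; [|apply continuous_Cconst].
        apply continuous_on_ray, Hfe, Hpol; lra.
      + apply ex_RInt_continuous_on; [exact HB|]. intros r Hr.
        apply continuous_Cmod, continuous_on_ray, Hf, Hpol; lra.
      + intros r Hr. rewrite Cmod_mult, Cmod_cis. unfold fe. rewrite Cmod_mult.
        assert (a <= phi <= b)%R by (destruct Hphi; lra).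
        pose proof (Hg1 e r phi He ltac:(assumption)).
        pose proof (Cmod_ge_0 (f (RtoC r * cis phi))).
        rewrite Rmult_1_r, <- (Rmult_1_r (Cmod (f (RtoC r * cis phi)%C))) at 1.
        rewrite Rmult_1_r. rewrite <- (Rmult_1_r (Cmod (f (RtoC r * cis phi)%C))) at 2.
        apply Rmult_le_compat_l; assumption.
    - destruct Hphi as [-> | ->]; [apply HA2|apply HA3]; lra. }
  (* The arc is pushed out to radius [B], chosen so large that the outer arc contributes at most
     [th]. The resulting bound [eta] does not involve [e]. *)
  assert (Harc : forall e, (0 < e)%R -> (Cmod (arc_integral (fe e) A a b) <= eta)%R).
  { intros e He. apply le_of_small_linear with 1%R. intros th Hth.
    destruct (gaussian_beats_exponential ((b - a) * M) k (e * kk) th) as (B0 & HB0 & HB);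
      [nra|lra|].
    set (B := Rmax A B0). assert (HAB : (A <= B)%R) by apply Rmax_l.
    specialize (HB B (Rmax_r _ _)).
    rewrite (polar_Cauchy (fe e) A B a b); [|lra|exact Hab|intros; apply Hfe, Hpol; lra].
    eapply Rle_trans; [apply Cmod_triangle_minus|].
    pose proof (Cmod_triangle (ray_integral (fe e) a A B) (arc_integral (fe e) B a b)).
    pose proof (Hray e a B ltac:(lra) (or_introl eq_refl) HAB).
    pose proof (Hray e b B ltac:(lra) (or_intror eq_refl) HAB).
    assert (Cmod (arc_integral (fe e) B a b) <= th)%R; [|lra].
    eapply Rle_trans; [|exact HB].
    eapply Rle_trans; [apply (Cmod_arc_integral_le _ _ _ _ (M * exp (k * B) * exp (- (e * kk * B ^ 2))))|].
    - exact Hab.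
    - lra.
    - intros t Ht. apply Hfe, Hpol, HAB.
    - intros t Ht. unfold fe. rewrite Cmod_mult.
      apply Rmult_le_compat; try apply Cmod_ge_0; [apply HfM, HAB|].
      apply Cmod_gauss_sector; [exact Hba|exact Ht|lra].
    - right; ring. }
  (* Now [A] is fixed. On this one arc the factor differs from [1] by at most [e] times a constant,
     so [f] inherits the bound. *)
  apply le_of_small_linear with ((b - a) * (M * exp (k * A) * (A ^ 2 * exp (A ^ 2)) * A))%R.
  intros e He. specialize (Harc e ltac:(lra)).
  replace (arc_integral f A a b)
    with (arc_integral (fe e) A a b - (arc_integral (fe e) A a b - arc_integral f A a b)) by ring.
  eapply Rle_trans; [apply Cmod_triangle_minus|]. apply Rplus_le_compat; [exact Harc|].
  unfold arc_integral. rewrite <- CInt_minus.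
  - rewrite <- Rmult_assoc, (Rmult_comm e), Rmult_assoc.
    assert (HA' : (A <= A)%R) by lra.
    apply Cmod_CInt_le; [exact Hab| |].
    + apply (ex_RInt_minus (V := C_R_NormedModule)); apply ex_arc_integral; try exact Hab; intros;
        [apply Hfe|apply Hf]; apply Hpol, HA'.
    + intros t Ht. unfold fe.
      replace (f (A * cis t) * gauss e c (A * cis t) * (A * (Ci * cis t)) -
               f (A * cis t) * (A * (Ci * cis t)))
        with (f (A * cis t) * (gauss e c (A * cis t) - 1) * (A * (Ci * cis t))) by ring.
      rewrite !(Cmod_mult (_ * _) (A * (Ci * cis t))), Cmod_arc_velocity, Cmod_mult by lra.
      replace (e * (M * exp (k * A) * (A ^ 2 * exp (A ^ 2)) * A))%R
        with (M * exp (k * A) * (e * (A ^ 2 * exp (A ^ 2))) * A)%R by ring.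
      apply Rmult_le_compat_r; [lra|].
      apply Rmult_le_compat; try apply Cmod_ge_0; [apply HfM, HA'|].
      apply gauss_sub_1; [lra|lra|apply Cmod_cis].
  - apply ex_arc_integral; [exact Hab|]. intros. apply Hfe, Hpol; lra.
  - apply ex_arc_integral; [exact Hab|]. intros. apply Hf, Hpol; lra.
Qed.

(** * The function sincD, and Cauchy's formula on a circle *)

Lemma RtoC_neq_0 (x : R) : x <> 0%R -> RtoC x <> 0.
Proof. intros H K. apply H. injection K. trivial. Qed.

Lemma Ci_neq_0 : Ci <> 0.
Proof. intro H. injection H. lra. Qed.

Lemma two_Ci_neq_0 : 2 * Ci <> 0.
Proof. apply Cmult_neq_0; [apply RtoC_neq_0; lra|exact Ci_neq_0]. Qed.

Ltac C_neq := repeat split; first [assumption | exact Ci_neq_0 | apply RtoC_neq_0; pose proof PI_RGT_0; lra].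

Lemma C_is_zero_spec (u : C) : reflect (u = 0) (C_is_zero u).
Proof.
  unfold C_is_zero. destruct u as [a b]; simpl.
  destruct (Req_EM_T a 0) as [->|Ha]; [destruct (Req_EM_T b 0) as [->|Hb]|]; constructor.
  - reflexivity.
  - intro H; injection H; exact Hb.
  - intro H; injection H; intros _; exact Ha.
Qed.

Lemma sincD_0 (T : R) : sincD T 0 = RtoC T.
Proof. unfold sincD. destruct (C_is_zero_spec 0); [reflexivity|congruence]. Qed.

Lemma sincD_neq_0 (T : R) (u : C) : u <> 0 ->
  sincD T u = Csin (RtoC (PI * T) * u) / (RtoC PI * u).
Proof. intros H. unfold sincD. destruct (C_is_zero_spec u); [contradiction|reflexivity]. Qed.

Lemma Cmod_Ci_mult (v : C) : Cmod (Ci * v) = Cmod v.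
Proof. rewrite Cmod_mult, Cmod_Ci. ring. Qed.

Lemma Cmod_two_Ci : Cmod (2 * Ci) = 2%R.
Proof. rewrite Cmod_mult, Cmod_Ci, Cmod_R, Rabs_pos_eq; lra. Qed.

Lemma Cmod_Csin_le (v : C) : (Cmod (Csin v) <= Cmod v * exp (Cmod v))%R.
Proof.
  unfold Csin. rewrite Cmod_div by exact two_Ci_neq_0. rewrite Cmod_two_Ci.
  replace (Cexp (Ci * v) - Cexp (- (Ci * v)))
    with ((Cexp (Ci * v) - 1) - (Cexp (- (Ci * v)) - 1)) by ring.
  pose proof (Cmod_triangle_minus (Cexp (Ci * v) - 1) (Cexp (- (Ci * v)) - 1)) as H.
  pose proof (Cexp_remainder_1 (Ci * v)) as H1.
  pose proof (Cexp_remainder_1 (- (Ci * v))) as H2.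
  rewrite Cmod_opp in H2. rewrite Cmod_Ci_mult in H1, H2. lra.
Qed.

Lemma Csin_remainder_3 (v : C) : (Cmod (Csin v - v) <= Cmod v ^ 3 * exp (Cmod v))%R.
Proof.
  replace (Csin v - v)
    with (((Cexp (Ci * v) - 1 - Ci * v - Ci * v * (Ci * v) / 2)
           - (Cexp (- (Ci * v)) - 1 - - (Ci * v) - - (Ci * v) * (- (Ci * v)) / 2)) / (2 * Ci))
    by (unfold Csin; field; C_neq).
  rewrite Cmod_div by exact two_Ci_neq_0. rewrite Cmod_two_Ci.
  pose proof (Cmod_triangle_minus (Cexp (Ci * v) - 1 - Ci * v - Ci * v * (Ci * v) / 2)
    (Cexp (- (Ci * v)) - 1 - - (Ci * v) - - (Ci * v) * (- (Ci * v)) / 2)) as H.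
  pose proof (Cexp_remainder_3 (Ci * v)) as H1.
  pose proof (Cexp_remainder_3 (- (Ci * v))) as H2.
  rewrite Cmod_opp in H2. rewrite Cmod_Ci_mult in H1, H2. lra.
Qed.

Lemma Cmod_Csin_le_Im (v : C) : (Cmod (Csin v) <= exp (Rabs (Im v)))%R.
Proof.
  unfold Csin. rewrite Cmod_div by exact two_Ci_neq_0. rewrite Cmod_two_Ci.
  pose proof (Cmod_triangle_minus (Cexp (Ci * v)) (Cexp (- (Ci * v)))) as H.
  rewrite !Cmod_Cexp in H.
  assert (H1 : (exp (Re (Ci * v)) <= exp (Rabs (Im v)))%R).
  { apply exp_le. simpl. pose proof (Rle_abs (- Im v)) as K. rewrite Rabs_Ropp in K.
    unfold Im in *. lra. }
  assert (H2 : (exp (Re (- (Ci * v))) <= exp (Rabs (Im v)))%R).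
  { apply exp_le. simpl. pose proof (Rle_abs (Im v)) as K. unfold Im in *. lra. }
  lra.
Qed.

Lemma PI_ge_1 : (1 <= PI)%R.
Proof. pose proof PI2_1. pose proof PI_RGT_0. lra. Qed.

Lemma RtoC_PI_neq_0 : RtoC PI <> 0.
Proof. apply RtoC_neq_0. pose proof PI_RGT_0. lra. Qed.

Lemma Cmod_sincD_le (T : R) (u : C) : (0 < T)%R ->
  (Cmod (sincD T u) <= T * exp (PI * T * Cmod u))%R.
Proof.
  intros HT. pose proof PI_RGT_0 as HP. pose proof (Cmod_ge_0 u) as Hu0.
  assert (HPT : (0 < PI * T)%R) by (apply Rmult_lt_0_compat; assumption).
  destruct (Ceq_dec u 0) as [->|Hu].
  - rewrite sincD_0, Cmod_R, Cmod_0, Rmult_0_r, exp_0, Rabs_pos_eq; lra.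
  - rewrite sincD_neq_0 by exact Hu.
    rewrite Cmod_div by (apply Cmult_neq_0; [exact RtoC_PI_neq_0|exact Hu]).
    pose proof (Cmod_Csin_le (RtoC (PI * T) * u)) as K.
    rewrite !Cmod_mult, Cmod_R, (Rabs_pos_eq (PI * T)) in K by lra.
    rewrite Cmod_mult, Cmod_R, (Rabs_pos_eq PI) by lra.
    apply Cmod_gt_0 in Hu.
    assert (HX : (0 < PI * Cmod u)%R) by (apply Rmult_lt_0_compat; assumption).
    apply Rmult_le_reg_r with (PI * Cmod u)%R; [exact HX|].
    unfold Rdiv. rewrite Rmult_assoc, Rinv_l by lra. lra.
Qed.

(** The imaginary part is constant on the shifted real line, so the sine is bounded there and the
    denominator supplies the decay; [PI >= 1] is simply dropped. This complements [Cmod_sincD_le],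
    which controls the type in the whole plane. *)
Lemma Cmod_sincD_shift_le (T x : R) (w : C) : (0 < T)%R -> (Cmod w < Rabs x)%R ->
  (Cmod (sincD T (RtoC x - w)) <= exp (PI * T * Cmod w) / (Rabs x - Cmod w))%R.
Proof.
  intros HT Hx. pose proof PI_ge_1 as HP.
  assert (HPT : (0 < PI * T)%R) by (apply Rmult_lt_0_compat; lra).
  pose proof (Cmod_triangle_inv (RtoC x) w) as Hd. rewrite Cmod_R in Hd.
  assert (Hu : RtoC x - w <> 0) by (apply Cmod_gt_0; lra).
  rewrite sincD_neq_0 by exact Hu.
  rewrite Cmod_div by (apply Cmult_neq_0; [exact RtoC_PI_neq_0|exact Hu]).
  rewrite (Cmod_mult (RtoC PI)), Cmod_R, (Rabs_pos_eq PI) by lra.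
  pose proof (Cmod_Csin_le_Im (RtoC (PI * T) * (RtoC x - w))) as K.
  assert (HI : (Rabs (Im (RtoC (PI * T) * (RtoC x - w))) <= PI * T * Cmod w)%R).
  { replace (Im (RtoC (PI * T) * (RtoC x - w))) with (PI * T * - Im w)%R
      by (destruct w; simpl; ring).
    rewrite Rabs_mult, Rabs_Ropp, (Rabs_pos_eq (PI * T)) by lra.
    apply Rmult_le_compat_l; [lra|apply Rabs_Im_le_Cmod]. }
  apply exp_le in HI.
  assert (HX : (Rabs x - Cmod w <= PI * Cmod (RtoC x - w))%R) by nra.
  apply Rmult_le_compat; [apply Cmod_ge_0| |lra|].
  - left; apply Rinv_0_lt_compat; lra.
  - apply Rinv_le_contravar; lra.
Qed.

Lemma holo_Csin (z : C) : holo Csin z.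
Proof.
  apply holo_div; [|apply holo_const|exact two_Ci_neq_0].
  assert (Hi : holo (fun u => Ci * u) z) by (apply holo_mult; [apply holo_const|apply holo_id]).
  apply holo_minus.
  - apply (holo_comp Cexp (fun u => Ci * u)); [apply holo_Cexp|exact Hi].
  - apply (holo_comp Cexp (fun u => - (Ci * u))); [apply holo_Cexp|apply holo_opp; exact Hi].
Qed.

Lemma holo_sincD (T : R) (z : C) : (0 < T)%R -> holo (sincD T) z.
Proof.
  intros HT. pose proof PI_RGT_0 as HP.
  assert (HPT : (0 < PI * T)%R) by (apply Rmult_lt_0_compat; assumption).
  destruct (Ceq_dec z 0) as [->|Hz].
  (* [sincD T] is even, hence has derivative [0] at the origin: the cubic remainder of the sine
     divided by [PI * Cmod y] leaves at most [Q * Cmod y ^ 2] when [Cmod y < 1]. *)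
  - exists (RtoC 0). apply is_C_derive_epsilon. intros e He.
    set (Q := ((PI * T) ^ 3 * exp (PI * T) / PI)%R).
    assert (HQ : (0 < Q)%R).
    { apply Rdiv_lt_0_compat; [|exact HP].
      apply Rmult_lt_0_compat; [apply pow_lt; exact HPT|apply exp_pos]. }
    assert (0 < e / Q)%R by (apply Rdiv_lt_0_compat; assumption).
    exists (Rmin 1 (e / Q)); split; [apply Rmin_pos; lra|]. intros y Hy.
    replace (y - 0) with y in * by ring.
    assert (Hy1 : (Cmod y < 1)%R) by (eapply Rlt_le_trans; [exact Hy|apply Rmin_l]).
    assert (Hy2 : (Cmod y < e / Q)%R) by (eapply Rlt_le_trans; [exact Hy|apply Rmin_r]).
    replace (sincD T y - sincD T 0 - 0 * y) with (sincD T y - sincD T 0) by ring.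
    pose proof (Cmod_ge_0 y) as Hy0. rewrite sincD_0.
    destruct (Ceq_dec y 0) as [->|Hyn].
    + rewrite sincD_0. replace (RtoC T - RtoC T) with (RtoC 0) by ring. rewrite Cmod_0. lra.
    + rewrite sincD_neq_0 by exact Hyn.
      replace (Csin (RtoC (PI * T) * y) / (RtoC PI * y) - RtoC T)
        with ((Csin (RtoC (PI * T) * y) - RtoC (PI * T) * y) / (RtoC PI * y)).
      2: { rewrite RtoC_mult. field. split; [exact Hyn|exact RtoC_PI_neq_0]. }
      rewrite Cmod_div by (apply Cmult_neq_0; [exact RtoC_PI_neq_0|exact Hyn]).
      pose proof (Csin_remainder_3 (RtoC (PI * T) * y)) as K.
      rewrite (Cmod_mult (RtoC (PI * T))), Cmod_R, (Rabs_pos_eq (PI * T)) in K by lra.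
      rewrite (Cmod_mult (RtoC PI)), Cmod_R, (Rabs_pos_eq PI) by lra.
      apply Cmod_gt_0 in Hyn. set (m := Cmod y) in *.
      assert (HX : (0 < PI * m)%R) by (apply Rmult_lt_0_compat; assumption).
      apply Rmult_le_reg_r with (PI * m)%R; [exact HX|].
      unfold Rdiv. rewrite Rmult_assoc, Rinv_l, Rmult_1_r by lra.
      eapply Rle_trans; [exact K|].
      apply Rle_trans with ((PI * T * m) ^ 3 * exp (PI * T))%R.
      * apply Rmult_le_compat_l; [apply pow_le; nra|]. apply exp_le. nra.
      * replace ((PI * T * m) ^ 3 * exp (PI * T))%R with (Q * m * (PI * m ^ 2))%R
          by (unfold Q; field; lra).
        replace (e * m * (PI * m))%R with (e * (PI * m ^ 2))%R by ring.
        apply Rmult_le_compat_r; [apply Rmult_le_pos; [lra|apply pow2_ge_0]|].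
        apply (Rmult_lt_compat_l Q) in Hy2; [|exact HQ].
        replace (Q * (e / Q))%R with e in Hy2 by (field; lra). lra.
  - apply (holo_ext_loc (fun u => Csin (RtoC (PI * T) * u) / (RtoC PI * u)) _ z (Cmod z)).
    + apply Cmod_gt_0; exact Hz.
    + intros u Hu. symmetry. apply sincD_neq_0. intros ->.
      rewrite Cmod_minus_sym in Hu. replace (z - 0) with z in Hu by ring. lra.
    + apply holo_div.
      * apply (holo_comp Csin (fun u => RtoC (PI * T) * u)); [apply holo_Csin|].
        apply holo_mult; [apply holo_const|apply holo_id].
      * apply holo_mult; [apply holo_const|apply holo_id].
      * apply Cmult_neq_0; [exact RtoC_PI_neq_0|exact Hz].
Qed.

Lemma holo_sincD_shift (T : R) (w z : C) : (0 < T)%R -> holo (fun u => sincD T (u - w)) z.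
Proof.
  intros HT. apply (holo_comp (sincD T) (fun u => u - w)); [apply holo_sincD, HT|].
  apply holo_minus; [apply holo_id|apply holo_const].
Qed.

Lemma Csin_opp (v : C) : Csin (- v) = - Csin v.
Proof.
  unfold Csin. replace (- (Ci * - v)) with (Ci * v) by ring.
  replace (Ci * - v) with (- (Ci * v)) by ring. field; C_neq.
Qed.

Lemma Cconj_inv_neq_0 (z : C) : z <> 0 -> Cconj (/ z) = / Cconj z.
Proof.
  intros Hz. apply Cmod_gt_0 in Hz. destruct z as [a b]. unfold Cconj, Cinv; simpl.
  assert (a * (a * 1) + b * (b * 1) <> 0)%R.
  { intro K. unfold Cmod in Hz; simpl in Hz. rewrite K, sqrt_0 in Hz. lra. }
  f_equal; field; simpl in *; lra.
Qed.

Lemma Cconj_eq_0 (z : C) : Cconj z = 0 -> z = 0.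
Proof. intros H. apply Cmod_eq_0. rewrite <- Cmod_conj, H. apply Cmod_0. Qed.

Lemma Cconj_RtoC (x : R) : Cconj (RtoC x) = RtoC x.
Proof. unfold Cconj, RtoC; simpl. f_equal. ring. Qed.

Lemma Csin_conj (v : C) : Csin (Cconj v) = Cconj (Csin v).
Proof.
  unfold Csin, Cdiv. rewrite Cmult_conj, Cconj_inv_neq_0 by exact two_Ci_neq_0.
  replace (Cconj (2 * Ci)) with (- (2 * Ci)) by (unfold Cconj, Ci, RtoC, Cmult, Copp; simpl; f_equal; ring).
  replace (Ci * Cconj v) with (Cconj (- (Ci * v)))
    by (destruct v; unfold Cconj, Ci, Cmult, Copp; simpl; f_equal; ring).
  replace (- Cconj (- (Ci * v))) with (Cconj (Ci * v))
    by (destruct v; unfold Cconj, Ci, Cmult, Copp; simpl; f_equal; ring).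
  rewrite Cminus_conj, !Cexp_conj. field; C_neq.
Qed.

Lemma sincD_opp (T : R) (u : C) : sincD T (- u) = sincD T u.
Proof.
  destruct (Ceq_dec u 0) as [->|Hu].
  - f_equal. ring.
  - assert (- u <> 0) by (intro K; apply Hu; replace u with (- - u) by ring; rewrite K; ring).
    rewrite !sincD_neq_0 by assumption.
    replace (RtoC (PI * T) * - u) with (- (RtoC (PI * T) * u)) by ring.
    rewrite Csin_opp. field. split; [exact Hu|exact RtoC_PI_neq_0].
Qed.

Lemma sincD_conj (T : R) (u : C) : sincD T (Cconj u) = Cconj (sincD T u).
Proof.
  destruct (Ceq_dec u 0) as [->|Hu].
  - rewrite Cconj_RtoC, sincD_0, Cconj_RtoC. reflexivity.
  - assert (Cconj u <> 0) by (intro K; apply Hu, Cconj_eq_0, K).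
    rewrite !sincD_neq_0 by assumption. unfold Cdiv.
    rewrite Cmult_conj, Cconj_inv_neq_0, <- Csin_conj, !Cmult_conj, !Cconj_RtoC; [reflexivity|].
    apply Cmult_neq_0; [exact RtoC_PI_neq_0|exact Hu].
Qed.

Lemma Csin_RtoC (x : R) : Csin (RtoC x) = RtoC (sin x).
Proof.
  assert (H : Cexp (Ci * RtoC x) - Cexp (- (Ci * RtoC x)) = 2 * Ci * RtoC (sin x)).
  { unfold Cexp, Ci, RtoC, Cmult, Cminus, Cplus, Copp; simpl.
    replace (0 * x - 1 * 0)%R with 0%R by ring. replace (0 * 0 + 1 * x)%R with x by ring.
    rewrite Ropp_0, exp_0, sin_neg, cos_neg. f_equal; ring. }
  unfold Csin. rewrite H. field; C_neq.
Qed.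

Lemma W_Sp_sincD (x : R) : RtoC (W_Sp x) = 1 - sincD 2 (RtoC x) / 2.
Proof.
  assert (H2 : RtoC 2 <> 0) by (apply RtoC_neq_0; lra).
  unfold W_Sp. destruct (Req_EM_T x 0) as [->|Hx].
  - rewrite sincD_0. field; C_neq.
  - pose proof (RtoC_neq_0 x Hx) as Hx'. pose proof PI_RGT_0.
    rewrite sincD_neq_0 by exact Hx'. rewrite <- RtoC_mult, Csin_RtoC.
    assert (2 * PI * x <> 0)%R
      by (apply Rmult_integral_contrapositive_currified; [lra|exact Hx]).
    rewrite RtoC_minus, RtoC_div, !RtoC_mult by assumption.
    replace (PI * 2 * x)%R with (2 * PI * x)%R by ring. field; C_neq.
Qed.

(** * Cauchy's theorem for a half disc and Cauchy's formula for a disc *)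

(** Scaling the imaginary part by [s] from [1] to [0] flattens the lower half circle through half
    ellipses onto the segment, which is then run through by [A * cos t] from [- A] to [A]. *)
Lemma segment_integral_eq_arc (G : C -> C) (A : R) :
  (0 <= A)%R -> (forall z, holo G z) ->
  CInt (fun x => G (RtoC x)) (- A) A = arc_integral G A (- PI) 0.
Proof.
  intros HA HG. pose proof PI_RGT_0 as HP.
  pose proof (homotopy_Cauchy G (fun s t => ((A * cos t)%R, (s * (A * sin t))%R))
    (fun s t => (0%R, (A * sin t)%R)) (fun s t => ((- (A * sin t))%R, (s * (A * cos t))%R))
    0 1 (- PI) 0 (2 * A)) as K. unfold box_boundary in K.
  match type of K with _ -> _ -> _ -> ?e = _ => assert (K' : e = 0) end.
  { apply K; [lra|lra|]. intros s t Hs Ht.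
    assert (Hc : (Rabs (A * cos t) <= A)%R).
    { rewrite Rabs_mult, (Rabs_pos_eq A) by exact HA.
      assert (Rabs (cos t) <= 1)%R by (apply Rabs_le, COS_bound). nra. }
    assert (Hsn : (Rabs (A * sin t) <= A)%R).
    { rewrite Rabs_mult, (Rabs_pos_eq A) by exact HA.
      assert (Rabs (sin t) <= 1)%R by (apply Rabs_le, SIN_bound). nra. }
    assert (HC : forall x y, (Rabs x <= A)%R -> (Rabs y <= A)%R -> (Cmod (x, y) <= 2 * A)%R).
    { intros x y Hx Hy. replace (x, y) with (RtoC x + Ci * RtoC y)
        by (unfold RtoC, Ci, Cmult, Cplus; simpl; f_equal; ring).
      eapply Rle_trans; [apply Cmod_triangle|]. rewrite Cmod_Ci_mult, !Cmod_R. lra. }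
    refine (conj _ (conj _ (conj _ (conj _ (conj _ (conj _ _)))))).
    - apply is_curve_derive_pair; simpl; auto_derive; trivial; ring.
    - apply is_curve_derive_pair; simpl; auto_derive; trivial; ring.
    - apply continuous_Cconst.
    - apply continuous_Re_Im; simpl; apply (ex_derive_continuous (V := R_NormedModule)); auto_derive; trivial.
    - apply HC; [rewrite Rabs_R0; exact HA|exact Hsn].
    - apply HC; [rewrite Rabs_Ropp; exact Hsn|].
      rewrite Rabs_mult, (Rabs_pos_eq s) by lra. pose proof (Rabs_pos (A * cos t)). nra.
    - apply HG. }
  (* The endpoints of the half ellipses do not move with [s], so the two remaining sides of the box
     contribute nothing. *)
  assert (Z : forall t, sin t = 0%R ->
    CInt (fun s => G ((A * cos t)%R, (s * (A * sin t))%R) * (0%R, (A * sin t)%R)) 0 1 = RtoC 0).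
  { intros t Ht. rewrite (CInt_ext _ (fun _ => RtoC 0)); [|lra|].
    - replace (RtoC 0) with (RtoC 0 - RtoC 0) by ring.
      apply (CInt_derive (fun _ => RtoC 0)); [lra| |].
      + intros. replace (RtoC 0 - RtoC 0) with (RtoC 0) by ring. apply is_curve_derive_const.
      + intros; apply continuous_Cconst.
    - intros s _. rewrite Ht, Rmult_0_r. change (0%R, 0%R) with (RtoC 0). ring. }
  rewrite (Z (- PI)%R), (Z 0%R) in K' by (rewrite ?sin_neg, ?sin_PI, ?sin_0; ring).
  assert (E1 : CInt (fun t => G ((A * cos t)%R, (1 * (A * sin t))%R) *
                      ((- (A * sin t))%R, (1 * (A * cos t))%R)) (- PI) 0 = arc_integral G A (- PI) 0).
  { apply CInt_ext; [lra|]. intros t _. f_equal; [f_equal|];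
    unfold cis, RtoC, Ci, Cmult; simpl; f_equal; ring. }
  assert (E0 : CInt (fun t => G ((A * cos t)%R, (0 * (A * sin t))%R) *
                      ((- (A * sin t))%R, (0 * (A * cos t))%R)) (- PI) 0
               = CInt (fun x => G (RtoC x)) (- A) A).
  { pose proof (RInt_comp (V := C_R_CompleteNormedModule) (fun x => G (RtoC x))
      (fun t => A * cos t)%R (fun t => - (A * sin t))%R (- PI) 0) as S.
    cbv beta in S. rewrite cos_neg, cos_PI, cos_0 in S.
    replace (A * -1)%R with (- A)%R in S by ring. rewrite Rmult_1_r in S.
    rewrite <- S.
    - apply CInt_ext; [lra|]. intros t _. rewrite !Rmult_0_l. fold (RtoC (A * cos t)).
      destruct (G (RtoC (A * cos t))) as [u v].
      unfold scal, Cmult; simpl. unfold prod_scal, scal; simpl. unfold mult; simpl. f_equal; ring.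
    - intros t _. apply (continuous_holo_comp G (fun x => RtoC x)); [apply HG|apply continuous_RtoC_id].
    - intros t _. split; [auto_derive; trivial; ring|].
      apply (ex_derive_continuous (V := R_NormedModule)); auto_derive; trivial. }
  rewrite E1, E0 in K'.
  assert (Halg : forall p q : C, 0 + p - 0 - q = 0 -> q = p).
  { intros p q Hpq. replace p with (q + (0 + p - 0 - q)) by ring. rewrite Hpq. ring. }
  apply Halg, K'.
Qed.

Lemma circle_Cauchy (E : C -> C) (w : C) (A : R) :
  (Cmod w < A)%R -> (forall z, holo E z) ->
  arc_integral (fun z => E z / (z - w)) A (- PI) PI = 2 * Ci * RtoC PI * E w.
Proof.
  intros HA HE. pose proof PI_RGT_0 as HP. pose proof (Cmod_ge_0 w) as Hw.
  set (f := fun z => E z / (z - w)).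
  assert (Hf : forall z, z <> w -> holo f z).
  { intros z Hz. apply holo_div; [apply HE| |].
    - apply holo_minus; [apply holo_id|apply holo_const].
    - intro K. apply Hz. replace z with (z - w + w) by ring. rewrite K. ring. }
  assert (Hrho : forall rho, (0 < rho <= A)%R ->
    arc_integral f A (- PI) PI = CInt (fun t => Ci * E (w + RtoC rho * cis t)) (- PI) PI).
  { intros rho Hr.
    pose proof (homotopy_Cauchy f
      (* For fixed [s] this is the circle with centre [(1 - s) w] and radius [rho + s (A - rho)]. It
         deforms the circle of radius [rho] about [w] into the circle of radius [A] about [0]. *)
      (fun s t => (w + RtoC rho * cis t) + RtoC s * (RtoC (A - rho) * cis t - w))
      (fun s t => RtoC (A - rho) * cis t - w)
      (fun s t => RtoC (rho + s * (A - rho)) * (Ci * cis t)) 0 1 (- PI) PI (A + Cmod w)) as K.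
    unfold box_boundary in K.
    match type of K with _ -> _ -> _ -> ?e = _ => assert (K' : e = 0) end.
    { apply K; [lra|lra|]. intros s t Hs Ht.
      assert (Hr' : (0 <= rho + s * (A - rho) <= A)%R) by nra.
      refine (conj _ (conj _ (conj _ (conj _ (conj _ (conj _ _)))))).
      - pose proof (is_curve_derive_plus _ _ s _ _ (is_curve_derive_const (w + RtoC rho * cis t) s)
          (is_curve_derive_line (RtoC (A - rho) * cis t - w) s)) as D.
        rewrite Cplus_0_l in D. exact D.
      - apply (is_derive_ext (V := C_R_NormedModule)
          (fun u => (w - RtoC s * w) + RtoC (rho + s * (A - rho)) * cis u)).
        + intros u. rewrite RtoC_plus, RtoC_mult.
          match goal with |- ?x = ?y => change (@eq C x y) end. ring.
        + match goal with |- is_derive _ _ ?v => replace v with (RtoC 0 + v) by ring end.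
          apply is_curve_derive_plus; [apply is_curve_derive_const|].
          apply is_curve_derive_cmult, is_curve_derive_cis.
      - apply continuous_Cconst.
      - apply continuous_arc_velocity.
      - eapply Rle_trans; [apply Cmod_triangle_minus|]. rewrite Cmod_polar; lra.
      - rewrite Cmod_arc_velocity; lra.
      (* Meeting [w] would force the radius to equal [s * Cmod w]; but it is [(1 - s) rho + s A],
         which is larger because [rho > 0] and [Cmod w < A]. *)
      - apply Hf. intro Z.
        assert (Z' : RtoC (rho + s * (A - rho)) * cis t = RtoC s * w).
        { rewrite RtoC_plus, RtoC_mult.
          transitivity (w + RtoC rho * cis t + RtoC s * (RtoC (A - rho) * cis t - w)
                        - w + RtoC s * w); [ring|].
          rewrite Z. ring. }
        apply (f_equal Cmod) in Z'. rewrite Cmod_polar, Cmod_mult, Cmod_R, Rabs_pos_eq in Z' by lra.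
        destruct (Req_dec s 0) as [->|Hs0]; [lra|].
        assert (s * Cmod w < s * A)%R by (apply Rmult_lt_compat_l; lra). nra. }
    assert (Hpi : cis (- PI) = cis PI) by (unfold cis; rewrite cos_neg, sin_neg, sin_PI; f_equal; ring).
    rewrite Hpi in K'.
    assert (E1 : CInt (fun t => f (w + RtoC rho * cis t + 1 * (RtoC (A - rho) * cis t - w)) *
       (RtoC (rho + 1 * (A - rho)) * (Ci * cis t))) (- PI) PI = arc_integral f A (- PI) PI).
    { apply CInt_ext; [lra|]. intros t _. rewrite RtoC_minus.
      replace (rho + 1 * (A - rho))%R with A by ring. f_equal. f_equal. ring. }
    assert (E0 : CInt (fun t => f (w + RtoC rho * cis t + 0 * (RtoC (A - rho) * cis t - w)) *
       (RtoC (rho + 0 * (A - rho)) * (Ci * cis t))) (- PI) PI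
       = CInt (fun t => Ci * E (w + RtoC rho * cis t)) (- PI) PI).
    { apply CInt_ext; [lra|]. intros t _.
      replace (rho + 0 * (A - rho))%R with rho by ring.
      replace (w + RtoC rho * cis t + 0 * (RtoC (A - rho) * cis t - w)) with (w + RtoC rho * cis t) by ring.
      unfold f. replace (w + RtoC rho * cis t - w) with (RtoC rho * cis t) by ring. field.
      split; [apply Cmod_gt_0; rewrite Cmod_cis; lra|apply RtoC_neq_0; lra]. }
    rewrite E1, E0 in K'.
    assert (Halg : forall p q r : C, p + q - p - r = 0 -> q = r).
    { intros p q r Hpq. replace q with ((p + q - p - r) + r) by ring. rewrite Hpq. ring. }
    eapply Halg, K'. }
  (* The integral over the large circle does not depend on [rho], so [rho] may be chosen from the
     continuity of [E] at [w]. *)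
  assert (Hd : forall e, (0 < e <= 1)%R ->
    (Cmod (arc_integral f A (- PI) PI - 2 * Ci * RtoC PI * E w) <= 0 + e * (2 * PI))%R).
  { intros e He.
    destruct (holo_local E w (HE w) e ltac:(lra)) as (d & Hd & HdE).
    set (rho := Rmin A (d / 2)).
    assert (Hr : (0 < rho <= A)%R) by (split; [apply Rmin_pos; lra|apply Rmin_l]).
    assert (Hr2 : (rho < d)%R) by (eapply Rle_lt_trans; [apply Rmin_r|lra]).
    rewrite (Hrho rho Hr).
    assert (Hcst : CInt (fun _ => Ci * E w) (- PI) PI = 2 * Ci * RtoC PI * E w).
    { rewrite (CInt_derive (fun t => RtoC t * (Ci * E w)) (fun _ => Ci * E w)); [|lra| |].
      - rewrite RtoC_opp. match goal with |- ?x = ?y => change (@eq C x y) end. ring.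
      - intros; apply is_curve_derive_line.
      - intros; apply continuous_Cconst. }
    assert (Hcont : forall t, Ccontinuous (fun t => Ci * E (w + RtoC rho * cis t)) t).
    { intros t. apply continuous_Cmult; [apply continuous_Cconst|].
      apply (continuous_holo_comp E (fun t => w + RtoC rho * cis t)); [apply HE|].
      apply continuous_Cplus; [apply continuous_Cconst|].
      apply continuous_Cmult; [apply continuous_Cconst|apply continuous_cis]. }
    rewrite <- Hcst, <- CInt_minus.
    - eapply Rle_trans; [apply (Cmod_CInt_le _ e); [lra| |]|lra].
      + apply ex_CInt_continuous; [lra|]. intros t _.
        apply continuous_Cminus; [apply Hcont|apply continuous_Cconst].
      + intros t _. replace (Ci * E (w + rho * cis t) - Ci * E w)
          with (Ci * (E (w + rho * cis t) - E w)) by ring.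
        rewrite Cmod_Ci_mult. left; apply HdE.
        replace (w + rho * cis t - w) with (rho * cis t) by ring. rewrite Cmod_polar; lra.
    - apply ex_CInt_continuous; [lra|]. intros; apply Hcont.
    - apply ex_CInt_continuous; [lra|]. intros; apply continuous_Cconst. }
  apply le_of_small_linear in Hd.
  assert (Z : arc_integral f A (- PI) PI - 2 * Ci * RtoC PI * E w = 0)
    by (apply Cmod_eq_0, Rle_antisym; [exact Hd|apply Cmod_ge_0]).
  replace (arc_integral f A (- PI) PI)
    with ((arc_integral f A (- PI) PI - 2 * Ci * RtoC PI * E w) + 2 * Ci * RtoC PI * E w) by ring.
  rewrite Z. ring.
Qed.

(** * The reproducing identity for smaller type *)

(** Square integrability at infinity on the half-line of direction [u], which is [1] or [-1], in
    Cauchy form. Both half-lines are parametrised by [r] going to plus infinity. *)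
Definition L2_ray (F : C -> C) (u : R) : Prop :=
  forall eta, (0 < eta)%R -> exists A0, forall A B, (A0 <= A <= B)%R ->
    (RInt (fun r => Cmod (F (RtoC (u * r))) ^ 2)%R A B <= eta)%R.

Lemma continuous_real_axis (F : C -> C) (u r : R) :
  (forall z, holo F z) -> Ccontinuous (fun x => F (RtoC (u * x))) r.
Proof.
  intros HF. apply (continuous_holo_comp F (fun x => RtoC (u * x))); [apply HF|].
  apply continuous_RtoC. apply (ex_derive_continuous (V := R_NormedModule)). auto_derive; trivial.
Qed.

Lemma continuous_pow2 (f : R -> R) (x : R) :
  continuous f x -> continuous (fun t => (f t) ^ 2)%R x.
Proof.
  intros H. apply (continuous_ext (fun t => f t * f t)%R); [intros; simpl; ring|].
  apply (continuous_mult (K := R_AbsRing)); exact H.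
Qed.

Lemma continuous_inv_sqr (m r : R) : (m < r)%R -> continuous (fun x => (/ (x - m)) ^ 2)%R r.
Proof.
  intros H. apply (ex_derive_continuous (V := R_NormedModule)). auto_derive. lra.
Qed.

Lemma RInt_inv_sqr_le (m A B : R) : (m < A <= B)%R ->
  (RInt (fun r => (/ (r - m)) ^ 2)%R A B <= / (A - m))%R.
Proof.
  intros H.
  assert (E : RInt (fun r => (/ (r - m)) ^ 2)%R A B = (- / (B - m) - - / (A - m))%R).
  { apply (is_RInt_unique (V := R_CompleteNormedModule)).
    apply (is_RInt_derive (V := R_CompleteNormedModule) (fun r => - / (r - m))%R);
      rewrite Rmin_left, Rmax_right by lra; intros r Hr.
    - auto_derive; [lra|]. field. lra.
    - apply continuous_inv_sqr. lra. }
  rewrite E. assert (0 < / (B - m))%R by (apply Rinv_0_lt_compat; lra). lra.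
Qed.

(* Cauchy-Schwarz is replaced by [x y <= x^2 + y^2], since both tails are small. *)
Lemma L2_ray_dominating_tail (F : C -> C) (u m Q eta : R) :
  (forall z, holo F z) -> L2_ray F u -> (0 < Q)%R -> (0 < eta)%R ->
  exists A0, (m + 1 <= A0)%R /\ forall A B, (A0 <= A <= B)%R ->
    (RInt (fun r => Q * (Cmod (F (RtoC (u * r))) ^ 2 + (/ (r - m)) ^ 2))%R A B <= eta)%R.
Proof.
  intros HF HL HQ He.
  assert (He' : (0 < eta / (2 * Q))%R) by (apply Rdiv_lt_0_compat; lra).
  destruct (HL _ He') as [A0 HA0].
  set (A1 := Rmax (m + 1) (Rmax A0 (m + 2 * Q / eta))).
  exists A1; split; [apply Rmax_l|]. intros A B HAB.
  assert (H1 : (m + 1 <= A)%R) by (eapply Rle_trans; [apply Rmax_l|apply HAB]).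
  assert (H2 : (A0 <= A)%R)
    by (eapply Rle_trans; [|apply HAB]; eapply Rle_trans; [|apply Rmax_r]; apply Rmax_l).
  assert (H3 : (m + 2 * Q / eta <= A)%R)
    by (eapply Rle_trans; [|apply HAB]; eapply Rle_trans; [|apply Rmax_r]; apply Rmax_r).
  assert (I1 : ex_RInt (fun r => Cmod (F (RtoC (u * r))) ^ 2)%R A B).
  { apply ex_RInt_continuous_on; [lra|]. intros r _.
    apply continuous_pow2, continuous_Cmod, continuous_real_axis, HF. }
  assert (I2 : ex_RInt (fun r => (/ (r - m)) ^ 2)%R A B).
  { apply ex_RInt_continuous_on; [lra|]. intros r Hr. apply continuous_inv_sqr. lra. }
  assert (E : RInt (fun r => Q * (Cmod (F (RtoC (u * r))) ^ 2 + (/ (r - m)) ^ 2))%R A B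
    = (Q * (RInt (fun r => Cmod (F (RtoC (u * r))) ^ 2)%R A B
            + RInt (fun r => (/ (r - m)) ^ 2)%R A B))%R).
  { apply (is_RInt_unique (V := R_CompleteNormedModule)).
    exact (is_RInt_scal _ _ _ Q _ (is_RInt_plus _ _ _ _ _ _
      (RInt_correct (V := R_CompleteNormedModule) _ _ _ I1)
      (RInt_correct (V := R_CompleteNormedModule) _ _ _ I2))). }
  rewrite E.
  pose proof (HA0 A B ltac:(lra)) as K1. pose proof (RInt_inv_sqr_le m A B ltac:(lra)) as K2.
  assert (K3 : (/ (A - m) <= eta / (2 * Q))%R).
  { replace (eta / (2 * Q))%R with (/ (2 * Q / eta))%R by (field; lra).
    apply Rinv_le_contravar; [|lra]. apply Rdiv_lt_0_compat; lra. }
  apply Rle_trans with (Q * (eta / (2 * Q) + eta / (2 * Q)))%R.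
  - apply Rmult_le_compat_l; lra.
  - right; field; lra.
Qed.

(** The difference of the functions for [q = PI * T] and [q = - (PI * T)] is [F z * sincD T (z - w)]
    times [2 * Ci * RtoC PI]. Each half has a possible pole at [w], so it is only used for
    [Cmod z > Cmod w]. *)
Definition half_kernel (F : C -> C) (q : R) (w z : C) : C :=
  F z * Cexp (Ci * (RtoC q * (z - w))) / (z - w).

Lemma holo_half_kernel_num (F : C -> C) (q : R) (w z : C) :
  (forall z, holo F z) -> holo (fun z => F z * Cexp (Ci * (RtoC q * (z - w)))) z.
Proof.
  intros HF. apply holo_mult; [apply HF|].
  apply (holo_comp Cexp (fun z => Ci * (RtoC q * (z - w)))); [apply holo_Cexp|].
  apply holo_mult; [apply holo_const|]. apply holo_mult; [apply holo_const|].
  apply holo_minus; [apply holo_id|apply holo_const].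
Qed.

Lemma holo_half_kernel (F : C -> C) (q : R) (w z : C) :
  (forall z, holo F z) -> (Cmod w < Cmod z)%R -> holo (half_kernel F q w) z.
Proof.
  intros HF Hz. apply holo_div; [apply holo_half_kernel_num, HF| |].
  - apply holo_minus; [apply holo_id|apply holo_const].
  - pose proof (Cmod_triangle_inv z w). apply Cmod_gt_0. lra.
Qed.

Lemma Cmod_half_kernel_le (F : C -> C) (q : R) (w z : C) :
  (Cmod w < Cmod z)%R ->
  (Cmod (half_kernel F q w z) <=
   Cmod (F z) * exp (- (q * Im z)) * (exp (Rabs q * Cmod w) * / (Cmod z - Cmod w)))%R.
Proof.
  intros Hz. pose proof (Cmod_triangle_inv z w) as Hd.
  unfold half_kernel. rewrite Cmod_div by (apply Cmod_gt_0; lra).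
  rewrite Cmod_mult, Cmod_Cexp. unfold Rdiv. rewrite <- Rmult_assoc.
  assert (HR : (exp (Re (Ci * (RtoC q * (z - w)))) <= exp (- (q * Im z)) * exp (Rabs q * Cmod w))%R).
  { rewrite <- exp_plus. apply exp_le.
    replace (Re (Ci * (RtoC q * (z - w)))) with (- (q * Im z) + q * Im w)%R
      by (destruct z, w; simpl; ring).
    apply Rplus_le_compat_l. eapply Rle_trans; [apply Rle_abs|]. rewrite Rabs_mult.
    apply Rmult_le_compat_l; [apply Rabs_pos|apply Rabs_Im_le_Cmod]. }
  apply Rmult_le_compat.
  - apply Rmult_le_pos; [apply Cmod_ge_0|left; apply exp_pos].
  - left; apply Rinv_0_lt_compat; lra.
  - rewrite Rmult_assoc. apply Rmult_le_compat_l; [apply Cmod_ge_0|exact HR].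
  - apply Rinv_le_contravar; lra.
Qed.

(** [cis phi = RtoC u] says that the ray is a real half-line. There the exponential is bounded, and
    what remains is the product of a square integrable function with [1 / (r - Cmod w)]. *)
Lemma ray_negligible_half_kernel_real (F : C -> C) (q u phi : R) (w : C) :
  (forall z, holo F z) -> L2_ray F u -> cis phi = RtoC u ->
  ray_negligible (half_kernel F q w) phi.
Proof.
  intros HF HL Hphi eta He. pose proof (Cmod_ge_0 w) as Hw.
  destruct (L2_ray_dominating_tail F u (Cmod w) (exp (Rabs q * Cmod w)) eta HF HL (exp_pos _) He)
    as (A0 & HA0 & K).
  exists A0. intros A B HAB. eapply Rle_trans; [|apply (K A B HAB)].
  assert (Hpol : forall r, (A <= r <= B)%R -> (Cmod w < Cmod (RtoC r * cis phi)%C)%R)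
    by (intros; rewrite Cmod_polar; lra).
  apply RInt_le; [lra| | |].
  - apply ex_RInt_continuous_on; [lra|]. intros r Hr.
    apply continuous_Cmod, continuous_on_ray, holo_half_kernel; [exact HF|apply Hpol, Hr].
  - apply ex_RInt_continuous_on; [lra|]. intros r Hr.
    apply (continuous_scal_r (V := R_NormedModule) (exp (Rabs q * Cmod w))).
    apply (continuous_plus (V := R_NormedModule)).
    + apply continuous_pow2, continuous_Cmod, continuous_real_axis, HF.
    + apply continuous_inv_sqr. lra.
  - intros r Hr. eapply Rle_trans; [apply Cmod_half_kernel_le, Hpol; lra|].
    rewrite Cmod_polar by lra. rewrite Hphi, <- RtoC_mult, (Rmult_comm r u).
    replace (Im (RtoC (u * r))) with 0%R by reflexivity.
    rewrite Rmult_0_r, Ropp_0, exp_0, Rmult_1_r.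
    set (x := Cmod (F (RtoC (u * r)))). set (y := (/ (r - Cmod w))%R).
    pose proof (exp_pos (Rabs q * Cmod w)) as HQ.
    replace (x * (exp (Rabs q * Cmod w) * y))%R with (exp (Rabs q * Cmod w) * (x * y))%R by ring.
    apply Rmult_le_compat_l; [lra|].
    pose proof (pow2_ge_0 (x - y)). pose proof (pow2_ge_0 x). pose proof (pow2_ge_0 y). nra.
Qed.

Lemma ray_negligible_half_kernel_decay (F : C -> C) (M k q phi : R) (w : C) :
  (forall z, holo F z) -> (forall z, (Cmod (F z) <= M * exp (k * Cmod z))%R) ->
  (k < q * sin phi)%R -> ray_negligible (half_kernel F q w) phi.
Proof.
  intros HF HM Hk eta He. pose proof (Cmod_ge_0 w) as Hw.
  (* The net rate on the ray: the exponential decays at rate [q * sin phi], and [F] grows at rate at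
     most [k]. *)
  set (mu := (q * sin phi - k)%R). assert (Hmu : (0 < mu)%R) by (unfold mu; lra).
  assert (HM0 : (0 <= M)%R).
  { pose proof (HM 0). pose proof (Cmod_ge_0 (F 0)). pose proof (exp_pos (k * Cmod 0)). nra. }
  set (K := (M * exp (Rabs q * Cmod w))%R).
  assert (HK : (0 <= K)%R) by (apply Rmult_le_pos; [exact HM0|left; apply exp_pos]).
  (* The tail integral is at most [K / mu * exp (- (mu * A))], and [exp x >= x] turns this into
     [K / (mu * mu * A)]. The bound [Cmod w + 1] makes the denominator [r - Cmod w] at least [1]. *)
  set (A0 := Rmax (Cmod w + 1) (K / (mu * mu * eta))).
  exists A0. intros A B HAB.
  assert (H1 : (Cmod w + 1 <= A)%R) by (eapply Rle_trans; [apply Rmax_l|apply HAB]).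
  assert (H2 : (K / (mu * mu * eta) <= A)%R) by (eapply Rle_trans; [apply Rmax_r|apply HAB]).
  assert (Hpol : forall r, (A <= r <= B)%R -> (Cmod w < Cmod (RtoC r * cis phi)%C)%R)
    by (intros; rewrite Cmod_polar; lra).
  assert (Hcont : forall r, continuous (fun r => K * exp (- (mu * r)))%R r).
  { intros r. apply (ex_derive_continuous (V := R_NormedModule)). auto_derive; trivial. }
  apply Rle_trans with (RInt (fun r => K * exp (- (mu * r)))%R A B).
  - apply RInt_le; [lra| | |].
    + apply ex_RInt_continuous_on; [lra|]. intros r Hr.
      apply continuous_Cmod, continuous_on_ray, holo_half_kernel; [exact HF|apply Hpol, Hr].
    + apply ex_RInt_continuous_on; [lra|]. intros r Hr. apply Hcont.
    + intros r Hr. eapply Rle_trans; [apply Cmod_half_kernel_le, Hpol; lra|].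
      pose proof (HM (RtoC r * cis phi)) as HMr. rewrite Cmod_polar in * by lra.
      replace (Im (RtoC r * cis phi)) with (r * sin phi)%R by (unfold cis; simpl; ring).
      assert (Hinv : (/ (r - Cmod w) <= 1)%R).
      { rewrite <- Rinv_1. apply Rinv_le_contravar; lra. }
      assert (Hinv0 : (0 < / (r - Cmod w))%R) by (apply Rinv_0_lt_compat; lra).
      apply Rle_trans with (M * exp (k * r) * exp (- (q * (r * sin phi)))
                            * (exp (Rabs q * Cmod w) * 1))%R.
      * apply Rmult_le_compat.
        -- apply Rmult_le_pos; [apply Cmod_ge_0|left; apply exp_pos].
        -- left; apply Rmult_lt_0_compat; [apply exp_pos|exact Hinv0].
        -- apply Rmult_le_compat_r; [left; apply exp_pos|exact HMr].
        -- apply Rmult_le_compat_l; [left; apply exp_pos|exact Hinv].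
      * right. unfold K. replace (- (mu * r))%R with (k * r + - (q * (r * sin phi)))%R
          by (unfold mu; ring).
        rewrite exp_plus. ring.
  - assert (E : RInt (fun r => K * exp (- (mu * r)))%R A B
                = (- (K / mu * exp (- (mu * B))) - - (K / mu * exp (- (mu * A))))%R).
    { apply (is_RInt_unique (V := R_CompleteNormedModule)).
      apply (is_RInt_derive (V := R_CompleteNormedModule) (fun r => - (K / mu * exp (- (mu * r))))%R);
        intros r _; [|apply Hcont].
      auto_derive; trivial. field. lra. }
    rewrite E.
    assert (HKm : (0 <= K / mu)%R)
      by (apply Rmult_le_pos; [exact HK|left; apply Rinv_0_lt_compat; exact Hmu]).
    assert (0 <= K / mu * exp (- (mu * B)))%R by (apply Rmult_le_pos; [exact HKm|left; apply exp_pos]).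
    assert (K / mu * exp (- (mu * A)) <= eta)%R; [|lra].
    assert (HmA : (0 < mu * A)%R) by (apply Rmult_lt_0_compat; lra).
    apply Rle_trans with (K / mu * / (mu * A))%R.
    + apply Rmult_le_compat_l; [exact HKm|]. rewrite exp_Ropp. apply Rinv_le_contravar; [exact HmA|].
      pose proof (exp_ineq1_le (mu * A)). lra.
    + assert (Hme : (0 < mu * mu * eta)%R) by (repeat apply Rmult_lt_0_compat; assumption).
      apply (Rmult_le_compat_r (mu * mu * eta)) in H2; [|lra].
      replace (K / (mu * mu * eta) * (mu * mu * eta))%R with K in H2 by (field; lra).
      replace (K / mu * / (mu * A))%R with (K * / (mu * mu * A))%R by (field; lra).
      assert (0 < mu * mu * A)%R by (repeat apply Rmult_lt_0_compat; lra).
      apply Rmult_le_reg_r with (mu * mu * A)%R; [assumption|].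
      rewrite Rmult_assoc, Rinv_l by lra. lra.
Qed.

Lemma arc_negligible_Chasles (f : C -> C) (A1 a b c : R) :
  (forall z, (A1 <= Cmod z)%R -> holo f z) -> (a <= b <= c)%R ->
  arc_negligible f a b -> arc_negligible f b c -> arc_negligible f a c.
Proof.
  intros Hf Habc H1 H2 eta He. assert (He2 : (0 < eta / 2)%R) by lra.
  destruct (H1 _ He2) as [B1 HB1]. destruct (H2 _ He2) as [B2 HB2].
  exists (Rmax (Rmax 0 A1) (Rmax B1 B2)). intros A HA.
  pose proof (Rmax_l (Rmax 0 A1) (Rmax B1 B2)). pose proof (Rmax_r (Rmax 0 A1) (Rmax B1 B2)).
  pose proof (Rmax_l 0 A1). pose proof (Rmax_r 0 A1).
  pose proof (Rmax_l B1 B2). pose proof (Rmax_r B1 B2).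
  rewrite <- (arc_integral_Chasles f A a b c Habc).
  - eapply Rle_trans; [apply Cmod_triangle|].
    specialize (HB1 A ltac:(lra)). specialize (HB2 A ltac:(lra)). lra.
  - intros t _. apply Hf. rewrite Cmod_polar; lra.
Qed.

(** Cuts at [th], [PI / 2] and [PI - th] give four sectors, each of opening less than [PI / 2]. The
    two extreme rays are real and rely on square integrability; on the three inner ones the
    exponential beats the growth of [F]. *)
Lemma half_circle_negligible (F : C -> C) (M k q a th u v : R) (w : C) :
  (forall z, holo F z) -> (forall z, (Cmod (F z) <= M * exp (k * Cmod z))%R) ->
  L2_ray F u -> L2_ray F v -> cis a = RtoC u -> cis (a + PI) = RtoC v ->
  (0 < th < PI / 2)%R ->
  (k < q * sin (a + th))%R -> (k < q * sin (a + PI / 2))%R -> (k < q * sin (a + (PI - th)))%R ->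
  arc_negligible (half_kernel F q w) a (a + PI).
Proof.
  intros HF HM Hu Hv Ha Hb Hth S1 S2 S3.
  pose proof (Cmod_ge_0 w) as Hw. set (f := half_kernel F q w).
  assert (Hf : forall z, (Cmod w + 1 <= Cmod z)%R -> holo f z)
    by (intros z Hz; apply holo_half_kernel; [exact HF|lra]).
  assert (HM0 : (0 <= M)%R).
  { pose proof (HM 0). pose proof (Cmod_ge_0 (F 0)). pose proof (exp_pos (k * Cmod 0)). nra. }
  assert (Hgr : forall z, (Cmod w + 1 <= Cmod z)%R ->
    (Cmod (f z) <= M * exp (Rabs q * Cmod w) * exp ((k + Rabs q) * Cmod z))%R).
  { intros z Hz. eapply Rle_trans; [apply Cmod_half_kernel_le; lra|].
    assert (Hinv : (/ (Cmod z - Cmod w) <= 1)%R).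
    { rewrite <- Rinv_1. apply Rinv_le_contravar; lra. }
    assert (Hinv0 : (0 < / (Cmod z - Cmod w))%R) by (apply Rinv_0_lt_compat; lra).
    assert (HI : (exp (- (q * Im z)) <= exp (Rabs q * Cmod z))%R).
    { apply exp_le. eapply Rle_trans; [apply Rle_abs|]. rewrite Rabs_Ropp, Rabs_mult.
      apply Rmult_le_compat_l; [apply Rabs_pos|apply Rabs_Im_le_Cmod]. }
    apply Rle_trans with (M * exp (k * Cmod z) * exp (Rabs q * Cmod z)
                          * (exp (Rabs q * Cmod w) * 1))%R.
    - apply Rmult_le_compat.
      + apply Rmult_le_pos; [apply Cmod_ge_0|left; apply exp_pos].
      + left; apply Rmult_lt_0_compat; [apply exp_pos|exact Hinv0].
      + apply Rmult_le_compat; [apply Cmod_ge_0|left; apply exp_pos|apply HM|exact HI].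
      + apply Rmult_le_compat_l; [left; apply exp_pos|exact Hinv].
    - right. rewrite Rmult_plus_distr_r, exp_plus. ring. }
  assert (N0 : ray_negligible f a) by exact (ray_negligible_half_kernel_real F q u a w HF Hu Ha).
  assert (N4 : ray_negligible f (a + PI))
    by exact (ray_negligible_half_kernel_real F q v (a + PI) w HF Hv Hb).
  assert (N1 : ray_negligible f (a + th))
    by (eapply ray_negligible_half_kernel_decay; eassumption).
  assert (N2 : ray_negligible f (a + PI / 2))
    by (eapply ray_negligible_half_kernel_decay; eassumption).
  assert (N3 : ray_negligible f (a + (PI - th)))
    by (eapply ray_negligible_half_kernel_decay; eassumption).
  apply (arc_negligible_Chasles f (Cmod w + 1) a (a + th)); [exact Hf|lra| |].
  { eapply sector_arc_negligible; try eassumption; lra. }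
  apply (arc_negligible_Chasles f (Cmod w + 1) (a + th) (a + PI / 2)); [exact Hf|lra| |].
  { eapply sector_arc_negligible; try eassumption; lra. }
  apply (arc_negligible_Chasles f (Cmod w + 1) (a + PI / 2) (a + (PI - th))); [exact Hf|lra| |];
    eapply sector_arc_negligible; try eassumption; lra.
Qed.

Lemma sinc_reproduces_strict_type (F : C -> C) (T M k : R) (w : C) :
  (forall z, holo F z) -> (forall z, (Cmod (F z) <= M * exp (k * Cmod z))%R) ->
  (0 <= k < PI * T)%R -> L2_ray F 1 -> L2_ray F (-1) ->
  forall eta, (0 < eta)%R -> exists A0, forall A, (A0 <= A)%R ->
    (Cmod (CInt (fun x => F (RtoC x) * sincD T (RtoC x - w))%C (- A) A - F w) <= eta)%R.
Proof.
  intros HF HM Hk HL1 HL2 eta He. pose proof PI_RGT_0 as HP. pose proof (Cmod_ge_0 w) as Hw.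
  assert (HPT : (0 < PI * T)%R) by lra.
  assert (HT : (0 < T)%R) by nra.
  (* The midpoint of [k / (PI * T)] and [1]: its arcsine is an angle short of [PI / 2] at which the
     decay rate [PI * T * sin th] still exceeds [k]. *)
  set (s0 := ((1 + k / (PI * T)) / 2)%R).
  assert (Hq : (0 <= k / (PI * T) < 1)%R).
  { split; [apply Rmult_le_pos; [lra|left; apply Rinv_0_lt_compat; exact HPT]|].
    apply Rmult_lt_reg_r with (PI * T)%R; [exact HPT|].
    unfold Rdiv. rewrite Rmult_assoc, Rinv_l by lra. lra. }
  assert (Hs0 : (k < PI * T * s0)%R).
  { assert (k = PI * T * (k / (PI * T)))%R as E by (field; lra).
    rewrite E at 1. apply Rmult_lt_compat_l; [exact HPT|unfold s0; lra]. }
  set (th := asin s0).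
  assert (Hsin : sin th = s0) by (apply sin_asin; unfold s0; lra).
  assert (Hth : (0 < th < PI / 2)%R).
  { pose proof (asin_bound_lt s0 ltac:(unfold s0; lra)) as Hb. fold th in Hb. split; [|lra].
    apply Rnot_le_lt. intros Hneg.
    assert (sin th <= sin 0)%R by (apply sin_incr_1; lra). rewrite sin_0, Hsin in *.
    unfold s0 in *; lra. }
  assert (Hsin1 : sin (PI - th) = s0) by (rewrite sin_PI_x; exact Hsin).
  assert (Hneg : forall t, sin (- PI + t) = (- sin t)%R).
  { intros t. rewrite sin_plus, cos_neg, sin_neg, cos_PI, sin_PI. ring. }
  assert (Hup : arc_negligible (half_kernel F (PI * T) w) 0 PI).
  { replace PI with (0 + PI)%R at 2 by ring.
    apply (half_circle_negligible F M k _ 0 th 1 (-1)); try assumption.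
    - unfold cis. rewrite cos_0, sin_0. reflexivity.
    - rewrite Rplus_0_l. unfold cis. rewrite cos_PI, sin_PI. reflexivity.
    - rewrite Rplus_0_l, Hsin. exact Hs0.
    - rewrite Rplus_0_l, sin_PI2. lra.
    - rewrite Rplus_0_l, Hsin1. exact Hs0. }
  assert (Hdn : arc_negligible (half_kernel F (- (PI * T)) w) (- PI) 0).
  { replace 0%R with (- PI + PI)%R by ring.
    apply (half_circle_negligible F M k _ (- PI) th (-1) 1); try assumption.
    - unfold cis. rewrite cos_neg, sin_neg, cos_PI, sin_PI, Ropp_0. reflexivity.
    - rewrite Rplus_opp_l. unfold cis. rewrite cos_0, sin_0. reflexivity.
    - rewrite Hneg, Hsin. lra.
    - rewrite Hneg, sin_PI2. lra.
    - rewrite Hneg, Hsin1. lra. }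
  destruct (Hup eta He) as [A1 HA1]. destruct (Hdn eta He) as [A2 HA2].
  exists (Rmax (Cmod w + 1) (Rmax A1 A2)). intros A HA.
  pose proof (Rmax_l (Cmod w + 1) (Rmax A1 A2)). pose proof (Rmax_r (Cmod w + 1) (Rmax A1 A2)).
  pose proof (Rmax_l A1 A2). pose proof (Rmax_r A1 A2).
  specialize (HA1 A ltac:(lra)). specialize (HA2 A ltac:(lra)).
  set (fp := half_kernel F (PI * T) w) in *. set (fm := half_kernel F (- (PI * T)) w) in *.
  set (G := fun z => F z * sincD T (z - w)).
  assert (HG : forall z, holo G z) by (intros z; apply holo_mult; [apply HF|apply holo_sincD_shift, HT]).
  assert (Hpol : forall t, (Cmod w < Cmod (RtoC A * cis t)%C)%R) by (intros; rewrite Cmod_polar; lra).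
  assert (Hfp : forall t, holo fp (RtoC A * cis t)) by (intros; apply holo_half_kernel; [exact HF|apply Hpol]).
  assert (Hfm : forall t, holo fm (RtoC A * cis t)) by (intros; apply holo_half_kernel; [exact HF|apply Hpol]).
  assert (E1 : CInt (fun x => F (RtoC x) * sincD T (RtoC x - w)) (- A) A = arc_integral G A (- PI) 0)
    by (apply (segment_integral_eq_arc G A); [lra|exact HG]).
  assert (E2 : arc_integral G A (- PI) 0
    = / (2 * Ci * RtoC PI) * (arc_integral fp A (- PI) 0 - arc_integral fm A (- PI) 0)).
  { unfold arc_integral. rewrite <- CInt_minus, <- CInt_Cmult.
    - apply CInt_ext; [lra|]. intros t _. unfold G, fp, fm, half_kernel.
      set (z := RtoC A * cis t). specialize (Hpol t). fold z in Hpol.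
      pose proof (Cmod_triangle_inv z w).
      assert (Hz : z - w <> 0) by (apply Cmod_gt_0; lra).
      rewrite sincD_neq_0 by exact Hz. unfold Csin.
      replace (- (Ci * (RtoC (PI * T) * (z - w)))) with (Ci * (RtoC (- (PI * T)) * (z - w)))
        by (rewrite RtoC_opp; ring).
      match goal with |- ?x = ?y => change (@eq C x y) end. field. C_neq.
    - apply (ex_RInt_minus (V := C_R_NormedModule)); apply ex_arc_integral; try lra; intros; auto.
    - apply ex_arc_integral; try lra; intros; auto.
    - apply ex_arc_integral; try lra; intros; auto. }
  (* [fp] need not be small on the lower half circle. Cauchy's formula on the full circle replaces
     that arc by the value at [w] minus the upper arc, where [Hup] applies. *)
  assert (E3 : arc_integral fp A (- PI) 0 = 2 * Ci * RtoC PI * F w - arc_integral fp A 0 PI).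
  { pose proof (circle_Cauchy (fun z => F z * Cexp (Ci * (RtoC (PI * T) * (z - w)))) w A
      ltac:(lra) (fun z => holo_half_kernel_num F (PI * T) w z HF)) as K.
    change (arc_integral fp A (- PI) PI = 2 * Ci * RtoC PI *
      (F w * Cexp (Ci * (RtoC (PI * T) * (w - w))))) in K.
    replace (Ci * (RtoC (PI * T) * (w - w))) with (RtoC 0) in K by ring.
    rewrite Cexp_0, Cmult_1_r in K. rewrite <- K.
    rewrite <- (arc_integral_Chasles fp A (- PI) 0 PI); [ring|lra|intros; apply Hfp]. }
  rewrite E1, E2, E3.
  assert (HPi : 2 * Ci * RtoC PI <> 0) by (apply Cmult_neq_0; [exact two_Ci_neq_0|exact RtoC_PI_neq_0]).
  replace (/ (2 * Ci * RtoC PI) * (2 * Ci * RtoC PI * F w - arc_integral fp A 0 PI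
            - arc_integral fm A (- PI) 0) - F w)
    with (- ((arc_integral fp A 0 PI + arc_integral fm A (- PI) 0) / (2 * Ci * RtoC PI)))
    by (field; C_neq).
  rewrite Cmod_opp, Cmod_div by exact HPi.
  rewrite Cmod_mult, Cmod_two_Ci, Cmod_R, (Rabs_pos_eq PI) by lra.
  pose proof (Cmod_triangle (arc_integral fp A 0 PI) (arc_integral fm A (- PI) 0)).
  pose proof PI_ge_1.
  apply Rmult_le_reg_r with (2 * PI)%R; [lra|].
  unfold Rdiv. rewrite Rmult_assoc, Rinv_l by lra. nra.
Qed.

(** * The reproducing identity *)

Local Notation minus_infty := (Rbar_locally m_infty).
Local Notation plus_infty := (Rbar_locally p_infty).
Local Notation is_CInt_gen f l := (@is_RInt_gen C_R_NormedModule f minus_infty plus_infty l).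

(** * Improper integrals over the real line *)

Lemma is_CInt_gen_epsilon (f : R -> C) (l : C) :
  is_CInt_gen f l <->
  (forall e, (0 < e)%R -> filter_prod minus_infty plus_infty
     (fun ab => exists z : C, is_CInt f (fst ab) (snd ab) z /\ (Cmod (z - l) < e)%R)).
Proof.
  unfold is_RInt_gen. split.
  - intros H e He. assert (He2 : (0 < e / 2)%R) by lra.
    generalize (proj1 (filterlimi_locally _ _) H (mkposreal _ He2)).
    apply filter_imp. intros ab [z [Hz [B1 B2]]]. exists z; split; [exact Hz|].
    apply Cmod_lt_sum; assumption.
  - intros H. apply (filterlimi_locally (U := C_UniformSpace)). intros e.
    generalize (H e (cond_pos e)). apply filter_imp. intros ab [z [Hz B]].
    exists z; split; [exact Hz|]. apply C_NormedModule_mixin_compat1. exact B.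
Qed.

Lemma is_CInt_gen_Cmult (c : C) (f : R -> C) (l : C) :
  is_CInt_gen f l -> is_CInt_gen (fun x => c * f x) (c * l).
Proof.
  intros H. apply is_CInt_gen_epsilon. intros e He.
  pose proof (Cmod_ge_0 c) as Hc.
  assert (He' : (0 < e / (Cmod c + 1))%R) by (apply Rdiv_lt_0_compat; lra).
  generalize (proj1 (is_CInt_gen_epsilon f l) H _ He'). apply filter_imp.
  intros ab [z [Hz Hlt]]. exists (c * z); split; [apply is_CInt_Cmult, Hz|].
  replace (c * z - c * l) with (c * (z - l)) by ring. rewrite Cmod_mult.
  apply (Rmult_lt_compat_l (Cmod c + 1)) in Hlt; [|lra].
  replace ((Cmod c + 1) * (e / (Cmod c + 1)))%R with e in Hlt by (field; lra).
  pose proof (Cmod_ge_0 (z - l)). lra.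
Qed.

Lemma is_CInt_gen_conj (f : R -> C) (l : C) :
  is_CInt_gen f l -> is_CInt_gen (fun x => Cconj (f x)) (Cconj l).
Proof.
  intros H. apply is_CInt_gen_epsilon. intros e He.
  generalize (proj1 (is_CInt_gen_epsilon f l) H e He). apply filter_imp.
  intros ab [z [Hz Hlt]]. exists (Cconj z); split.
  - apply (is_RInt_fct_extend_pair (U := R_NormedModule) (V := R_NormedModule) (fun t => Cconj (f t))).
    + exact (is_RInt_fct_extend_fst (U := R_NormedModule) (V := R_NormedModule) f _ _ z Hz).
    + exact (is_RInt_opp _ _ _ _
        (is_RInt_fct_extend_snd (U := R_NormedModule) (V := R_NormedModule) f _ _ z Hz)).
  - rewrite <- Cminus_conj, Cmod_conj. exact Hlt.
Qed.

Lemma is_CInt_gen_Re (f : R -> C) (l : C) :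
  is_CInt_gen f l -> is_RInt_gen (fun x => Re (f x)) minus_infty plus_infty (Re l).
Proof.
  intros H. apply (filterlimi_locally (U := R_UniformSpace)). intros e.
  generalize (proj1 (is_CInt_gen_epsilon f l) H e (cond_pos e)). apply filter_imp.
  intros ab [z [Hz Hlt]]. exists (Re z); split.
  - exact (is_RInt_fct_extend_fst (U := R_NormedModule) (V := R_NormedModule) f _ _ z Hz).
  - eapply Rle_lt_trans; [|exact Hlt]. exact (re_le_Cmod (z - l)).
Qed.

Lemma is_CInt_gen_plus (f g : R -> C) (l m : C) :
  is_CInt_gen f l -> is_CInt_gen g m -> is_CInt_gen (fun x => f x + g x) (l + m).
Proof. intros Hf Hg. exact (is_RInt_gen_plus f g l m Hf Hg). Qed.

Lemma is_CInt_gen_ext (f g : R -> C) (l : C) :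
  (forall x, f x = g x) -> is_CInt_gen f l -> is_CInt_gen g l.
Proof.
  intros H. apply (is_RInt_gen_ext (V := C_R_NormedModule)).
  apply filter_forall. intros ab x _. apply H.
Qed.

Lemma is_CInt_gen_unique (f : R -> C) (l m : C) :
  is_CInt_gen f l -> is_CInt_gen f m -> l = m.
Proof.
  intros Hl Hm.
  rewrite <- (is_RInt_gen_unique (V := C_R_CompleteNormedModule) f l Hl).
  exact (is_RInt_gen_unique (V := C_R_CompleteNormedModule) f m Hm).
Qed.

Lemma filter_prod_infty (A0 : R) (P : R * R -> Prop) :
  (forall a b, (a <= - A0)%R -> (A0 <= b)%R -> P (a, b)) ->
  filter_prod minus_infty plus_infty P.
Proof.
  intros H. apply (Filter_prod _ _ _ (fun a => a < - A0)%R (fun b => A0 < b)%R).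
  - exists (- A0)%R. trivial.
  - exists A0. trivial.
  - intros a b Ha Hb. apply H; lra.
Qed.

Lemma filter_prod_infty_elim (P : R * R -> Prop) :
  filter_prod minus_infty plus_infty P ->
  exists A0, (0 <= A0)%R /\ forall a b, (a <= - A0)%R -> (A0 <= b)%R -> P (a, b).
Proof.
  intros [Q1 Q2 [M1 H1] [M2 H2] H].
  exists (Rabs M1 + Rabs M2 + 1)%R.
  pose proof (Rle_abs M2). pose proof (Rle_abs (- M1)) as HM1. rewrite Rabs_Ropp in HM1.
  pose proof (Rabs_pos M1). pose proof (Rabs_pos M2).
  split; [lra|]. intros a b Ha Hb. apply H; [apply H1; lra|apply H2; lra].
Qed.

Lemma is_RInt_gen_ge_0 (f : R -> R) (l : R) :
  (forall x, (0 <= f x)%R) -> is_RInt_gen f minus_infty plus_infty l -> (0 <= l)%R.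
Proof.
  intros Hf H. apply Rnot_lt_le. intros Hl.
  assert (He : (0 < - l)%R) by lra.
  destruct (filter_prod_infty_elim _ (proj1 (filterlimi_locally _ _) H (mkposreal _ He)))
    as (A0 & HA0 & K).
  destruct (K (- A0)%R A0 ltac:(lra) ltac:(lra)) as (z & Hz & B). simpl in Hz.
  assert (0 <= z)%R.
  { apply (is_RInt_ge_0 f (- A0) A0 z); [lra|exact Hz|intros; apply Hf]. }
  change (Rabs (z - l) < - l)%R in B. rewrite Rabs_pos_eq in B; lra.
Qed.

(** Brings the left tail to the right, so that the estimates for [L2_ray] with [u = -1] apply to
    it. *)
Lemma CInt_reflect (h : R -> C) (a b : R) :
  (a <= b)%R -> (forall x, Ccontinuous h x) ->
  CInt h (- b) (- a) = CInt (fun r => h (-1 * r)%R) a b.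
Proof.
  intros Hab Hh.
  assert (Hex : forall x y, ex_CInt h x y)
    by (intros; apply (ex_RInt_continuous (V := C_R_CompleteNormedModule)); intros; apply Hh).
  pose proof (RInt_comp_lin (V := C_R_CompleteNormedModule) h (-1) 0 a b (Hex _ _)) as K.
  replace (-1 * a + 0)%R with (- a)%R in K by ring. replace (-1 * b + 0)%R with (- b)%R in K by ring.
  rewrite <- (opp_RInt_swap (V := C_R_CompleteNormedModule) h (- a) (- b) (Hex _ _)), <- K.
  assert (Hex' : ex_CInt (fun y => scal (-1)%R (h (-1 * y + 0)%R)) a b)
    by (apply (ex_RInt_comp_lin (V := C_R_NormedModule)); apply Hex).
  etransitivity; [symmetry; exact (RInt_opp (V := C_R_CompleteNormedModule) _ _ _ Hex')|].
  apply CInt_ext; [exact Hab|]. intros t _. rewrite Rplus_0_r.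
  destruct (h (-1 * t)%R) as [x y].
  unfold opp, scal; simpl; unfold prod_opp, prod_scal, opp, scal; simpl; unfold mult; simpl.
  f_equal; ring.
Qed.

Lemma RInt_reflect (h : R -> R) (a b : R) :
  (a <= b)%R -> (forall x, continuous h x) ->
  RInt h (- b) (- a) = RInt (fun r => h (-1 * r)%R) a b.
Proof.
  intros Hab Hh.
  assert (Hex : forall x y, ex_RInt h x y)
    by (intros; apply (ex_RInt_continuous (V := R_CompleteNormedModule)); intros; apply Hh).
  pose proof (RInt_comp_lin (V := R_CompleteNormedModule) h (-1) 0 a b (Hex _ _)) as K.
  replace (-1 * a + 0)%R with (- a)%R in K by ring. replace (-1 * b + 0)%R with (- b)%R in K by ring.
  rewrite <- (opp_RInt_swap (V := R_CompleteNormedModule) h (- a) (- b) (Hex _ _)), <- K.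
  assert (Hex' : ex_RInt (fun y => scal (-1)%R (h (-1 * y + 0)%R)) a b)
    by (apply (ex_RInt_comp_lin (V := R_NormedModule)); apply Hex).
  etransitivity; [symmetry; exact (RInt_opp (V := R_CompleteNormedModule) _ _ _ Hex')|].
  apply RInt_ext. intros t _. rewrite Rplus_0_r.
  unfold opp, scal; simpl; unfold mult; simpl. ring.
Qed.

(** Lipschitz dependence on the band, locally uniform in [u]. The addition formula isolates
    [Cexp y - 1] with [y] of modulus [PI * d * Cmod u], and this factor [PI * Cmod u] cancels the
    denominator. *)
Lemma Cmod_sincD_diff_le (T d : R) (u : C) : (0 < T)%R -> (0 <= d <= 1)%R ->
  (Cmod (sincD (T + d) u - sincD T u) <= d * exp (PI * (T + 1) * Cmod u))%R.
Proof.
  intros HT Hd. pose proof PI_RGT_0 as HP. pose proof (Cmod_ge_0 u) as Hu0.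
  destruct (Ceq_dec u 0) as [->|Hu].
  - rewrite !sincD_0, <- RtoC_minus, Cmod_R, Cmod_0, Rmult_0_r, exp_0.
    replace (T + d - T)%R with d by ring. rewrite Rabs_pos_eq; lra.
  - rewrite !sincD_neq_0 by exact Hu.
    set (x := Ci * (RtoC (PI * T) * u)). set (y := Ci * (RtoC (PI * d) * u)).
    assert (Hxy : Ci * (RtoC (PI * (T + d)) * u) = x + y).
    { unfold x, y. rewrite Rmult_plus_distr_l, RtoC_plus. ring. }
    unfold Csin. rewrite Hxy. fold x.
    replace (- (x + y)) with (- x + - y) by ring. rewrite !Cexp_plus.
    replace ((Cexp x * Cexp y - Cexp (- x) * Cexp (- y)) / (2 * Ci) / (RtoC PI * u)
             - (Cexp x - Cexp (- x)) / (2 * Ci) / (RtoC PI * u))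
      with ((Cexp x * (Cexp y - 1) - Cexp (- x) * (Cexp (- y) - 1)) / (2 * Ci * (RtoC PI * u)))
      by (field; C_neq).
    assert (HPu : RtoC PI * u <> 0) by (apply Cmult_neq_0; [exact RtoC_PI_neq_0|exact Hu]).
    rewrite Cmod_div by (apply Cmult_neq_0; [exact two_Ci_neq_0|exact HPu]).
    rewrite (Cmod_mult (2 * Ci)), Cmod_two_Ci, (Cmod_mult (RtoC PI)), Cmod_R, (Rabs_pos_eq PI) by lra.
    pose proof (Cmod_triangle_minus (Cexp x * (Cexp y - 1)) (Cexp (- x) * (Cexp (- y) - 1))) as H.
    rewrite !Cmod_mult, !Cmod_Cexp in H.
    assert (Hx : Cmod x = (PI * T * Cmod u)%R).
    { unfold x. rewrite Cmod_Ci_mult, Cmod_mult, Cmod_R, Rabs_pos_eq by nra. reflexivity. }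
    assert (Hy : Cmod y = (PI * d * Cmod u)%R).
    { unfold y. rewrite Cmod_Ci_mult, Cmod_mult, Cmod_R, Rabs_pos_eq by nra. reflexivity. }
    pose proof (exp_Re_le x) as A1. pose proof (exp_Re_le (- x)) as A2.
    pose proof (Cexp_remainder_1 y) as A3. pose proof (Cexp_remainder_1 (- y)) as A4.
    rewrite Cmod_opp in A2, A4. rewrite Hx in A1, A2. rewrite Hy in A3, A4.
    assert (Hbig : forall v z : C, (exp (Re v) <= exp (PI * T * Cmod u))%R ->
       (Cmod (Cexp z - 1) <= PI * d * Cmod u * exp (PI * d * Cmod u))%R ->
       (exp (Re v) * Cmod (Cexp z - 1) <= PI * Cmod u * (d * exp (PI * (T + 1) * Cmod u)))%R).
    { intros v z V1 V2.
      apply Rle_trans with (exp (PI * T * Cmod u) * (PI * d * Cmod u * exp (PI * d * Cmod u)))%R.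
      - apply Rmult_le_compat; [left; apply exp_pos|apply Cmod_ge_0|exact V1|exact V2].
      - replace (exp (PI * T * Cmod u) * (PI * d * Cmod u * exp (PI * d * Cmod u)))%R
          with (PI * Cmod u * (d * (exp (PI * T * Cmod u) * exp (PI * d * Cmod u))))%R by ring.
        rewrite <- exp_plus. apply Rmult_le_compat_l; [apply Rmult_le_pos; lra|].
        apply Rmult_le_compat_l; [lra|]. apply exp_le.
        assert (0 <= PI * Cmod u * (1 - d))%R
          by (apply Rmult_le_pos; [apply Rmult_le_pos|]; lra). lra. }
    pose proof (Hbig x y A1 A3) as B1. pose proof (Hbig (- x) (- y) A2 A4) as B2.
    apply Cmod_gt_0 in Hu. assert (HX : (0 < 2 * (PI * Cmod u))%R) by (apply Rmult_lt_0_compat; [lra|nra]).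
    apply Rmult_le_reg_r with (2 * (PI * Cmod u))%R; [exact HX|].
    unfold Rdiv. rewrite Rmult_assoc, Rinv_l, Rmult_1_r by lra. lra.
Qed.

(** [A0] is fixed before the band [S]: the constant [exp (PI * S * Cmod w)] in the dominating
    function increases with [S], so its value at [T] serves all smaller bands. *)
Lemma sinc_tail (F : C -> C) (u T : R) (w : C) (eta : R) :
  (forall z, holo F z) -> L2_ray F u -> (u = 1 \/ u = -1)%R -> (0 < T)%R -> (0 < eta)%R ->
  exists A0, (Cmod w + 1 <= A0)%R /\ forall S A B, (0 < S <= T)%R -> (A0 <= A <= B)%R ->
    (Cmod (CInt (fun r => F (RtoC (u * r)) * sincD S (RtoC (u * r) - w))%C A B) <= eta)%R.
Proof.
  intros HF HL Hu HT He. pose proof PI_RGT_0 as HP. pose proof (Cmod_ge_0 w) as Hw.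
  destruct (L2_ray_dominating_tail F u (Cmod w) (exp (PI * T * Cmod w)) eta HF HL (exp_pos _) He)
    as (A0 & HA0 & K).
  exists A0; split; [exact HA0|]. intros S A B HS HAB.
  eapply Rle_trans; [|apply (K A B HAB)].
  apply Cmod_CInt_le_RInt; [lra| | |].
  - apply ex_CInt_continuous; [lra|]. intros r Hr.
    apply continuous_Cmult; [apply continuous_real_axis, HF|].
    apply (continuous_real_axis (fun z => sincD S (z - w)) u r). intros; apply holo_sincD_shift; lra.
  - apply ex_RInt_continuous_on; [lra|]. intros r Hr.
    apply (continuous_scal_r (V := R_NormedModule) (exp (PI * T * Cmod w))).
    apply (continuous_plus (V := R_NormedModule)).
    + apply continuous_pow2, continuous_Cmod, continuous_real_axis, HF.
    + apply continuous_inv_sqr. lra.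
  - intros r Hr. rewrite Cmod_mult.
    assert (Habs : Rabs (u * r) = r).
    { destruct Hu as [-> | ->]; [rewrite Rmult_1_l, Rabs_pos_eq; lra|].
      rewrite Rabs_mult, Rabs_left, Rabs_pos_eq; lra. }
    pose proof (Cmod_sincD_shift_le S (u * r) w ltac:(lra)) as K1. rewrite Habs in K1.
    specialize (K1 ltac:(lra)).
    set (x := Cmod (F (RtoC (u * r)))). set (y := (/ (r - Cmod w))%R) in *.
    assert (Hx : (0 <= x)%R) by apply Cmod_ge_0.
    assert (Hy : (0 < y)%R) by (apply Rinv_0_lt_compat; lra).
    assert (HE : (exp (PI * S * Cmod w) <= exp (PI * T * Cmod w))%R).
    { apply exp_le. apply Rmult_le_compat_r; [exact Hw|]. apply Rmult_le_compat_l; lra. }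
    unfold Rdiv in K1. fold y in K1.
    apply Rle_trans with (x * (exp (PI * T * Cmod w) * y))%R.
    + apply Rmult_le_compat_l; [exact Hx|]. eapply Rle_trans; [exact K1|].
      apply Rmult_le_compat_r; lra.
    + replace (x * (exp (PI * T * Cmod w) * y))%R with (exp (PI * T * Cmod w) * (x * y))%R by ring.
      apply Rmult_le_compat_l; [left; apply exp_pos|].
      pose proof (pow2_ge_0 (x - y)). pose proof (pow2_ge_0 x). pose proof (pow2_ge_0 y). nra.
Qed.

(* The kernel of band [T + d] reproduces type [T] with room to spare; the tails are bounded
   uniformly in [d], so [d] can go to [0] on a fixed segment. *)
Theorem sinc_reproduces (F : C -> C) (T : R) (w : C) :
  (0 < T)%R -> (forall z, holo F z) -> exp_type_le (PI * T) F -> L2_ray F 1 -> L2_ray F (-1) ->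
  is_CInt_gen (fun x => F (RtoC x) * sincD T (RtoC x - w)) (F w).
Proof.
  intros HT HF HE HL1 HL2. pose proof PI_RGT_0 as HP. pose proof (Cmod_ge_0 w) as Hw.
  set (h := fun S x => F (RtoC x) * sincD S (RtoC x - w)).
  assert (Hh : forall S x, (0 < S)%R -> Ccontinuous (h S) x).
  { intros S x HS.
    apply (continuous_holo_comp (fun z => F z * sincD S (z - w)) (fun x => RtoC x)).
    - apply holo_mult; [apply HF|apply holo_sincD_shift, HS].
    - apply continuous_RtoC_id. }
  assert (Hhex : forall S a b, (0 < S)%R -> ex_CInt (h S) a b).
  { intros S a b HS. apply (ex_RInt_continuous (V := C_R_CompleteNormedModule)).
    intros; apply Hh, HS. }
  (* The budget is [2 e] for the two tails and [3 e] on the fixed segment; a sixth [e] makes the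
     final inequality strict. *)
  apply is_CInt_gen_epsilon. intros e0 He0. set (e := (e0 / 6)%R).
  assert (He : (0 < e)%R) by (unfold e; lra).
  destruct (sinc_tail F 1 (T + 1) w e HF HL1 (or_introl eq_refl) ltac:(lra) He) as (A1 & HA1 & K1).
  destruct (sinc_tail F (-1) (T + 1) w e HF HL2 (or_intror eq_refl) ltac:(lra) He) as (A2 & HA2 & K2).
  set (A0 := Rmax A1 A2).
  assert (H01 : (A1 <= A0)%R) by apply Rmax_l. assert (H02 : (A2 <= A0)%R) by apply Rmax_r.
  assert (Tail : forall S a b, (0 < S <= T + 1)%R -> (a <= - A0)%R -> (A0 <= b)%R ->
    (Cmod (CInt (h S) a b - CInt (h S) (- A0) A0) <= 2 * e)%R).
  { intros S a b HS Ha Hb.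
    rewrite <- (CInt_Chasles (h S) a (- A0) b), <- (CInt_Chasles (h S) (- A0) A0 b)
      by (apply Hhex; lra).
    replace (CInt (h S) a (- A0) + (CInt (h S) (- A0) A0 + CInt (h S) A0 b) - CInt (h S) (- A0) A0)
      with (CInt (h S) a (- A0) + CInt (h S) A0 b) by ring.
    eapply Rle_trans; [apply Cmod_triangle|].
    assert (X1 : (Cmod (CInt (h S) A0 b) <= e)%R).
    { rewrite (CInt_ext (h S) (fun r => F (RtoC (1 * r)) * sincD S (RtoC (1 * r) - w))); [|lra|].
      - apply K1; lra.
      - intros t _. unfold h. rewrite Rmult_1_l. reflexivity. }
    assert (X2 : (Cmod (CInt (h S) a (- A0)) <= e)%R).
    { replace a with (- - a)%R by ring. rewrite CInt_reflect; [|lra|intros; apply Hh; lra].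
      apply K2; lra. }
    lra. }
  assert (Near : forall d, (0 < d <= 1)%R -> (Cmod (CInt (h (T + d)%R) (- A0) A0 - F w) <= 3 * e)%R).
  { intros d Hd.
    (* The slack in the exponential type is half of the gain [PI * d] in the band, so the rate stays
       strictly below [PI * (T + d)]. *)
    assert (HPd : (0 < PI * d / 2)%R) by (apply Rdiv_lt_0_compat; [nra|lra]).
    destruct (HE _ HPd) as [M HM].
    assert (Hk : (0 <= PI * T + PI * d / 2 < PI * (T + d))%R) by nra.
    destruct (sinc_reproduces_strict_type F (T + d) M _ w HF HM Hk HL1 HL2 e He) as [A3 HA3].
    set (A := Rmax A0 A3). pose proof (Rmax_l A0 A3) as L1. pose proof (Rmax_r A0 A3) as L2.
    fold A in L1, L2. specialize (HA3 A L2).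
    pose proof (Tail (T + d)%R (- A)%R A ltac:(lra) ltac:(lra) L1) as HT'.
    replace (CInt (h (T + d)%R) (- A0) A0 - F w)
      with ((CInt (h (T + d)%R) (- A) A - F w) - (CInt (h (T + d)%R) (- A) A - CInt (h (T + d)%R) (- A0) A0))
      by ring.
    eapply Rle_trans; [apply Cmod_triangle_minus|]. unfold h at 1. lra. }
  assert (Here : (Cmod (CInt (h T) (- A0) A0 - F w) <= 3 * e)%R).
  { destruct (HE 1%R Rlt_0_1) as [M HM].
    assert (HM0 : (0 <= M)%R).
    { pose proof (HM 0) as X. pose proof (Cmod_ge_0 (F 0)).
      pose proof (exp_pos ((PI * T + 1) * Cmod 0)). nra. }
    (* [A0] and [M] were chosen independently of [d], so the change of band costs at most [d] times
       this constant on the segment. *)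
    apply le_of_small_linear with
      ((A0 - - A0) * (M * exp ((PI * T + 1) * A0) * exp (PI * (T + 1) * (A0 + Cmod w))))%R.
    intros d Hd. specialize (Near d Hd).
    replace (CInt (h T) (- A0) A0 - F w)
      with ((CInt (h (T + d)%R) (- A0) A0 - F w) - (CInt (h (T + d)%R) (- A0) A0 - CInt (h T) (- A0) A0))
      by ring.
    eapply Rle_trans; [apply Cmod_triangle_minus|]. apply Rplus_le_compat; [exact Near|].
    rewrite <- CInt_minus by (apply Hhex; lra).
    rewrite <- Rmult_assoc, (Rmult_comm d), Rmult_assoc.
    apply Cmod_CInt_le; [lra| |].
    - apply (ex_RInt_minus (V := C_R_NormedModule)); apply Hhex; lra.
    - intros x Hx. unfold h.
      replace (F x * sincD (T + d) (x - w) - F x * sincD T (x - w))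
        with (F x * (sincD (T + d) (x - w) - sincD T (x - w))) by ring.
      rewrite Cmod_mult.
      pose proof (HM (RtoC x)) as B1. rewrite Cmod_R in B1.
      pose proof (Cmod_sincD_diff_le T d (RtoC x - w) HT ltac:(lra)) as B2.
      assert (Hax : (Rabs x <= A0)%R) by (apply Rabs_le; lra).
      assert (Hxw : (Cmod (RtoC x - w) <= A0 + Cmod w)%R).
      { eapply Rle_trans; [apply Cmod_triangle_minus|]. rewrite Cmod_R. lra. }
      replace (d * (M * exp ((PI * T + 1) * A0) * exp (PI * (T + 1) * (A0 + Cmod w))))%R
        with (M * exp ((PI * T + 1) * A0) * (d * exp (PI * (T + 1) * (A0 + Cmod w))))%R by ring.
      apply Rmult_le_compat; [apply Cmod_ge_0|apply Cmod_ge_0| |].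
      + eapply Rle_trans; [exact B1|]. apply Rmult_le_compat_l; [exact HM0|]. apply exp_le.
        apply Rmult_le_compat_l; [nra|exact Hax].
      + eapply Rle_trans; [exact B2|]. apply Rmult_le_compat_l; [lra|]. apply exp_le.
        apply Rmult_le_compat_l; [nra|exact Hxw]. }
  apply (filter_prod_infty A0). intros a b Ha Hb. simpl.
  exists (CInt (h T) a b); split.
  - exact (RInt_correct (V := C_R_CompleteNormedModule) _ _ _ (Hhex T a b HT)).
  - replace (CInt (h T) a b - F w)
      with ((CInt (h T) a b - CInt (h T) (- A0) A0) + (CInt (h T) (- A0) A0 - F w)) by ring.
    eapply Rle_lt_trans; [apply Cmod_triangle|].
    pose proof (Tail T a b ltac:(lra) Ha Hb). unfold e in *. lra.
Qed.

(** * Reproducing kernels *)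

Lemma RInt_Rmult (k : R) (f : R -> R) (a b : R) :
  ex_RInt f a b -> RInt (fun x => k * f x)%R a b = (k * RInt f a b)%R.
Proof. exact (RInt_scal (V := R_CompleteNormedModule) f a b k). Qed.

Lemma Rabs_sin_le (y : R) : (Rabs (sin y) <= Rabs y)%R.
Proof.
  pose proof (bounded_variation sin cos 1 0 y) as K.
  rewrite sin_0, !Rminus_0_r, Rmult_1_l in K. apply K. intros t _.
  split; [apply is_derive_sin|apply Rabs_le, COS_bound].
Qed.

Lemma W_Sp_bound (x : R) : (0 <= W_Sp x <= 2)%R.
Proof.
  unfold W_Sp. destruct (Req_EM_T x 0) as [_|Hx]; [lra|].
  pose proof PI_RGT_0.
  assert (Hy : (2 * PI * x <> 0)%R)
    by (apply Rmult_integral_contrapositive_currified; [lra|exact Hx]).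
  set (y := (2 * PI * x)%R) in *.
  assert (Rabs (sin y / y) <= 1)%R as B.
  { unfold Rdiv. rewrite Rabs_mult, Rabs_inv.
    assert (0 < Rabs y)%R by (apply Rabs_pos_lt, Hy).
    apply Rmult_le_reg_r with (Rabs y); [assumption|].
    rewrite Rmult_assoc, Rinv_l by lra. pose proof (Rabs_sin_le y). lra. }
  apply Rabs_le_between in B. lra.
Qed.

(** The weight vanishes at [0], but only tails enter [L2_ray]; with this lower bound weighted square
    integrability controls the unweighted tails. *)
Lemma W_Sp_ge_half (x : R) : (1 <= Rabs x)%R -> (1 / 2 <= W_Sp x)%R.
Proof.
  intros Hx. pose proof PI_ge_1 as HP. unfold W_Sp.
  destruct (Req_EM_T x 0) as [->|_]; [rewrite Rabs_R0 in Hx; lra|].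
  set (y := (2 * PI * x)%R).
  assert (Hy : (2 <= Rabs y)%R).
  { unfold y. rewrite !Rabs_mult, (Rabs_pos_eq 2), (Rabs_pos_eq PI) by lra. nra. }
  assert (Rabs (sin y / y) <= 1 / 2)%R as B.
  { unfold Rdiv at 1. rewrite Rabs_mult, Rabs_inv.
    apply Rmult_le_reg_r with (Rabs y); [lra|].
    rewrite Rmult_assoc, Rinv_l by lra.
    assert (Rabs (sin y) <= 1)%R by (apply Rabs_le, SIN_bound). lra. }
  apply Rabs_le_between in B. lra.
Qed.

Lemma continuous_W_Sp (x : R) : continuous W_Sp x.
Proof.
  apply (continuous_ext (fun t => Re (RtoC (W_Sp t)))); [reflexivity|].
  apply continuous_Re.
  apply (continuous_ext (fun t => 1 - sincD 2 (RtoC t) * / 2)); [intros t; symmetry; apply W_Sp_sincD|].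
  apply continuous_Cminus; [apply continuous_Cconst|].
  apply continuous_Cmult; [|apply continuous_Cconst].
  apply (continuous_holo_comp (sincD 2) (fun t => RtoC t)); [apply holo_sincD; lra|apply continuous_RtoC_id].
Qed.

Lemma continuous_weighted_square (F : C -> C) (x : R) :
  (forall z, holo F z) -> continuous (fun x => Cmod (F (RtoC x)) ^ 2 * W_Sp x)%R x.
Proof.
  intros HF. apply (continuous_mult (K := R_AbsRing)); [|apply continuous_W_Sp].
  apply continuous_pow2, continuous_Cmod, (continuous_holo_comp F (fun x => RtoC x));
    [apply HF|apply continuous_RtoC_id].
Qed.

Lemma is_RInt_gen_tails (f : R -> R) (l eta : R) :
  (forall x, continuous f x) -> is_RInt_gen f minus_infty plus_infty l -> (0 < eta)%R ->
  exists A0, (0 <= A0)%R /\ forall A B, (A0 <= A <= B)%R ->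
    (RInt f A B <= eta)%R /\ (RInt f (- B) (- A) <= eta)%R.
Proof.
  intros Hf H He. assert (He2 : (0 < eta / 2)%R) by lra.
  assert (Hex : forall a b, ex_RInt f a b)
    by (intros; apply (ex_RInt_continuous (V := R_CompleteNormedModule)); intros; apply Hf).
  destruct (filter_prod_infty_elim _ (proj1 (filterlimi_locally _ _) H (mkposreal _ He2)))
    as (A0 & HA0 & K).
  assert (K' : forall a b, (a <= - A0)%R -> (A0 <= b)%R -> (Rabs (RInt f a b - l) < eta / 2)%R).
  { intros a b Ha Hb. destruct (K a b Ha Hb) as (z & Hz & B). simpl in Hz.
    rewrite (is_RInt_unique _ _ _ _ Hz). exact B. }
  exists A0; split; [exact HA0|]. intros A B HAB. split.
  - pose proof (RInt_Chasles f (- A0) A B (Hex _ _) (Hex _ _)) as E.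
    change (RInt f (- A0) A + RInt f A B = RInt f (- A0) B)%R in E.
    pose proof (K' (- A0)%R A ltac:(lra) ltac:(lra)) as X1.
    pose proof (K' (- A0)%R B ltac:(lra) ltac:(lra)) as X2.
    apply Rabs_lt_between in X1. apply Rabs_lt_between in X2. lra.
  - pose proof (RInt_Chasles f (- B) (- A) A0 (Hex _ _) (Hex _ _)) as E.
    change (RInt f (- B) (- A) + RInt f (- A) A0 = RInt f (- B) A0)%R in E.
    pose proof (K' (- A)%R A0 ltac:(lra) ltac:(lra)) as X1.
    pose proof (K' (- B)%R A0 ltac:(lra) ltac:(lra)) as X2.
    apply Rabs_lt_between in X1. apply Rabs_lt_between in X2. lra.
Qed.

(** For a nonnegative function, enlarging the interval adds only the two tails, so small tails give
    the Cauchy criterion for both endpoints at once. *)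
Lemma ex_RInt_gen_of_tails (f : R -> R) :
  (forall x, continuous f x) -> (forall x, (0 <= f x)%R) ->
  (forall eta, (0 < eta)%R -> exists A0, (0 <= A0)%R /\ forall A B, (A0 <= A <= B)%R ->
     (RInt f A B <= eta)%R /\ (RInt f (- B) (- A) <= eta)%R) ->
  ex_RInt_gen f minus_infty plus_infty.
Proof.
  intros Hf Hpos H.
  assert (Hex : forall a b, ex_RInt f a b)
    by (intros; apply (ex_RInt_continuous (V := R_CompleteNormedModule)); intros; apply Hf).
  apply (filterlimi_locally_cauchy (U := R_CompleteSpace)
           (fun ab : R * R => is_RInt f (fst ab) (snd ab))).
  - apply filter_forall. intros [a b]. simpl. split; [apply Hex|].
    intros y1 y2 H1 H2. rewrite <- (is_RInt_unique _ _ _ _ H1). exact (is_RInt_unique _ _ _ _ H2).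
  - intros e. assert (He : (0 < e / 4)%R) by (pose proof (cond_pos e); lra).
    destruct (H _ He) as (A0 & HA0 & K).
    assert (Near : forall a b, (a <= - A0)%R -> (A0 <= b)%R ->
      (0 <= RInt f a b - RInt f (- A0) A0 <= e / 2)%R).
    { intros a b Ha Hb.
      pose proof (RInt_Chasles f a (- A0) A0 (Hex _ _) (Hex _ _)) as E1.
      change (RInt f a (- A0) + RInt f (- A0) A0 = RInt f a A0)%R in E1.
      pose proof (RInt_Chasles f a A0 b (Hex _ _) (Hex _ _)) as E2.
      change (RInt f a A0 + RInt f A0 b = RInt f a b)%R in E2.
      destruct (K A0 b ltac:(lra)) as [X1 _]. destruct (K A0 (- a)%R ltac:(lra)) as [_ X2].
      rewrite Ropp_involutive in X2.
      pose proof (RInt_ge_0 f a (- A0) Ha (Hex _ _) (fun x _ => Hpos x)).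
      pose proof (RInt_ge_0 f A0 b Hb (Hex _ _) (fun x _ => Hpos x)). lra. }
    exists (fun ab => fst ab <= - A0 /\ A0 <= snd ab)%R; split.
    + apply (filter_prod_infty A0). intros a b Ha Hb; split; assumption.
    + intros [a b] [a' b'] [Ha Hb] [Ha' Hb'] u v Hu Hv. simpl in *.
      rewrite <- (is_RInt_unique _ _ _ _ Hu), <- (is_RInt_unique _ _ _ _ Hv).
      pose proof (Near a b Ha Hb). pose proof (Near a' b' Ha' Hb'). pose proof (cond_pos e).
      change (Rabs (RInt f a' b' - RInt f a b) < e)%R. apply Rabs_def1; lra.
Qed.

Lemma in_space_L2_ray (G : group) (D : R) (F : C -> C) (u : R) :
  in_space G D F -> (u = 1 \/ u = -1)%R -> L2_ray F u.
Proof.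
  intros (HF & _ & l & Hl) Hu eta He. assert (He2 : (0 < eta / 2)%R) by lra.
  set (f := fun x => (Cmod (F (RtoC x)) ^ 2 * W_Sp x)%R) in *.
  assert (Hf : forall x, continuous f x) by (intros; apply continuous_weighted_square, HF).
  destruct (is_RInt_gen_tails f l _ Hf Hl He2) as (A0 & HA0 & K).
  exists (Rmax A0 1). intros A B HAB.
  pose proof (Rmax_l A0 1). pose proof (Rmax_r A0 1).
  assert (Hfu : forall r, continuous (fun r => f (u * r)%R) r).
  { intros r. apply continuous_comp; [|apply Hf].
    apply (ex_derive_continuous (V := R_NormedModule)). auto_derive; trivial. }
  assert (E : (RInt (fun r => f (u * r)) A B <= eta / 2)%R).
  { destruct (K A B ltac:(lra)) as [X1 X2]. destruct Hu as [-> | ->].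
    - rewrite (RInt_ext _ f); [exact X1|]. intros; f_equal; ring.
    - rewrite RInt_reflect in X2; [exact X2|lra|exact Hf]. }
  apply Rle_trans with (RInt (fun r => 2 * f (u * r)) A B)%R.
  - apply RInt_le; [lra| | |].
    + apply ex_RInt_continuous_on; [lra|]. intros r _.
      apply continuous_pow2, continuous_Cmod, continuous_real_axis, HF.
    + apply ex_RInt_continuous_on; [lra|]. intros r _.
      apply (continuous_scal_r (V := R_NormedModule) 2), Hfu.
    + intros r Hr. unfold f.
      assert (1 / 2 <= W_Sp (u * r))%R.
      { apply W_Sp_ge_half. rewrite Rabs_mult, (Rabs_pos_eq r) by lra.
        destruct Hu as [-> | ->]; [rewrite Rabs_R1; lra|rewrite Rabs_left; lra]. }
      pose proof (pow2_ge_0 (Cmod (F (RtoC (u * r))))). nra.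
  - rewrite (RInt_Rmult 2 (fun r => f (u * r)%R)).
    + lra.
    + apply ex_RInt_continuous_on; [lra|]. intros; apply Hfu.
Qed.

(** Beyond [Cmod w + 1] the translated kernel is bounded by [Q], so the product has tails at most
    [Q ^ 2] times those of [F]. *)
Lemma L2_ray_sinc_mult (F : C -> C) (u D : R) (w : C) :
  (forall z, holo F z) -> L2_ray F u -> (u = 1 \/ u = -1)%R -> (0 < D)%R ->
  L2_ray (fun z => F z * sincD D (z - w)) u.
Proof.
  intros HF HL Hu HD eta He. pose proof (Cmod_ge_0 w) as Hw.
  set (Q := exp (PI * D * Cmod w)). assert (HQ : (0 < Q)%R) by apply exp_pos.
  assert (HQ2 : (0 < Q ^ 2)%R) by (apply pow_lt, HQ).
  assert (He' : (0 < eta / Q ^ 2)%R) by (apply Rdiv_lt_0_compat; assumption).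
  destruct (HL _ He') as [A0 K].
  exists (Rmax A0 (Cmod w + 1)). intros A B HAB.
  pose proof (Rmax_l A0 (Cmod w + 1)). pose proof (Rmax_r A0 (Cmod w + 1)).
  specialize (K A B ltac:(lra)).
  assert (Hc : forall r, continuous (fun r => Cmod (F (RtoC (u * r))) ^ 2)%R r)
    by (intros; apply continuous_pow2, continuous_Cmod, continuous_real_axis, HF).
  apply Rle_trans with (RInt (fun r => Q ^ 2 * Cmod (F (RtoC (u * r))) ^ 2) A B)%R.
  - apply RInt_le; [lra| | |].
    + apply ex_RInt_continuous_on; [lra|]. intros r _.
      apply continuous_pow2, continuous_Cmod, (continuous_real_axis (fun z => F z * sincD D (z - w))).
      intros z; apply holo_mult; [apply HF|apply holo_sincD_shift, HD].
    + apply ex_RInt_continuous_on; [lra|]. intros r _.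
      apply (continuous_scal_r (V := R_NormedModule) (Q ^ 2)%R), Hc.
    + intros r Hr. rewrite Cmod_mult, Rpow_mult_distr, Rmult_comm.
      apply Rmult_le_compat_r; [apply pow2_ge_0|].
      apply pow_incr; split; [apply Cmod_ge_0|].
      assert (Habs : Rabs (u * r) = r).
      { destruct Hu as [-> | ->]; [rewrite Rmult_1_l, Rabs_pos_eq; lra|].
        rewrite Rabs_mult, Rabs_left, Rabs_pos_eq; lra. }
      pose proof (Cmod_sincD_shift_le D (u * r) w HD) as K1. rewrite Habs in K1.
      eapply Rle_trans; [apply K1; lra|]. fold Q.
      assert (/ (r - Cmod w) <= 1)%R by (rewrite <- Rinv_1; apply Rinv_le_contravar; lra).
      unfold Rdiv. nra.
  - rewrite (RInt_Rmult (Q ^ 2) (fun r => Cmod (F (RtoC (u * r))) ^ 2)%R).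
    + apply Rle_trans with (Q ^ 2 * (eta / Q ^ 2))%R; [apply Rmult_le_compat_l; lra|].
      right; field. lra.
    + apply ex_RInt_continuous_on; [lra|]. intros; apply Hc.
Qed.

(** Types add under multiplication, giving [2 * PI * D]. This is where [D <= 1] enters: the product
    must stay within the band [2] of the sine in the weight. *)
Lemma exp_type_sinc_mult (F : C -> C) (D : R) (w : C) :
  (0 < D <= 1)%R -> exp_type_le (PI * D) F ->
  exp_type_le (PI * 2) (fun z => F z * sincD D (z - w)).
Proof.
  intros HD HF e He. destruct (HF e He) as [M HM]. pose proof PI_RGT_0 as HP.
  assert (HM0 : (0 <= M)%R).
  { pose proof (HM 0). pose proof (Cmod_ge_0 (F 0)). pose proof (exp_pos ((PI * D + e) * Cmod 0)). nra. }
  exists (M * (D * exp (PI * D * Cmod w)))%R. intros z. rewrite Cmod_mult.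
  pose proof (Cmod_sincD_le D (z - w) ltac:(lra)) as K.
  pose proof (Cmod_triangle_minus z w) as Hzw. pose proof (Cmod_ge_0 z) as Hz.
  assert (HPD : (0 < PI * D <= PI)%R) by nra.
  apply Rle_trans with (M * exp ((PI * D + e) * Cmod z) * (D * exp (PI * D * (Cmod z + Cmod w))))%R.
  - apply Rmult_le_compat; [apply Cmod_ge_0|apply Cmod_ge_0|apply HM|].
    eapply Rle_trans; [exact K|]. apply Rmult_le_compat_l; [lra|]. apply exp_le.
    apply Rmult_le_compat_l; lra.
  - rewrite Rmult_plus_distr_l, exp_plus.
    replace (M * exp ((PI * D + e) * Cmod z) * (D * (exp (PI * D * Cmod z) * exp (PI * D * Cmod w))))%R
      with (M * (D * exp (PI * D * Cmod w)) * (exp ((PI * D + e) * Cmod z) * exp (PI * D * Cmod z)))%R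
      by ring.
    rewrite <- exp_plus. apply Rmult_le_compat_l.
    + apply Rmult_le_pos; [exact HM0|]. apply Rmult_le_pos; [lra|left; apply exp_pos].
    + apply exp_le. nra.
Qed.

(** * The explicit kernel *)

Definition SOodd_kernel (D : R) (w z : C) : C :=
  sincD D (z - Cconj w) - / (RtoC (2 + D)%R) * sincD D z * sincD D (Cconj w).

Lemma Cmod_inv_le_1 (D : R) : (0 < D)%R -> (Cmod (/ RtoC (2 + D)) <= 1)%R.
Proof.
  intros HD. rewrite Cmod_inv by (apply RtoC_neq_0; lra).
  rewrite Cmod_R, Rabs_pos_eq by lra. rewrite <- Rinv_1. apply Rinv_le_contravar; lra.
Qed.

(** The type comes from the bound on [sincD] in the plane; integrability comes from its decay like
    [1 / |x|] on the real line, squared, together with [W_Sp <= 2]. *)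
Lemma SOodd_kernel_in_space (G : group) (D : R) (w : C) :
  (0 < D)%R -> in_space G D (SOodd_kernel D w).
Proof.
  intros HD. pose proof PI_RGT_0 as HP. pose proof (Cmod_ge_0 w) as Hw.
  assert (HPD : (0 < PI * D)%R) by (apply Rmult_lt_0_compat; assumption).
  set (k := Cmod (sincD D (Cconj w))). assert (Hk : (0 <= k)%R) by apply Cmod_ge_0.
  pose proof (Cmod_inv_le_1 D HD) as Hi. pose proof (Cmod_ge_0 (/ RtoC (2 + D))) as Hi0.
  assert (Hent : forall z, holo (SOodd_kernel D w) z).
  { intros z. unfold SOodd_kernel. apply holo_minus; [apply holo_sincD_shift, HD|].
    apply holo_mult; [|apply holo_const]. apply holo_mult; [apply holo_const|apply holo_sincD, HD]. }
  assert (Hmod : forall z, (Cmod (SOodd_kernel D w z) <=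
    Cmod (sincD D (z - Cconj w)) + k * Cmod (sincD D z))%R).
  { intros z. unfold SOodd_kernel. eapply Rle_trans; [apply Cmod_triangle_minus|].
    apply Rplus_le_compat_l. rewrite !Cmod_mult. fold k. rewrite Rmult_comm.
    apply Rmult_le_compat_l; [exact Hk|]. pose proof (Cmod_ge_0 (sincD D z)). nra. }
  split; [exact Hent|]. split.
  - intros e He. exists (D * exp (PI * D * Cmod w) + k * D)%R. intros z.
    pose proof (Cmod_ge_0 z) as Hz.
    eapply Rle_trans; [apply Hmod|]. rewrite Rmult_plus_distr_r.
    assert (HE : (exp (PI * D * Cmod z) <= exp ((PI * D + e) * Cmod z))%R) by (apply exp_le; nra).
    apply Rplus_le_compat.
    + eapply Rle_trans; [apply Cmod_sincD_le, HD|]. rewrite (Rmult_assoc D).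
      apply Rmult_le_compat_l; [lra|].
      apply Rle_trans with (exp (PI * D * Cmod w) * exp (PI * D * Cmod z))%R.
      * rewrite <- exp_plus. apply exp_le. rewrite <- Rmult_plus_distr_l.
        apply Rmult_le_compat_l; [lra|].
        pose proof (Cmod_triangle_minus z (Cconj w)) as X. rewrite Cmod_conj in X. lra.
      * apply Rmult_le_compat_l; [left; apply exp_pos|exact HE].
    + rewrite (Rmult_assoc k). apply Rmult_le_compat_l; [exact Hk|].
      eapply Rle_trans; [apply Cmod_sincD_le, HD|]. apply Rmult_le_compat_l; [lra|exact HE].
  - set (f := fun x => (Cmod (SOodd_kernel D w (RtoC x)) ^ 2 * W_Sp x)%R).
    assert (Hf : forall x, continuous f x) by (intros; apply continuous_weighted_square, Hent).
    set (m := Cmod w). set (Q := (exp (PI * D * m) + k)%R).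
    assert (HQ : (0 < Q)%R) by (pose proof (exp_pos (PI * D * m)); unfold Q; lra).
    assert (Hb : forall x, (m < Rabs x)%R -> (f x <= 2 * Q ^ 2 * (/ (Rabs x - m)) ^ 2)%R).
    { intros x Hx. unfold f.
      assert (HK : (Cmod (SOodd_kernel D w (RtoC x)) <= Q * / (Rabs x - m))%R).
      { eapply Rle_trans; [apply Hmod|]. unfold Q. rewrite Rmult_plus_distr_r.
        apply Rplus_le_compat.
        - pose proof (Cmod_sincD_shift_le D x (Cconj w) HD) as X. rewrite Cmod_conj in X.
          apply X, Hx.
        - apply Rmult_le_compat_l; [exact Hk|].
          pose proof (Cmod_sincD_shift_le D x 0 HD) as X.
          rewrite Cmod_0, Rmult_0_r, exp_0, Rminus_0_r in X.
          replace (RtoC x - 0) with (RtoC x) in X by ring.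
          assert (Hx0 : (0 < Rabs x)%R) by (unfold m in Hx; lra).
          eapply Rle_trans; [apply X, Hx0|]. unfold Rdiv. rewrite Rmult_1_l.
          apply Rinv_le_contravar; unfold m in *; lra. }
      assert (HK2 : (Cmod (SOodd_kernel D w (RtoC x)) ^ 2 <= Q ^ 2 * (/ (Rabs x - m)) ^ 2)%R).
      { rewrite <- Rpow_mult_distr. apply pow_incr; split; [apply Cmod_ge_0|exact HK]. }
      pose proof (W_Sp_bound x). pose proof (pow2_ge_0 (Cmod (SOodd_kernel D w (RtoC x)))). nra. }
    apply ex_RInt_gen_of_tails; [exact Hf| |].
    + intros x. apply Rmult_le_pos; [apply pow2_ge_0|apply W_Sp_bound].
    + intros eta He.
      assert (HQe : (0 < 2 * Q ^ 2 / eta)%R).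
      { apply Rdiv_lt_0_compat; [|exact He]. pose proof (pow_lt Q 2 HQ). lra. }
      (* The tail of the dominating function is at most [2 * Q ^ 2 / (A - m)], hence at most [eta]
         from here on. *)
      exists (m + 1 + 2 * Q ^ 2 / eta)%R. split; [unfold m; lra|].
      assert (Gen : forall u, (u = 1 \/ u = -1)%R -> forall A B,
        (m + 1 + 2 * Q ^ 2 / eta <= A <= B)%R -> (RInt (fun r => f (u * r)) A B <= eta)%R).
      { intros u Hu A B HAB.
        apply Rle_trans with (RInt (fun r => 2 * Q ^ 2 * (/ (r - m)) ^ 2) A B)%R.
        - apply RInt_le; [lra| | |].
          + apply ex_RInt_continuous_on; [lra|]. intros r _.
            apply continuous_comp; [|apply Hf].
            apply (ex_derive_continuous (V := R_NormedModule)). auto_derive; trivial.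
          + apply ex_RInt_continuous_on; [lra|]. intros r Hr.
            apply (continuous_scal_r (V := R_NormedModule) (2 * Q ^ 2)%R), continuous_inv_sqr. lra.
          + intros r Hr.
            assert (Habs : Rabs (u * r) = r).
            { destruct Hu as [-> | ->]; [rewrite Rmult_1_l, Rabs_pos_eq; unfold m in *; lra|].
              rewrite Rabs_mult, Rabs_left, Rabs_pos_eq; unfold m in *; lra. }
            rewrite <- Habs at 2. apply Hb. rewrite Habs. lra.
        - rewrite (RInt_Rmult (2 * Q ^ 2) (fun r => (/ (r - m)) ^ 2)%R).
          + pose proof (RInt_inv_sqr_le m A B ltac:(lra)) as X.
            assert (X2 : (/ (A - m) <= / (2 * Q ^ 2 / eta))%R) by (apply Rinv_le_contravar; lra).
            apply Rle_trans with (2 * Q ^ 2 * / (2 * Q ^ 2 / eta))%R.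
            * apply Rmult_le_compat_l; [|lra]. pose proof (pow2_ge_0 Q). lra.
            * right. field. split; lra.
          + apply ex_RInt_continuous_on; [lra|]. intros r Hr. apply continuous_inv_sqr. lra. }
      intros A B HAB. split.
      * rewrite (RInt_ext _ (fun r => f (1 * r)%R)); [|intros; f_equal; ring].
        apply Gen; [left; reflexivity|exact HAB].
      * rewrite RInt_reflect; [|lra|exact Hf]. apply Gen; [right; reflexivity|exact HAB].
Qed.

(* Since [F k_w] has type at most [2 pi], integrating it against [sin (2 pi x) / (2 pi x)] gives
   half its value at [0]; hence [<F, k_w>] for the weight [W_Sp] is [F w - F 0 k_w(0) / 2]. *)
Lemma weighted_sinc_integral (D : R) (F : C -> C) (w : C) :
  (0 < D <= 1)%R -> in_space SOodd D F ->
  is_CInt_gen (fun x => F (RtoC x) * sincD D (RtoC x - w) * RtoC (W_Sp x))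
    (F w - F 0 * sincD D w / 2).
Proof.
  intros HD HF.
  pose proof (in_space_L2_ray _ _ _ _ HF (or_introl eq_refl)) as L1.
  pose proof (in_space_L2_ray _ _ _ _ HF (or_intror eq_refl)) as L2.
  destruct HF as (HE & HT & _).
  pose proof (sinc_reproduces F D w ltac:(lra) HE HT L1 L2) as I1.
  set (H := fun z => F z * sincD D (z - w)).
  assert (I2 : is_CInt_gen (fun x => H (RtoC x) * sincD 2 (RtoC x - 0)) (H 0)).
  { apply sinc_reproduces; [lra| |apply exp_type_sinc_mult; assumption| |].
    - intros z. apply holo_mult; [apply HE|apply holo_sincD_shift; lra].
    - apply L2_ray_sinc_mult; try assumption; [left; reflexivity|lra].
    - apply L2_ray_sinc_mult; try assumption; [right; reflexivity|lra]. }
  pose proof (is_CInt_gen_plus _ _ _ _ I1 (is_CInt_gen_Cmult (- / 2) _ _ I2)) as I3.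
  replace (F w - F 0 * sincD D w / 2) with (F w + - / 2 * H 0).
  - refine (is_CInt_gen_ext _ _ _ _ I3). intros x. unfold H. rewrite W_Sp_sincD.
    replace (RtoC x - 0) with (RtoC x) by ring. unfold Cdiv. ring.
  - unfold H. replace (0 - w) with (- w) by ring. rewrite sincD_opp. unfold Cdiv. ring.
Qed.

(** Origin of [2 + D]: let [k = sincD D w] and subtract from the sinc kernel at [w] a multiple of
    the one at [0], with conjugated coefficient [c]. The weighted integral is
    [F w - F 0 k / 2 - c (F 0 - F 0 D / 2)], and the atom adds [F 0 (k - c D)]. The terms in [F 0]
    cancel exactly when [c (1 + D / 2) = k / 2], that is [c = k / (2 + D)]. *)
Lemma SOodd_kernel_reproducing (D : R) :
  (0 < D <= 1)%R -> is_repr_kernel SOodd D (SOodd_kernel D).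
Proof.
  intros HD w. split; [apply SOodd_kernel_in_space; lra|]. intros F HF.
  pose proof (weighted_sinc_integral D F w HD HF) as I1.
  pose proof (weighted_sinc_integral D F 0 HD HF) as I2.
  assert (H2D : RtoC (2 + D) <> 0) by (apply RtoC_neq_0; lra).
  assert (Hconj : forall z, Cconj (SOodd_kernel D w z)
    = sincD D (Cconj z - w) - / RtoC (2 + D) * sincD D (Cconj z) * sincD D w).
  { intros z. unfold SOodd_kernel. rewrite Cminus_conj, !Cmult_conj, Cconj_inv_neq_0 by exact H2D.
    rewrite Cconj_RtoC, <- !sincD_conj, Cminus_conj, !Cconj_conj. reflexivity. }
  pose proof (is_CInt_gen_plus _ _ _ _ I1
    (is_CInt_gen_Cmult (- (sincD D w / RtoC (2 + D))) _ _ I2)) as I3.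
  unfold inner_is, atom. rewrite Hconj, Cconj_RtoC, sincD_0.
  replace (F w - F 0 * (sincD D (0 - w) - / RtoC (2 + D) * RtoC D * sincD D w))
    with (F w - F 0 * sincD D w / 2
          + - (sincD D w / RtoC (2 + D)) * (F 0 - F 0 * sincD D 0 / 2)).
  - refine (is_CInt_gen_ext _ _ _ _ I3). intros x. rewrite Hconj, Cconj_RtoC.
    replace (RtoC x - 0) with (RtoC x) by ring. unfold Cdiv. ring.
  - replace (0 - w) with (- w) by ring. rewrite sincD_opp, sincD_0.
    rewrite RtoC_plus in *. field; C_neq.
Qed.

(** * Hermitian symmetry, uniqueness and adding the atom *)

Lemma atom_conj (G : group) (F H : C -> C) : Cconj (atom G F H) = atom G H F.
Proof.
  destruct G; simpl; [apply Cconj_RtoC|]. rewrite Cmult_conj, Cconj_conj. ring.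
Qed.

Lemma inner_is_conj (G : group) (F H : C -> C) (v : C) :
  inner_is G F H v -> inner_is G H F (Cconj v).
Proof.
  intros I. unfold inner_is in *. apply is_CInt_gen_conj in I.
  rewrite Cminus_conj, atom_conj in I. refine (is_CInt_gen_ext _ _ _ _ I).
  intros x. rewrite !Cmult_conj, Cconj_conj, Cconj_RtoC. ring.
Qed.

Lemma inner_is_unique (G : group) (F H : C -> C) (u v : C) :
  inner_is G F H u -> inner_is G F H v -> u = v.
Proof.
  intros Hu Hv. pose proof (is_CInt_gen_unique _ _ _ Hu Hv) as E.
  replace u with (u - atom G F H + atom G F H) by ring. rewrite E. ring.
Qed.

(** The inner product of [K w] with [K' z] is evaluated twice: [K'] reproduces [K w] at [z], and,
    after conjugation, [K] reproduces [K' z] at [w]. The version with two kernels also yields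
    uniqueness, by comparison with the case of [K'] and itself. *)
Lemma repr_kernel_hermitian (G : group) (D : R) (K K' : C -> C -> C) (w z : C) :
  is_repr_kernel G D K -> is_repr_kernel G D K' -> K w z = Cconj (K' z w).
Proof.
  intros HK HK'. apply (inner_is_unique G (K w) (K' z)).
  - apply HK', HK.
  - apply inner_is_conj, HK, HK'.
Qed.

Lemma repr_kernel_unique (G : group) (D : R) (K K' : C -> C -> C) :
  is_repr_kernel G D K -> is_repr_kernel G D K' -> K = K'.
Proof.
  intros HK HK'. apply functional_extensionality; intros w.
  apply functional_extensionality; intros z.
  rewrite (repr_kernel_hermitian G D K K' w z HK HK').
  symmetry. exact (repr_kernel_hermitian G D K' K' w z HK' HK').
Qed.

(** [K 0 0] is the squared norm of [K 0], hence has nonnegative real part, and it is real by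
    Hermitian symmetry. *)
Lemma Sp_kernel_00 (D : R) (K : C -> C -> C) :
  is_repr_kernel Sp D K -> 1 + K 0 0 <> 0 /\ Cconj (K 0 0) = K 0 0.
Proof.
  intros HK. split.
  - destruct (HK 0) as [H0 HF]. specialize (HF _ H0). unfold inner_is, atom in HF.
    apply is_CInt_gen_Re in HF.
    assert (0 <= Re (K 0 0 - RtoC 0))%R as Hpos.
    { refine (is_RInt_gen_ge_0 _ _ _ HF). intros x.
      pose proof (W_Sp_bound x). destruct (K 0 (RtoC x)) as [a b]. simpl. nra. }
    intros E. apply (f_equal Re) in E. simpl in *. unfold Re in *. lra.
  - symmetry. exact (repr_kernel_hermitian Sp D K K 0 0 HK HK).
Qed.

Lemma Cmod_sqr_combination (a b c : C) :
  (Cmod (a - c * b) ^ 2 =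
   Cmod a ^ 2 + (Cmod c ^ 2 * Cmod b ^ 2 + -2 * Re (Cconj c * (a * Cconj b))))%R.
Proof. rewrite !Cmod2_alt. destruct a, b, c. simpl. ring. Qed.

(** The square is expanded by [Cmod_sqr_combination]. Its cross term is integrable without
    Cauchy-Schwarz, because the reproducing property of [K 0] already asserts convergence of the
    integral of [F] against it. *)
Lemma in_space_combination (D : R) (K : C -> C -> C) (F : C -> C) (c : C) :
  is_repr_kernel Sp D K -> in_space Sp D F -> in_space SOodd D (fun z => F z - c * K 0 z).
Proof.
  intros HK HF. destruct (HK 0) as [HK0 Hin]. specialize (Hin F HF).
  destruct HF as (HE & HT & l & Hl). destruct HK0 as (HE0 & HT0 & l0 & Hl0).
  split; [|split].
  - intros z. apply holo_minus; [apply HE|]. apply holo_mult; [apply holo_const|apply HE0].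
  - intros e He. destruct (HT e He) as [M HM]. destruct (HT0 e He) as [M0 HM0].
    exists (M + Cmod c * M0)%R. intros z.
    eapply Rle_trans; [apply Cmod_triangle_minus|]. rewrite Cmod_mult, Rmult_plus_distr_r.
    apply Rplus_le_compat; [apply HM|]. rewrite Rmult_assoc.
    apply Rmult_le_compat_l; [apply Cmod_ge_0|apply HM0].
  - unfold inner_is in Hin.
    pose proof (is_CInt_gen_Re _ _ (is_CInt_gen_Cmult (Cconj c) _ _ Hin)) as Hre.
    pose proof (is_RInt_gen_plus _ _ _ _ Hl
      (is_RInt_gen_plus _ _ _ _ (is_RInt_gen_scal _ (Cmod c ^ 2)%R _ Hl0)
         (is_RInt_gen_scal _ (-2)%R _ Hre))) as H.
    eexists. refine (is_RInt_gen_ext _ _ _ _ H).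
    apply filter_forall. intros ab x _. cbv beta. rewrite Cmod_sqr_combination.
    unfold plus, scal; simpl; unfold mult; simpl. ring.
Qed.

(** A rank-one update. Against [K w - c K 0] the [Sp] pairing gives [F w - Cconj c * F 0], and the
    atom adds [F 0 * Cconj (K w 0 - c * K 0 0)]. The extra terms cancel exactly when
    [K w 0 = c * (1 + K 0 0)], since [K 0 0] is real. *)
Lemma SOodd_kernel_of_Sp (D : R) (K : C -> C -> C) :
  is_repr_kernel Sp D K ->
  is_repr_kernel SOodd D
    (fun w z => K w z - K w (RtoC 0) / (1 + K (RtoC 0) (RtoC 0)) * K (RtoC 0) z).
Proof.
  intros HK w. destruct (Sp_kernel_00 D K HK) as [Hnz Hreal].
  set (c := K w (RtoC 0) / (1 + K (RtoC 0) (RtoC 0))). split.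
  - apply in_space_combination; [exact HK|apply HK].
  - intros F HF. destruct (HK w) as [_ I1]. destruct (HK 0) as [_ I2].
    (* [HF] is membership for [SOodd]; the condition is the same for both groups, so the [Sp]
       reproducing property applies to [F]. *)
    specialize (I1 F HF). specialize (I2 F HF). unfold inner_is in *.
    pose proof (is_CInt_gen_plus _ _ _ _ I1 (is_CInt_gen_Cmult (- Cconj c) _ _ I2)) as I3.
    simpl atom in *.
    replace (F w - F 0 * Cconj (K w 0 - c * K 0 0))
      with (F w - 0 + - Cconj c * (F 0 - 0)).
    + refine (is_CInt_gen_ext _ _ _ _ I3). intros x. rewrite Cminus_conj, Cmult_conj. ring.
    + assert (E : Cconj (K w 0) = Cconj c * (1 + K 0 0)).
      { rewrite <- Hreal at 1. rewrite <- (Cconj_RtoC 1).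
        rewrite <- Cplus_conj, <- Cmult_conj. f_equal. unfold c. field. exact Hnz. }
      rewrite Cminus_conj, Cmult_conj, Hreal, E. ring.
Qed.

Theorem theorem7 :
  (forall D : R, (0 < D <= 1)%R ->
     forall K : C -> C -> C,
       is_repr_kernel SOodd D K <->
       K = (fun w z : C =>
              sincD D (z - Cconj w)
              - / (RtoC (2 + D)%R) * sincD D z * sincD D (Cconj w)))
  /\
  (forall D : R, (0 < D)%R ->
     forall KSp : C -> C -> C, is_repr_kernel Sp D KSp ->
     forall K : C -> C -> C,
       is_repr_kernel SOodd D K <->
       K = (fun w z : C =>
              KSp w z - KSp w (RtoC 0) / (1 + KSp (RtoC 0) (RtoC 0)) * KSp (RtoC 0) z)).
Proof.
  split.
  - intros D HD K. pose proof (SOodd_kernel_reproducing D HD) as H. split.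
    + intros HK. exact (repr_kernel_unique SOodd D K (SOodd_kernel D) HK H).
    + intros ->. exact H.
  - intros D HD KSp HS K. pose proof (SOodd_kernel_of_Sp D KSp HS) as H. split.
    + intros HK. exact (repr_kernel_unique SOodd D K _ HK H).
    + intros ->. exact H.
Qed.
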